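(* Let $\Gamma$ be a finite, compact metric graph and let $H$ be a Schr\''odinger operator in $L^2(\Gamma)$ with real-valued potential $q \in L^\infty(\Gamma)$ and local, self-adjoint vertex conditions at the vertices. Assume that $v_1, v_2$ are two distinct vertices of $\Gamma$ and that the vertex conditions of $H$ at $v_1$ and $v_2$ are of type I, i.e. of $\delta$-type with coefficients $\alpha_{v_1}, \alpha_{v_2} \in \mathbb{R}$ (coefficient zero corresponds to a Kirchhoff condition). Denote by $\widetilde\Gamma$ the graph obtained from $\Gamma$ by joining $v_1$ and $v_2$ to form one single vertex $v_0$. Let $\widetilde H$ be the self-adjoint Schr\''odinger operator in $L^2(\widetilde\Gamma)$ with potential $q$ having the same vertex conditions as $H$ at all vertices apart from $v_0$ and satisfying a $\delta$-type condition with coefficient $\alpha_{v_0} := \alpha_{v_1} + \alpha_{v_2}$ at $v_0$. Then $$\lambda_k(H) \leq \lambda_k(\widetilde H)$$ holds for all $k \in \mathbb{N}$ (with $\mathbb{N} = \{1,2,\dots\}$).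
   Context: Metric graphs. A finite, compact metric graph $\Gamma$ consists of a finite vertex set $V$, a finite edge set $E$ (loops and multiple edges are allowed) and a length function $L : E \to (0,\infty)$. Each edge $e$ is identified with the interval $[0, L(e)]$; the endpoint $0$ is attached to the initial vertex of $e$ and the endpoint $L(e)$ to its terminal vertex (these coincide if $e$ is a loop). For $v \in V$, $E_{v,\mathrm{i}}$ (resp. $E_{v,\mathrm{t}}$) is the set of edges with initial (resp. terminal) vertex $v$, and $\deg(v) = |E_{v,\mathrm{i}}| + |E_{v,\mathrm{t}}|$. One sets $L^2(\Gamma) = \bigoplus_{e \in E} L^2(0,L(e))$ and $\widetilde H^k(\Gamma) = \bigoplus_{e\in E} H^k(0,L(e))$; $f_e$ denotes the restriction of $f$ to $e$. A function $f\in \widetilde H^1(\Gamma)$ is continuous at $v$ if all the boundary values of $f$ at $v$ along the edges incident to $v$ coincide; the common value is $f(v)$. Boundary vectors. For $v \in V$ fix enumerations $e_1,\dots,e_l$ of $E_{v,\mathrm{i}}$ and $e_{l+1},\dots,e_m$ of $E_{v,\mathrm{t}}$, $m = \deg(v)$, and put $F(v) = (f_{e_1}(0),\dots,f_{e_l}(0), f_{e_{l+1}}(L(e_{l+1})),\dots,f_{e_m}(L(e_m)))^\top$ and $F'(v) = (f'_{e_1}(0),\dots,f'_{e_l}(0), -f'_{e_{l+1}}(L(e_{l+1})),\dots,-f'_{e_m}(L(e_m)))^\top$, with components $F_j(v)$, $F_j'(v)$. Operators. Local, self-adjoint vertex conditions at $v$ are given by orthogonal projections $P_{v,\mathrm D},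 P_{v,\mathrm N}, P_{v,\mathrm R}$ in $\mathbb{C}^{\deg(v)}$ with mutually orthogonal ranges and sum $I$, and a self-adjoint invertible operator $\Lambda_v$ in $\operatorname{ran} P_{v,\mathrm R}$; the conditions read $P_{v,\mathrm D}F(v) = 0$, $P_{v,\mathrm N}F'(v) = 0$, $P_{v,\mathrm R}F'(v) = \Lambda_v P_{v,\mathrm R}F(v)$. The Schr\''odinger operator with real-valued potential $q \in L^\infty(\Gamma)$ and such conditions at every vertex is the self-adjoint operator $H$ in $L^2(\Gamma)$ with $(Hf)_e = -f_e'' + q_e f_e$ for $e\in E$, whose domain consists of all $f \in \widetilde H^2(\Gamma)$ satisfying the conditions at each $v \in V$. Its spectrum is purely discrete and bounded from below; $\lambda_1(H) \le \lambda_2(H) \le \dots$ denote its eigenvalues in non-decreasing order, counted with multiplicities. Type I conditions. A $\delta$-type condition at $v$ with coefficient $\alpha_v \in \mathbb{R}$ means: $f$ is continuous at $v$ and $\sum_{j=1}^{\deg(v)} F_j'(v) = \alpha_v f(v)$. For $\alpha_v = 0$ it is called a Kirchhoff condition. Type I means a condition of this form. Joining vertices. Two vertices $v_1, v_2$ of $\Gamma$ are joined to one vertex $v_0$ if $v_1$ and $v_2$ are removed from $V$ and, instead, a vertex $v_0$ with $E_{v_0,\mathrm i} := E_{v_1,\mathrm i} \cup E_{v_2,\mathrm i}$ and $E_{v_0,\mathrm t} := E_{v_1,\mathrm t} \cup E_{v_2,\mathrm t}$ is introduced. The edge set and edge lengths are unchanged, so $L^2(\Gamma)$ and $L^2(\widetilde\Gamma)$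 are identified. *)

(* Defs.v *)
From HB Require Import structures.
From mathcomp Require Import all_boot all_order all_algebra.
From mathcomp Require Import complex.
From mathcomp Require Import all_classical all_reals all_analysis.

Set Implicit Arguments.
Unset Strict Implicit.
Unset Printing Implicit Defensive.

Import Order.TTheory GRing.Theory Num.Theory.

Local Open Scope classical_set_scope.
Local Open Scope ring_scope.
Local Open Scope complex_scope.

(* The incidence sets E_{v,i} = [outE v] and E_{v,t} = [inE v] are primitive:
   every edge has exactly one initial and exactly one terminal vertex.  Loops,
   multiple edges, and disconnected graphs are allowed.  With this encoding the
   incidence sets of a vertex not involved in a joining are unchanged
   definitionally, so its vertex condition can be kept as it is. *)
Record metric_graph (R : realType) := MetricGraph {
  vertex : finType ;
  edge : finType ;
  outE : vertex -> {set edge} ;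
  inE : vertex -> {set edge} ;
  outE_unique : forall e, exists! v, e \in outE v ;
  inE_unique : forall e, exists! v, e \in inE v ;
  len : edge -> R ;
  len_gt0 : forall e, 0 < len e
}.

Arguments outE {R} _ _.
Arguments inE {R} _ _.
Arguments len {R} _ _.

(* A loop at v counts twice. *)
Definition deg (R : realType) (G : metric_graph R) (v : vertex G) : nat :=
  (#|outE G v| + #|inE G v|)%N.

(* Representatives of elements of L^2(G); only the values of [f e] on
   [0, len G e] matter. *)
Definition graph_fun (R : realType) (G : metric_graph R) : Type :=
  edge G -> R -> R[i].

Definition eq_L2 (R : realType) (G : metric_graph R) (f g : graph_fun G) : Prop :=
  forall e, f e = g e %[ae (@lebesgue_measure R) in `[0, len G e]%classic].

Definition essentially_bounded (R : realType) (G : metric_graph R)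
    (q : edge G -> R -> R) : Prop :=
  forall e, measurable_fun `[0, len G e]%classic (q e) /\
    exists M : R, \forall x \ae (@lebesgue_measure R),
      x \in `[0, len G e] -> `|q e x| <= M.

Definition in_L2 (R : realType) (l : R) (f : R -> R[i]) : Prop :=
  [/\ measurable_fun `[0, l]%classic (fun x => complex.Re (f x)),
      measurable_fun `[0, l]%classic (fun x => complex.Im (f x)) &
      (\int[@lebesgue_measure R]_(x in `[0%R, l]%classic)
         (complex.Re (f x) ^+ 2 + complex.Im (f x) ^+ 2)%:E < +oo)%E].

Definition cintegral (R : realType) (D : set R) (f : R -> R[i]) : R[i] :=
  (\int[@lebesgue_measure R]_(x in D) complex.Re (f x))
  +i* (\int[@lebesgue_measure R]_(x in D) complex.Im (f x)).

(* f is the (absolutely) continuous representative on [0, l] of an element of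
   H^1(0, l), and f' is its weak derivative; f 0 and f l are then the boundary
   values of f. *)
Definition in_H1 (R : realType) (l : R) (f f' : R -> R[i]) : Prop :=
  in_L2 l f' /\
  forall x, x \in `[0, l] -> f x = f 0 + cintegral `[0, x]%classic f'.

Definition in_H2 (R : realType) (l : R) (f f' f'' : R -> R[i]) : Prop :=
  in_H1 l f f' /\ in_H1 l f' f''.

(* F(v); the enumerations of E_{v,i} and E_{v,t} are those of [enum]. *)
Definition bdry_val (R : realType) (G : metric_graph R) (f : graph_fun G)
    (v : vertex G) : 'cV[R[i]]_(deg v) :=
  col_mx (\col_(j < #|outE G v|) f (enum_val j) 0)
         (\col_(j < #|inE G v|) f (enum_val j) (len G (enum_val j))).

(* F'(v), where f' is the edgewise derivative: derivatives are taken in the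
   direction pointing into the edge. *)
Definition bdry_der (R : realType) (G : metric_graph R) (f' : graph_fun G)
    (v : vertex G) : 'cV[R[i]]_(deg v) :=
  col_mx (\col_(j < #|outE G v|) f' (enum_val j) 0)
         (\col_(j < #|inE G v|) - f' (enum_val j) (len G (enum_val j))).

(* The operator Lambda_v in ran P_{v,R} is represented by the matrix [vcL] of
   its extension by 0 to (ran P_{v,R})^\perp; [vcL_inv] says that it is
   invertible in ran P_{v,R}. *)
Record vertex_condition (R : realType) (m : nat) := VertexCondition {
  vcD : 'M[R[i]]_m ;
  vcN : 'M[R[i]]_m ;
  vcR : 'M[R[i]]_m ;
  vcL : 'M[R[i]]_m ;
  vcD_proj : vcD \is hermsymmx /\ vcD *m vcD = vcD ;
  vcN_proj : vcN \is hermsymmx /\ vcN *m vcN = vcN ;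
  vcR_proj : vcR \is hermsymmx /\ vcR *m vcR = vcR ;
  vc_orth : [/\ vcD *m vcN = 0, vcD *m vcR = 0 & vcN *m vcR = 0] ;
  vc_sum : vcD + vcN + vcR = 1%:M ;
  vcL_ran : vcR *m vcL *m vcR = vcL ;
  vcL_herm : vcL \is hermsymmx ;
  vcL_inv : exists K : 'M[R[i]]_m,
    [/\ vcR *m K *m vcR = K, vcL *m K = vcR & K *m vcL = vcR]
}.

Definition vc_holds (R : realType) (m : nat) (c : vertex_condition R m)
    (F F' : 'cV[R[i]]_m) : Prop :=
  [/\ vcD c *m F = 0, vcN c *m F' = 0 &
      vcR c *m F' = vcL c *m (vcR c *m F)].

(* The complex number z is the common value f(v). *)
Definition delta_holds (R : realType) (m : nat) (alpha : R)
    (F F' : 'cV[R[i]]_m) : Prop :=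
  exists z : R[i], (forall j, F j 0 = z) /\ \sum_j F' j 0 = alpha%:C * z.

Definition delta_type (R : realType) (m : nat) (alpha : R)
    (c : vertex_condition R m) : Prop :=
  forall F F' : 'cV[R[i]]_m, vc_holds c F F' <-> delta_holds alpha F F'.

Definition conditions (R : realType) (G : metric_graph R) : Type :=
  forall v : vertex G, vertex_condition R (deg v).

(* The graph of the operator H: f is in dom H, and g represents H f. *)
Definition schrodinger (R : realType) (G : metric_graph R)
    (q : edge G -> R -> R) (c : conditions G) (f g : graph_fun G) : Prop :=
  exists f' f'' : graph_fun G,
    [/\ forall e, in_H2 (len G e) (f e) (f' e) (f'' e),
        forall v, vc_holds (c v) (bdry_val f v) (bdry_der f' v) &
        eq_L2 g (fun e x => - f'' e x + (q e x)%:C * f e x)].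

Definition in_eigenspace (R : realType) (G : metric_graph R)
    (H : graph_fun G -> graph_fun G -> Prop) (mu : R) (f : graph_fun G) : Prop :=
  H f (fun e x => mu%:C * f e x).

Definition lincomb (R : realType) (G : metric_graph R) (n : nat)
    (a : 'I_n -> R[i]) (phi : 'I_n -> graph_fun G) : graph_fun G :=
  fun e x => \sum_i a i * phi i e x.

(* dim ker (H - mu) = n as a complex subspace of L^2(G); n = 0 means that mu is
   not an eigenvalue. *)
Definition multiplicity (R : realType) (G : metric_graph R)
    (H : graph_fun G -> graph_fun G -> Prop) (mu : R) (n : nat) : Prop :=
  exists phi : 'I_n -> graph_fun G,
    [/\ forall i, in_eigenspace H mu (phi i),
        forall a, eq_L2 (lincomb a phi) (fun _ _ => 0) -> forall i, a i = 0 &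
        forall f, in_eigenspace H mu f -> exists a, eq_L2 f (lincomb a phi)].

(* lam lists all eigenvalues of H in non-decreasing order, each one as often as
   its multiplicity.  Indices start at 0: lam k is lambda_{k+1}(H). *)
Definition eigenvalues (R : realType) (G : metric_graph R)
    (H : graph_fun G -> graph_fun G -> Prop) (lam : nat -> R) : Prop :=
  (forall i j, (i <= j)%N -> lam i <= lam j) /\
  (forall mu : R, exists s : seq nat,
     [/\ uniq s, forall k, k \in s <-> lam k = mu & multiplicity H mu (size s)]).

Section Join.
Variables (R : realType) (G : metric_graph R) (v1 v2 : vertex G).

(* [None] is the new vertex v0; [Some v] is an old vertex other than v1, v2. *)
Definition join_vertex : finType :=
  option {v : vertex G | (v != v1) && (v != v2)}.

Definition join_sets (S : vertex G -> {set edge G}) (w : join_vertex) :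
    {set edge G} :=
  if w is Some v then S (val v) else S v1 :|: S v2.

Lemma join_sets_unique (S : vertex G -> {set edge G}) :
  (forall e, exists! v, e \in S v) ->
  forall e, exists! w, e \in join_sets S w.
Proof.
move=> hS e; have [v [ev uv]] := hS e.
have [hv|hv] := boolP ((v != v1) && (v != v2)).
- exists (Some (exist _ v hv)); split=> // -[[u hu]|] /=.
    by move=> /uv vu; congr Some; apply: val_inj.
  by rewrite finset.inE => /orP[] /uv vE; exfalso; move: hv; rewrite vE eqxx ?andbF.
- exists None; split.
    move: hv; rewrite negb_and !negbK /= finset.inE => /orP[] /eqP <-;
    by rewrite ev ?orbT.
  by case=> [[u hu]|] //= /uv vu; exfalso; move: hv; rewrite vu hu.
Qed.

Definition join : metric_graph R :=
  @MetricGraph R join_vertex (edge G) (join_sets (outE G)) (join_sets (inE G))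
    (join_sets_unique (@outE_unique R G)) (join_sets_unique (@inE_unique R G))
    (len G) (@len_gt0 R G).

Definition join_conditions (c : conditions G)
    (c0 : vertex_condition R (deg (None : vertex join))) : conditions join :=
  fun w => match w return vertex_condition R (@deg R join w) with
           | Some v => c (val v)
           | None => c0
           end.

End Join.

(* Main.v *)
(** Cut every edge into m + 1 short pieces.  For a spectral parameter nu in a bounded range
    the Dirichlet problem for -f'' + q f = nu f is uniquely solvable on every piece, so a
    solution is known from its values at the cut points, and the eigenvalue problem of H
    becomes: nu is an eigenvalue iff the Hermitian form Q_nu built from the
    Dirichlet-to-Neumann maps of the pieces and from the operators Lambda_v is degenerate
    on the space S of node values satisfying the Dirichlet part of the vertex conditions;
    the multiplicity is the dimension of the kernel.  Q_nu is Lipschitz and strictly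
    decreasing in nu (Green's identity and the fact that solutions on short pieces are
    close to affine functions) and positive for very negative nu (Riccati substitution).

    Strict monotonicity shows that Q_mu has, for mu = lambda_k of the joined graph, a
    k-dimensional nonpositive subspace of the space S~ of the joined graph.  Joining v1 and
    v2 only adds the constraint f(v1) = f(v2): S~ is a subspace of S, and both forms agree
    there, as alpha_1 |f|^2 + alpha_2 |f|^2 = (alpha_1 + alpha_2) |f|^2.  Finally, starting
    from a positive form, nonpositive directions can only be created where Q_nu is
    degenerate on S, i.e. at eigenvalues of H, and there at most as many as the
    multiplicity; so H has at least k eigenvalues not exceeding mu. *)
Require Import Defs.
From mathcomp Require Import all_boot all_order all_algebra.
From mathcomp Require Import complex.
From mathcomp Require Import all_classical all_reals all_analysis.
From mathcomp Require Import measurable_realfun.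
From mathcomp Require Import ring lra.

Set Implicit Arguments.
Unset Strict Implicit.
Unset Printing Implicit Defensive.

Import Order.TTheory GRing.Theory Num.Theory.
Import numFieldNormedType.Exports.

Local Open Scope classical_set_scope.
Local Open Scope ring_scope.
Local Open Scope sesquilinear_scope.

(** * Primitives of bounded measurable functions *)

Section Primitives.
Variable R : realType.
Implicit Types (s t x y z a b c C M : R) (f g F G : R -> R).

Local Notation mu := (@lebesgue_measure R).

(** Min-max for unbounded operators is avoided: everything happens with matrices of a fixed finite
    size. A whole edge would not do as a single piece, since its Dirichlet-to-Neumann map has poles
    at the Dirichlet eigenvalues of the edge; pieces that are short relative to the spectral window
    have none there. Every end of an edge keeps its own coordinate, so both graphs share one node
    space and one set of Dirichlet-to-Neumann matrices, and joining changes only the admissible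
    subspace and the vertex terms. The two graphs need opposite bounds: for the joined graph the
    number of nonpositive directions is bounded below, by induction along its eigenvalues; for H it
    is bounded above, which requires a starting point where the form is positive and a way to follow
    the inertia in nu. The potential is merely bounded and measurable, so the calculus uses
    Lipschitz functions and integrals in place of derivatives. *)

Definition bounded_measurable s t f :=
  measurable_fun `[s, t] f /\
  exists M, forall x, s <= x -> x <= t -> `|f x| <= M.

(** Integral form of F' = f for Lipschitz F; with a potential that is only measurable, F need not be
    differentiable everywhere. *)
Definition primitive s t F f :=
  bounded_measurable s t f /\
  forall x y, s <= x -> x <= y -> y <= t -> F y - F x = \int[mu]_(z in `[x, y]) f z.

Lemma bounded_measurableS s t s' t' f : s <= s' -> t' <= t ->
  bounded_measurable s t f -> bounded_measurable s' t' f.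
Proof.
move=> ss' tt' [mf [M fM]]; split.
  by apply: measurable_funS mf => //; apply: subset_itvScc; rewrite ?bnd_simp.
by exists M => x sx xt; apply: fM; [exact: le_trans ss' sx|exact: le_trans xt tt'].
Qed.

Lemma bounded_measurable_ext s t f g :
  (forall x, s <= x -> x <= t -> f x = g x) ->
  bounded_measurable s t f -> bounded_measurable s t g.
Proof.
move=> fg [mf [M fM]]; split.
  apply: eq_measurable_fun mf => x; rewrite inE /= in_itv /= => /andP[sx xt].
  exact: fg.
by exists M => x sx xt; rewrite -fg//; exact: fM.
Qed.

Lemma bounded_measurableD s t f g : bounded_measurable s t f ->
  bounded_measurable s t g -> bounded_measurable s t (fun x => f x + g x).
Proof.
move=> [mf [M fM]] [mg [N gN]]; split; first exact: measurable_funD.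
by exists (M + N) => x sx xt; rewrite (le_trans (ler_normD _ _))// lerD// (fM, gN).
Qed.

Lemma bounded_measurableM s t f g : bounded_measurable s t f ->
  bounded_measurable s t g -> bounded_measurable s t (fun x => f x * g x).
Proof.
move=> [mf [M fM]] [mg [N gN]]; split; first exact: measurable_funM.
by exists (M * N) => x sx xt; rewrite normrM ler_pM// (fM, gN).
Qed.

Lemma bounded_measurable_cst s t c : bounded_measurable s t (fun=> c).
Proof. by split; [exact: measurable_cst | exists `|c|]. Qed.

Lemma bounded_measurableZ s t c f : bounded_measurable s t f ->
  bounded_measurable s t (fun x => c * f x).
Proof. by apply: bounded_measurableM; exact: bounded_measurable_cst. Qed.

Lemma bounded_measurableB s t f g : bounded_measurable s t f ->
  bounded_measurable s t g -> bounded_measurable s t (fun x => f x - g x).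
Proof.
move=> bf bg; apply: bounded_measurable_ext
  (bounded_measurableD bf (bounded_measurableZ (-1) bg)) => x _ _.
by rewrite mulN1r.
Qed.

Lemma lipschitz_bounded_measurable s t f C : 0 <= C ->
  (forall x y, s <= x -> x <= y -> y <= t -> `|f y - f x| <= C * (y - x)) ->
  bounded_measurable s t f.
Proof.
move=> C0 fC; have [st|ts] := leP s t; last first.
  split; last by exists 0 => x sx xt; have := lt_le_trans ts sx; rewrite ltNge xt.
  by rewrite set_itv_ge ?bnd_simp -?ltNge//; exact: measurable_fun_set0.
split; last first.
  exists (`|f s| + C * (t - s)) => x sx xt.
  have -> : f x = f s + (f x - f s) by ring.
  rewrite (le_trans (ler_normD _ _))// lerD2l (le_trans (fC _ _ (lexx _) sx xt))//.
  by rewrite ler_wpM2l// lerB.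
(* Clamping to [s, t] extends f to a Lipschitz function on the line; continuity then gives
   measurability. *)
pose p x := Num.max s (Num.min x t).
have ps x : s <= p x by rewrite le_max lexx.
have pt x : p x <= t by rewrite ge_max st ge_min lexx orbT.
have plip x y : x <= y -> p x <= p y /\ p y - p x <= y - x.
  by move=> xy; rewrite /p /Order.min; do ![case: ifPn; rewrite -?leNgt => ?];
    rewrite /Order.max; do ![case: ifPn; rewrite -?leNgt => ?]; split; lra.
have pid x : s <= x -> x <= t -> p x = x.
  by move=> sx xt; rewrite /p (min_idPl xt) (max_idPr sx).
have fplip x y : `|f (p y) - f (p x)| <= C * `|y - x|.
  wlog xy : x y / x <= y.
    by move=> H; case: (leP x y) => [/H//|/ltW/H]; rewrite distrC (distrC x).
  have [p1 p2] := plip _ _ xy; rewrite (le_trans (fC _ _ (ps _) p1 (pt _)))//.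
  by rewrite (ger0_norm (_ : 0 <= y - x)) ?subr_ge0// ler_wpM2l.
apply: (@eq_measurable_fun _ _ _ _ _ (f \o p)).
  by move=> x; rewrite inE /= in_itv /= => /andP[sx xt]; rewrite pid.
apply: measurable_funTS; apply: continuous_measurable_fun => x.
apply/cvgrPdist_le => e e0; near=> y.
rewrite /= (le_trans (fplip _ _))//.
have y1 : `|x - y| <= e / (C + 1).
  near: y; apply: cvgr_dist_le; first exact: cvg_id.
  by rewrite divr_gt0// ltr_wpDl.
rewrite (le_trans (ler_wpM2l _ y1))// mulrCA ler_piMr ?(ltW e0)//.
by rewrite ler_pdivrMr ?mul1r ?lerDl// ltr_wpDl.
Unshelve. all: by end_near. Qed.


Lemma bounded_measurable_integrable s t f : bounded_measurable s t f ->
  mu.-integrable `[s, t] (EFin \o f).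
Proof.
move=> [mf [M fM]]; apply: measurable_bounded_integrable => //.
  by rewrite /= lebesgue_measure_itv /=; case: ifPn => // _; rewrite -EFinB ltry.
exists M; split; rewrite ?num_real// => N MN x /=; rewrite in_itv /= => /andP[sx xt].
by rewrite (le_trans (fM _ sx xt))// ltW.
Qed.

Lemma integral_split x y z f : x <= y -> y <= z ->
  mu.-integrable `[x, z] (EFin \o f) ->
  \int[mu]_(u in `[x, z]) f u =
  \int[mu]_(u in `[x, y]) f u + \int[mu]_(u in `[y, z]) f u.
Proof.
move=> xy yz fi.
rewrite -(@Rintegral_itv_obnd_cbnd _ y (BRight z)); last first.
  apply: integrableS fi => //; apply: subset_itvr; rewrite bnd_simp//.
by rewrite -(@Rintegral_itvB _ f (BLeft x) (BRight z) y)// ?bnd_simp// addrC subrK.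
Qed.

Lemma integral_bound s t f M : s <= t -> bounded_measurable s t f ->
  (forall x, s <= x -> x <= t -> `|f x| <= M) ->
  `|\int[mu]_(u in `[s, t]) f u| <= M * (t - s).
Proof.
move=> st bf fM; have fi := bounded_measurable_integrable bf.
apply: le_trans (le_normr_Rintegral _ _) _ => //.
have -> : M * (t - s) = \int[mu]_(u in `[s, t]) M.
  rewrite Rintegral_cst//= lebesgue_measure_itv /= lte_fin.
  by move: st; rewrite le_eqVlt => /predU1P[->|->]//; rewrite ltxx subrr.
apply: le_Rintegral => //.
- exact: integrable_norm.
- by apply: bounded_measurable_integrable; exact: bounded_measurable_cst.
- by move=> x /=; rewrite in_itv /= => /andP[]; exact: fM.
Qed.

Lemma primitive_lipschitz s t F f M : primitive s t F f ->
  (forall x, s <= x -> x <= t -> `|f x| <= M) ->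
  forall x y, s <= x -> x <= y -> y <= t -> `|F y - F x| <= M * (y - x).
Proof.
move=> [bf pf] fM x y sx xy yt; rewrite pf//; apply: integral_bound => //.
  exact: bounded_measurableS bf.
by move=> z xz zy; apply: fM; [exact: le_trans xz|exact: le_trans yt].
Qed.

Lemma bounded_measurable_bound s t f : bounded_measurable s t f ->
  exists2 M, 0 <= M & forall x, s <= x -> x <= t -> `|f x| <= M.
Proof.
move=> [_ [M fM]]; exists `|M| => // x sx xt.
by rewrite (le_trans (fM _ sx xt))// ler_norm.
Qed.

Lemma primitive_bounded s t F f :
  primitive s t F f -> bounded_measurable s t F.
Proof.
move=> pF; have [M M0 fM] := bounded_measurable_bound pF.1.
exact: (lipschitz_bounded_measurable M0) (primitive_lipschitz pF fM).
Qed.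

Lemma primitiveS s t s' t' F f : s <= s' -> t' <= t ->
  primitive s t F f -> primitive s' t' F f.
Proof.
move=> ss' tt' [bf pF]; split; first exact: bounded_measurableS bf.
by move=> x y sx xy yt; apply: pF => //; [exact: le_trans sx|exact: le_trans tt'].
Qed.

Lemma primitive_integral s t f : bounded_measurable s t f ->
  primitive s t (fun x => \int[mu]_(z in `[s, x]) f z) f.
Proof.
move=> bf; split=> // x y sx xy yt; rewrite (@integral_split s x y)//.
  by rewrite addrC addKr.
by apply: bounded_measurable_integrable; exact: bounded_measurableS bf.
Qed.

Lemma primitive_ext s t F f G g :
  (forall x, s <= x -> x <= t -> F x = G x) ->
  (forall x, s <= x -> x <= t -> f x = g x) ->
  primitive s t F f -> primitive s t G g.
Proof.
move=> FG fg [bf pF]; split; first exact: bounded_measurable_ext bf.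
move=> x y sx xy yt.
rewrite -!FG ?pF// ?(le_trans sx)// ?(le_trans xy)//.
apply: eq_Rintegral => z; rewrite inE /= in_itv /= => /andP[xz zy].
by rewrite fg// ?(le_trans sx)// ?(le_trans zy).
Qed.

Lemma primitiveD s t F f G g : primitive s t F f -> primitive s t G g ->
  primitive s t (fun x => F x + G x) (fun x => f x + g x).
Proof.
move=> [bf pF] [bg pG]; split; first exact: bounded_measurableD.
move=> x y sx xy yt; rewrite RintegralD// -?pF// -?pG//; first ring.
all: by apply: bounded_measurable_integrable; apply: bounded_measurableS (sx) (yt) _.
Qed.

Lemma primitiveZ s t F f c : primitive s t F f ->
  primitive s t (fun x => c * F x) (fun x => c * f x).
Proof.
move=> [bf pF]; split; first exact: bounded_measurableZ.
move=> x y sx xy yt; rewrite RintegralZl// -?pF//; first ring.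
all: by apply: bounded_measurable_integrable; apply: bounded_measurableS (sx) (yt) _.
Qed.

Lemma primitiveB s t F f G g : primitive s t F f -> primitive s t G g ->
  primitive s t (fun x => F x - G x) (fun x => f x - g x).
Proof.
move=> pF pG; apply: primitive_ext (primitiveD pF (primitiveZ (-1) pG)) => x _ _ /=;
by rewrite mulN1r.
Qed.

Lemma primitive_cst s t c : primitive s t (fun=> c) (fun=> 0).
Proof.
split; first exact: bounded_measurable_cst.
by move=> x y _ _ _; rewrite subrr Rintegral_cst ?mul0r.
Qed.

Lemma primitive_id s t : primitive s t (fun x => x) (fun=> 1).
Proof.
split; first exact: bounded_measurable_cst.
move=> x y _ xy _; rewrite Rintegral_cst// mul1r /= lebesgue_measure_itv /= lte_fin.
by move: xy; rewrite le_eqVlt => /predU1P[->|->]//; rewrite ltxx subrr.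
Qed.

(** Cutting [s, t] into n equal parts bounds the total increment by C (t - s)^2 / n. This replaces a
    mean value theorem for functions that may lack derivatives. *)
Lemma eq_of_quadratic_modulus s t (D : R -> R) C : s <= t ->
  (forall x y, s <= x -> x <= y -> y <= t -> `|D y - D x| <= C * (y - x) ^+ 2) ->
  D t = D s.
Proof.
move=> st DC; apply/eqP; rewrite -subr_eq0 -normr_le0; apply/ler_addgt0Pl => e e0.
rewrite addr0; set A := C * (t - s) ^+ 2.
have A0 : 0 <= A by apply: le_trans (DC s t _ _ _).
pose n := (Num.truncn (A / e)).+1.
have n0 : 0 < n%:R :> R by rewrite ltr0n.
have Ane : A / n%:R <= e.
  by rewrite ler_pdivrMr// mulrC -ler_pdivrMr// ltW// truncnS_gt.
pose d := (t - s) / n%:R.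
have d0 : 0 <= d by rewrite divr_ge0 ?subr_ge0// ltW.
have nd : n%:R * d = t - s by rewrite /d mulrCA divff ?mulr1// gt_eqF.
have H k : (k <= n)%N -> `|D (s + k%:R * d) - D s| <= k%:R * (C * d ^+ 2).
  elim: k => [_|k IH kn]; first by rewrite !mul0r addr0 subrr normr0.
  have -> : D (s + k.+1%:R * d) - D s = (D (s + k.+1%:R * d) - D (s + k%:R * d)) +
     (D (s + k%:R * d) - D s) by ring.
  rewrite (le_trans (ler_normD _ _))// -[in leRHS]natr1 mulrDl mul1r addrC.
  rewrite lerD ?IH// 1?ltnW//.
  have -> : C * d ^+ 2 = C * ((s + k.+1%:R * d) - (s + k%:R * d)) ^+ 2.
    by rewrite -natr1; ring.
  apply: DC; first by rewrite lerDl mulr_ge0.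
    by rewrite lerD2l ler_wpM2r// ler_nat.
  rewrite -lerBrDl -nd ler_wpM2r// ler_nat//.
have := H n (leqnn n); rewrite nd addrCA subrr addr0 => /le_trans; apply.
apply: le_trans Ane; rewrite le_eqVlt; apply/orP; left; apply/eqP.
by rewrite /A /d; field; rewrite gt_eqF.
Qed.

Lemma primitiveM s t F f G g : primitive s t F f -> primitive s t G g ->
  primitive s t (fun x => F x * G x) (fun x => f x * G x + F x * g x).
Proof.
move=> pF pG.
have bF := primitive_bounded pF; have bG := primitive_bounded pG.
have [Mf Mf0 fM] := bounded_measurable_bound pF.1.
have [Mg Mg0 gM] := bounded_measurable_bound pG.1.
have bfG : bounded_measurable s t (fun x => f x * G x + F x * g x).
  by apply: bounded_measurableD; apply: bounded_measurableM => //;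
    [exact: pF.1|exact: pG.1].
split=> // a b sa ab bt.
set J := \int[mu]_(z in `[a, b]) _.
have pJ := primitive_integral (bounded_measurableS sa bt bfG).
pose D x := F x * G x - \int[mu]_(z in `[a, x]) (f z * G z + F z * g z).
suff : D b = D a.
  rewrite /D -/J => /eqP; rewrite subr_eq => /eqP ->.
  by rewrite set_itv1 Rintegral_set1; ring.
(* Of the 3, one comes from the product of the two increments and two from the integrand of the
   remainder. *)
apply: (@eq_of_quadratic_modulus a b _ (3 * (Mf * Mg))) => // x y ax xy yb.
have sx := le_trans sa ax; have yt := le_trans yb bt.
have pFx := primitiveS sx yt pF; have pGx := primitiveS sx yt pG.
(* On [x, y] replace F and G by their values at x; the error is quadratic, so
   [eq_of_quadratic_modulus] applies. *)
have r1 : primitive x y (fun u => F x * G u + G x * F u) (fun u => F x * g u + G x * f u).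
  by apply: primitiveD; apply: primitiveZ.
have r2 : primitive x y (fun u => \int[mu]_(z in `[a, u]) (f z * G z + F z * g z) -
    (F x * G u + G x * F u)) (fun u => f u * (G u - G x) + (F u - F x) * g u).
  apply: primitive_ext (primitiveB (primitiveS ax yb pJ) r1) => // u _ _; ring.
have lF u : x <= u -> u <= y -> `|F u - F x| <= Mf * (y - x).
  move=> xu uy; rewrite (le_trans (primitive_lipschitz pF fM sx xu (le_trans uy yt)))//.
  by rewrite ler_wpM2l// lerB.
have lG u : x <= u -> u <= y -> `|G u - G x| <= Mg * (y - x).
  move=> xu uy; rewrite (le_trans (primitive_lipschitz pG gM sx xu (le_trans uy yt)))//.
  by rewrite ler_wpM2l// lerB.
have := primitive_lipschitz r2 (M := 2 * (Mf * Mg) * (y - x)) _ (lexx x) xy (lexx y).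
move=> H; have {}H := H _.
have -> : D y - D x = (F y - F x) * (G y - G x) -
   ((\int[mu]_(z in `[a, y]) (f z * G z + F z * g z) -
    (F x * G y + G x * F y)) - (\int[mu]_(z in `[a, x]) (f z * G z + F z * g z) -
    (F x * G x + G x * F x))) by rewrite /D; ring.
rewrite (le_trans (ler_normB _ _))//.
have -> : 3 * (Mf * Mg) * (y - x) ^+ 2 =
  (Mf * (y - x)) * (Mg * (y - x)) + 2 * (Mf * Mg) * (y - x) * (y - x) by ring.
apply: lerD; first by rewrite normrM ler_pM// ?lF ?lG.
apply: H => u xu uy; rewrite (le_trans (ler_normD _ _))// !normrM.
have -> : 2 * (Mf * Mg) * (y - x) = Mf * (Mg * (y - x)) + Mf * (y - x) * Mg by ring.
have su := le_trans sx xu; have ut := le_trans uy yt.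
by apply: lerD; apply: ler_pM; rewrite ?fM ?gM ?lG ?lF.
Qed.

Lemma primitive_eq s t F f G g : s <= t -> primitive s t F f ->
  primitive s t G g -> (forall x, s <= x -> x <= t -> f x = g x) ->
  F t - F s = G t - G s.
Proof.
move=> st [_ pF] [_ pG] fg; rewrite pF// pG//; apply: eq_Rintegral => z.
by rewrite inE /= in_itv /= => /andP[]; exact: fg.
Qed.

Lemma primitive_le s t F f G g : s <= t -> primitive s t F f ->
  primitive s t G g -> (forall x, s <= x -> x <= t -> f x <= g x) ->
  F t - F s <= G t - G s.
Proof.
move=> st [bf pF] [bg pG] fg; rewrite pF// pG//; apply: le_Rintegral => //.
- exact: bounded_measurable_integrable.
- exact: bounded_measurable_integrable.
- by move=> z; rewrite /= in_itv /= => /andP[]; exact: fg.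
Qed.

Lemma primitive_glue s t r F f : s <= t -> t <= r ->
  primitive s t F f -> primitive t r F f -> primitive s r F f.
Proof.
move=> st tr [[mf [M fM]] pF] [[mg [N gN]] pG].
have bf : bounded_measurable s r f.
  split.
    have -> : `[s, r]%classic = `[s, t] `|` `[t, r] :> set R.
      apply/seteqP; split=> x /=; rewrite !in_itv /=.
        by move=> /andP[-> ->]; rewrite !andbT; have [] := leP x t; [left|right; exact: ltW].
      by move=> [] /andP[a b]; apply/andP; split => //;
        [exact: le_trans b tr|exact: le_trans st a].
    by rewrite measurable_funU.
  exists (Num.max M N) => x sx xr; rewrite le_max.
  have [xt|/ltW tx] := leP x t; first by rewrite fM.
  by rewrite gN// orbT.
split=> // x y sx xy yr.
have [yt|ty] := leP y t; first exact: pF.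
have [tx|xt] := leP t x; first exact: pG.
rewrite (@integral_split x t y) ?ltW//; last first.
  by apply: bounded_measurable_integrable; exact: bounded_measurableS bf.
by rewrite -(pF x t) ?(ltW xt)// -(pG t y) ?(ltW ty)//; ring.
Qed.

End Primitives.

(** * The equation f'' = k f on an interval *)

Section EdgeEquation.
Variable R : realType.
Implicit Types (s t x y a b c C K M m : R) (f g F G k : R -> R).

Local Notation mu := (@lebesgue_measure R).

Definition solution k s t f f' :=
  primitive s t f f' /\ primitive s t f' (fun x => k x * f x).

Definition interpolant s t a b x : R := a + (b - a) * ((x - s) / (t - s)).

Lemma interpolant_bound s t a b m x : s < t -> `|a| <= m -> `|b| <= m ->
  s <= x -> x <= t -> `|interpolant s t a b x| <= m.
Proof.
move=> st am bm sx xt; rewrite /interpolant; set z := _ / _.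
have z0 : 0 <= z by rewrite divr_ge0 ?subr_ge0 // ltW.
have z1 : z <= 1 by rewrite ler_pdivrMr ?subr_gt0// mul1r lerB.
have -> : a + (b - a) * z = a * (1 - z) + b * z by ring.
rewrite (le_trans (ler_normD _ _))// [`|a * _|]normrM [`|b * _|]normrM (ger0_norm z0).
rewrite (ger0_norm (_ : 0 <= 1 - z)) ?subr_ge0//.
have -> : m = m * (1 - z) + m * z by ring.
by rewrite lerD// ler_wpM2r// subr_ge0.
Qed.

(** Subtracting the tangent direction at s leaves a function with slope at most C (t - s).
    Interpolation reproduces affine functions, so only two increments of that function remain, each
    at most C (t - s)^2. *)
Lemma interpolation_error s t F F' k C : s < t ->
  primitive s t F F' -> primitive s t F' k ->
  (forall x, s <= x -> x <= t -> `|k x| <= C) ->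
  forall x, s <= x -> x <= t ->
  `|F x - interpolant s t (F s) (F t) x| <= 2 * C * (t - s) ^+ 2.
Proof.
move=> st pF pF' kC x sx xt.
have h0 : 0 < t - s by rewrite subr_gt0.
have C0 : 0 <= C := le_trans (normr_ge0 _) (kC s (lexx _) (ltW st)).
have pE : primitive s t (fun y => F y - F' s * y) (fun y => F' y - F' s * 1).
  by apply: primitiveB => //; apply: primitiveZ; exact: primitive_id.
have rC y : s <= y -> y <= t -> `|F' y - F' s * 1| <= C * (t - s).
  move=> sy yt; rewrite mulr1.
  rewrite (le_trans (primitive_lipschitz pF' kC (lexx _) sy yt))//.
  by rewrite ler_wpM2l// lerB.
have E1 := primitive_lipschitz pE rC (lexx _) sx xt.
have E2 := primitive_lipschitz pE rC (lexx _) (ltW st) (lexx _).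
set e1 := (F x - F' s * x) - _ in E1; set e2 := (F t - F' s * t) - _ in E2.
have -> : F x - interpolant s t (F s) (F t) x = e1 - e2 * ((x - s) / (t - s)).
  by rewrite /interpolant /e1 /e2; field; rewrite gt_eqF.
rewrite (le_trans (ler_normB _ _))// normrM.
have z0 : 0 <= (x - s) / (t - s) by rewrite divr_ge0 ?subr_ge0 // ltW.
have z1 : (x - s) / (t - s) <= 1 by rewrite ler_pdivrMr ?mul1r ?lerB.
rewrite (ger0_norm z0).
have -> : 2 * C * (t - s) ^+ 2 = C * (t - s) * (t - s) + C * (t - s) * (t - s) * 1 by ring.
apply: lerD; last by rewrite ler_pM.
by rewrite (le_trans E1)// ler_wpM2l ?lerB ?mulr_ge0// ltW.
Qed.

Lemma bvp_rhs s t k a b : s < t -> bounded_measurable s t k ->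
  exists F F', [/\ primitive s t F F', primitive s t F' k, F s = a & F t = b].
Proof.
move=> st bk.
pose W y := \int[mu]_(z in `[s, y]) k z.
have pW : primitive s t W k by exact: primitive_integral.
pose V y := \int[mu]_(z in `[s, y]) W z.
have pV : primitive s t V W by apply: primitive_integral; exact: primitive_bounded pW.
pose c := (b - a - V t) / (t - s).
exists (fun x => V x + (c * x + (a - c * s))), (fun x => W x + (c * 1 + 0)); split.
- apply: primitiveD => //; apply: primitiveD; last exact: primitive_cst.
  by apply: primitiveZ; exact: primitive_id.
- apply: primitive_ext (primitiveD pW (primitive_cst s t (c * 1 + 0))) => // x _ _.
  by rewrite addr0.
- by rewrite /V set_itv1 Rintegral_set1; ring.
- by rewrite /c; field; rewrite subr_eq0 gt_eqF.
Qed.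

(** The intervals of radius [2 * C / 2 ^+ n], the tail of the geometric series, are nested; the
    limit is the supremum of their left ends. *)
Lemma geometric_cauchy (u : nat -> R) C :
  (forall n, `|u n.+1 - u n| <= C / 2 ^+ n) ->
  exists l, forall n, `|u n - l| <= 2 * C / 2 ^+ n.
Proof.
move=> uC.
pose e n := 2 * C / 2 ^+ n.
have eS n : e n = e n.+1 + C / 2 ^+ n by rewrite /e exprS; field; rewrite expf_neq0.
have lo n (m : nat) : u n - e n <= u (n + m)%N - e (n + m)%N.
  elim: m => [|m IH]; first by rewrite addn0.
  rewrite (le_trans IH)// addnS eS; have := uC (n + m)%N.
  by rewrite ler_norml => /andP[]; lra.
have hi n (m : nat) : u (n + m)%N + e (n + m)%N <= u n + e n.
  elim: m => [|m IH]; first by rewrite addn0.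
  rewrite (le_trans _ IH)// addnS (eS (n + m)%N); have := uC (n + m)%N.
  by rewrite ler_norml => /andP[]; lra.
have e0 n : 0 <= e n.
  have C0 : 0 <= C by have := le_trans (normr_ge0 _) (uC 0%N); rewrite expr0 divr1.
  by rewrite divr_ge0 ?mulr_ge0 ?exprn_ge0.
have cross n (m : nat) : u n - e n <= u m + e m.
  apply: le_trans (lo n m) _; apply: le_trans (hi m n); rewrite addnC.
  by have := e0 (m + n)%N; lra.
pose A := [set u n - e n | n in [set: nat]].
have supA : has_sup A.
  split; first by exists (u 0%N - e 0%N), 0%N.
  by exists (u 0%N + e 0%N) => _ [n _ <-]; exact: cross.
exists (sup A) => n.
have h1 : u n - e n <= sup A by apply: ub_le_sup; [case: supA|exists n].
have h2 : sup A <= u n + e n.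
  by apply: ge_sup; [case: supA|move=> _ [m _ <-]; exact: cross].
by rewrite ler_norml -/(e n); lra.
Qed.

(* The bound 34 K h^2 <= 1 makes f |-> interpolant + (double integral of k f) a contraction
   with factor 1/17. *)
Lemma solution_near_interpolant k s t f f' K m : s < t ->
  (forall x, s <= x -> x <= t -> `|k x| <= K) -> 34 * (K * (t - s) ^+ 2) <= 1 ->
  solution k s t f f' -> `|f s| <= m -> `|f t| <= m ->
  forall x, s <= x -> x <= t -> `|f x - interpolant s t (f s) (f t) x| <= m / 16.
Proof.
move=> st kK Kh [pf pf'] fsm ftm.
have K0 : 0 <= K := le_trans (normr_ge0 _) (kK s (lexx _) (ltW st)).
have key N : (forall x, s <= x -> x <= t -> `|f x| <= N) ->
    forall x, s <= x -> x <= t -> `|f x - interpolant s t (f s) (f t) x| <= N / 17.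
  move=> fN x sx xt.
  have N0 : 0 <= N := le_trans (normr_ge0 _) (fN x sx xt).
  have kfC y : s <= y -> y <= t -> `|k y * f y| <= K * N.
    by move=> sy yt; rewrite normrM ler_pM ?kK ?fN.
  rewrite (le_trans (interpolation_error st pf pf' kfC sx xt))//; nra.
pose A := [set `|f x| | x in `[s, t]].
have [M M0 fM] := bounded_measurable_bound (primitive_bounded pf).
have supA : has_sup A.
  split; first by exists `|f s|, s => //=; rewrite in_itv /= lexx ltW.
  by exists M => _ [x /= + <-]; rewrite in_itv /= => /andP[]; exact: fM.
have fsup x : s <= x -> x <= t -> `|f x| <= sup A.
  move=> sx xt; apply: ub_le_sup; first by case: supA.
  by exists x => //=; rewrite in_itv /= sx xt.
(* This gives sup A <= 17/16 m, so the error sup A / 17 is at most m / 16. *)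
have supm : sup A <= m + sup A / 17.
  apply: ge_sup; [by case: supA|move=> _ [x /= + <-]].
  rewrite in_itv /= => /andP[sx xt].
  rewrite -[f x](subrK (interpolant s t (f s) (f t) x)) addrC (le_trans (ler_normD _ _))//.
  by rewrite lerD ?key// interpolant_bound.
move=> x sx xt; rewrite (le_trans (key _ fsup _ sx xt))//; lra.
Qed.

Lemma solution_bound k s t f f' K m : s < t ->
  (forall x, s <= x -> x <= t -> `|k x| <= K) -> 34 * (K * (t - s) ^+ 2) <= 1 ->
  solution k s t f f' -> `|f s| <= m -> `|f t| <= m ->
  forall x, s <= x -> x <= t -> `|f x| <= m + m / 16.
Proof.
move=> st kK Kh sf fsm ftm x sx xt.
rewrite -[f x](subrK (interpolant s t (f s) (f t) x)) addrC (le_trans (ler_normD _ _))//.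
by rewrite lerD ?interpolant_bound// (solution_near_interpolant st kK Kh sf).
Qed.

Lemma solutionD k s t f f' g g' : solution k s t f f' -> solution k s t g g' ->
  solution k s t (fun x => f x + g x) (fun x => f' x + g' x).
Proof.
move=> [pf pf'] [pg pg']; split; first exact: primitiveD.
by apply: primitive_ext (primitiveD pf' pg') => // x _ _; ring.
Qed.

Lemma solutionZ k s t f f' c : solution k s t f f' ->
  solution k s t (fun x => c * f x) (fun x => c * f' x).
Proof.
move=> [pf pf']; split; first exact: primitiveZ.
by apply: primitive_ext (primitiveZ c pf') => // x _ _; ring.
Qed.

Lemma solution0 k s t f f' K : s < t ->
  (forall x, s <= x -> x <= t -> `|k x| <= K) -> 34 * (K * (t - s) ^+ 2) <= 1 ->
  solution k s t f f' -> f s = 0 -> f t = 0 ->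
  forall x, s <= x -> x <= t -> f x = 0 /\ f' x = 0.
Proof.
move=> st kK Kh sf fs ft.
have f0 x : s <= x -> x <= t -> f x = 0.
  move=> sx xt; apply/eqP; rewrite -normr_le0.
  have := solution_bound (m := 0) st kK Kh sf _ _ sx xt.
  by rewrite fs ft normr0 mul0r addr0; apply.
have [pf pf'] := sf.
have f'c x : s <= x -> x <= t -> f' x = f' s.
  move=> sx xt; apply/eqP; rewrite -subr_eq0 -normr_le0 -(mul0r (x - s)).
  apply: primitive_lipschitz pf' _ _ _ _ sx xt => // y sy yt.
  by rewrite f0// mulr0 normr0.
have f's : f' s = 0.
  have := primitive_eq (ltW st) pf (primitiveZ (f' s) (primitive_id s t)).
  move=> /(_ (fun x sx xt => etrans (f'c x sx xt) (esym (mulr1 _)))).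
  rewrite fs ft subrr -mulrBr => /esym/eqP.
  by rewrite mulf_eq0 subr_eq0 (gt_eqF st) orbF => /eqP.
by move=> x sx xt; rewrite f0// f'c.
Qed.

(** Picard iteration for the Dirichlet problem: [T] solves F'' = k g with the given end values, and
    by the interpolation estimate it shrinks sup distances by the factor 1/17, of which only 1/2 is
    used. *)
Lemma solution_exists k s t K a b : s < t -> bounded_measurable s t k ->
  (forall x, s <= x -> x <= t -> `|k x| <= K) -> 34 * (K * (t - s) ^+ 2) <= 1 ->
  exists f f', [/\ solution k s t f f', f s = a & f t = b].
Proof.
move=> st bk kK Kh.
have K0 : 0 <= K := le_trans (normr_ge0 _) (kK s (lexx _) (ltW st)).
pose X := {g : R -> R | bounded_measurable s t g}.
have T (g : X) : {G : X | exists G', [/\ primitive s t (sval G) G',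
    primitive s t G' (fun x => k x * sval g x), sval G s = a & sval G t = b]}.
  apply: cid; have bkg := bounded_measurableM bk (svalP g).
  have [F [F' [pF pF' Fs Ft]]] := bvp_rhs a b st bkg.
  by exists (exist _ F (primitive_bounded pF)), F'.
have Tdiff (g1 g2 : X) C : (forall x, s <= x -> x <= t -> `|sval g1 x - sval g2 x| <= C) ->
    forall x, s <= x -> x <= t ->
    `|sval (sval (T g1)) x - sval (sval (T g2)) x| <= C / 2.
  move=> gC x sx xt; case: (T g1) => G1 /= [G1' [p1 p1' s1 t1]].
  case: (T g2) => G2 /= [G2' [p2 p2' s2 t2]].
  have kC y : s <= y -> y <= t -> `|k y * sval g1 y - k y * sval g2 y| <= K * C.
    by move=> sy yt; rewrite -mulrBr normrM ler_pM ?kK ?gC.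
  have C0 : 0 <= C := le_trans (normr_ge0 _) (gC x sx xt).
  have := interpolation_error st (primitiveB p1 p2) (primitiveB p1' p2') kC sx xt.
  rewrite s1 s2 t1 t2 !subrr /interpolant subrr mul0r addr0 subr0 => /le_trans; apply.
  nra.
pose g0 : X := exist _ _ (bounded_measurable_cst s t 0).
pose u (n : nat) : X := iter n (fun g : X => sval (T g)) g0.
have [M M0 M1] := bounded_measurable_bound
  (bounded_measurableB (svalP (u 1%N)) (svalP (u 0%N))).
have uC n x : s <= x -> x <= t -> `|sval (u n.+1) x - sval (u n) x| <= M / 2 ^+ n.
  elim: n x => [|n IH] x sx xt; first by rewrite expr0 divr1 M1.
  have /le_trans := Tdiff _ _ _ IH x sx xt; apply.
  by rewrite exprSr invfM mulrA.
have /choice[f fu] : forall x, exists l, s <= x -> x <= t ->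
    forall n, `|sval (u n) x - l| <= 2 * M / 2 ^+ n.
  move=> x; have [sx|] := boolP (s <= x); last by exists 0.
  have [xt|] := boolP (x <= t); last by exists 0.
  by have [l ul] := geometric_cauchy (fun n => uC n x sx xt); exists l.
have small e : 0 < e -> exists n, 2 * M / 2 ^+ n <= e.
  move=> e0; exists (Num.truncn (e^-1 * (2 * M))).+1.
  rewrite ler_pdivrMr ?exprn_gt0// -ler_pdivrMl//.
  apply: le_trans (ltW (truncnS_gt _)) _; set N := (_.+1).
  by have -> : 2 ^+ N = (2 ^ N)%:R :> R by [rewrite natrX]; rewrite ler_nat ltnW// ltn_expl.
have bf : bounded_measurable s t f.
  split.
    apply: (measurable_fun_cvg (h := fun n => sval (u n))) => //.
      by move=> n; have [] := svalP (u n).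
    move=> x /=; rewrite in_itv /= => /andP[sx xt].
    apply/cvgrPdist_le => e e0; have [n ne] := small _ e0; near=> j.
    rewrite distrC (le_trans (fu x sx xt j))// (le_trans _ ne)//.
    rewrite ler_wpM2l ?mulr_ge0// lef_pV2 ?posrE ?exprn_gt0// ler_weXn2l ?ler1n//.
    by near: j; exact: nbhs_infty_ge.
  have [N N0 gN] := bounded_measurable_bound (svalP (u 0%N)).
  exists (N + 2 * M) => x sx xt.
  have := fu x sx xt 0%N; rewrite expr0 divr1 distrC => H.
  by rewrite -[f x](subrK (sval (u 0%N) x)) addrC (le_trans (ler_normD _ _))// lerD ?gN.
pose fX : X := exist _ f bf.
(* The limit is a fixed point on [s, t]; its image under [T] comes with a derivative and therefore
   is the solution. *)
have Tf x : s <= x -> x <= t -> sval (sval (T fX)) x = f x.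
  move=> sx xt; apply/eqP; rewrite -subr_eq0 -normr_le0; apply/ler_addgt0Pl => e e0.
  rewrite addr0; have [n ne] := small _ (divr_gt0 e0 (ltr0Sn _ 1)).
  have H1 : `|sval (sval (T fX)) x - sval (u n.+1) x| <= 2 * M / 2 ^+ n / 2.
    apply: Tdiff => // y sy yt; rewrite distrC; exact: fu.
  have H2 := fu x sx xt n.+1.
  rewrite -[X in `|X|](subrKA (sval (u n.+1) x)) (le_trans (ler_normD _ _))//.
  rewrite exprSr invfM mulrA in H2; lra.
case: (T fX) Tf => -[F bF] /= [F' [pF pF' Fs Ft]] FE.
exists F, F'; split=> //; split=> //.
by apply: primitive_ext pF' => // x sx xt; rewrite FE.
Unshelve. all: by end_near. Qed.

Lemma solution_green k1 k2 s t f f' g g' :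
  solution k1 s t f f' -> solution k2 s t g g' ->
  primitive s t (fun x => f' x * g x - f x * g' x) (fun x => (k1 x - k2 x) * (f x * g x)).
Proof.
move=> [pf pf'] [pg pg'].
by apply: primitive_ext (primitiveB (primitiveM pf' pg) (primitiveM pf pg')) => // x _ _;
  ring.
Qed.

(** Uniqueness expands f in the solutions with end values (1, 0) and (0, 1). Their Wronskian is
    constant, which makes the matrix symmetric. *)
Lemma dirichlet_to_neumann k s t K : s < t -> bounded_measurable s t k ->
  (forall x, s <= x -> x <= t -> `|k x| <= K) -> 34 * (K * (t - s) ^+ 2) <= 1 ->
  exists p11 p12 p22, forall f f', solution k s t f f' ->
    f' s = - (p11 * f s + p12 * f t) /\ f' t = p12 * f s + p22 * f t.
Proof.
move=> st bk kK Kh.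
have [f1 [f1' [sol1 f1s f1t]]] := solution_exists 1 0 st bk kK Kh.
have [f2 [f2' [sol2 f2s f2t]]] := solution_exists 0 1 st bk kK Kh.
have sym : f1' t = - f2' s.
  have := primitive_eq (ltW st) (solution_green sol1 sol2) (primitive_cst s t 0).
  rewrite f1s f1t f2s f2t subrr => H; apply/eqP; rewrite -subr_eq0; apply/eqP.
  rewrite -[RHS]H; first ring.
  by move=> x _ _; rewrite subrr mul0r.
exists (- f1' s), (- f2' s), (f2' t) => f f' sf.
have := solutionD sf (solutionD (solutionZ (- f s) sol1) (solutionZ (- f t) sol2)).
move=> /(solution0 st kK Kh); rewrite f1s f1t f2s f2t => H.
have {}H := H _ _; have [] := H _ _ s (lexx _) (ltW st); [ring|ring|move=> _ Hs].
have [] := H _ _ t (ltW st) (lexx _); [ring|ring|move=> _ Ht].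
split; first by apply/eqP; rewrite -subr_eq0 -[X in _ == X]Hs; apply/eqP; ring.
by apply/eqP; rewrite -subr_eq0 -[X in _ == X]Ht -sym; apply/eqP; ring.
Qed.

(** For a solution of f'' = k f this is the integral of f'^2 + k f^2, the quadratic form of the
    Dirichlet-to-Neumann map. *)
Definition edge_energy s t f f' : R := f t * f' t - f s * f' s.

(** Green's identity turns the difference of energies into (nu2 - nu1) times the integral of f g.
    Both factors are within m / 16 of the same affine function l, so f g lies between l^2 - 3/16 m^2
    and 2 m^2. *)
Lemma edge_energy_monotone k s t K a b nu1 nu2 f f' g g' : s < t ->
  nu1 <= nu2 ->
  (forall x, s <= x -> x <= t -> `|k x - nu1| <= K) ->
  (forall x, s <= x -> x <= t -> `|k x - nu2| <= K) ->
  34 * (K * (t - s) ^+ 2) <= 1 ->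
  solution (fun x => k x - nu1) s t f f' -> solution (fun x => k x - nu2) s t g g' ->
  f s = a -> f t = b -> g s = a -> g t = b ->
  (nu2 - nu1) * ((t - s) / 32) * (a ^+ 2 + b ^+ 2)
    <= edge_energy s t f f' - edge_energy s t g g'
    <= (nu2 - nu1) * (2 * (t - s)) * (a ^+ 2 + b ^+ 2).
Proof.
move=> st nu12 k1K k2K Kh solf solg fs ft gs gt.
have h0 : 0 < t - s by rewrite subr_gt0.
(* m is the larger of the two moduli; completing the square in a^2 + a b + b^2 leaves 3/4 m^2. *)
have [m m0 [am bm mab abm]] : exists2 m, 0 <= m & [/\ `|a| <= m, `|b| <= m,
    m ^+ 2 <= a ^+ 2 + b ^+ 2 & a ^+ 2 + b ^+ 2 <= 2 * m ^+ 2 /\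
    3 / 4 * m ^+ 2 <= a ^+ 2 + a * b + b ^+ 2].
  exists (Num.max `|a| `|b|); first by rewrite le_max normr_ge0.
  rewrite !le_max !lexx orbT /=; have [ab|ba] := leP `|a| `|b|; rewrite real_normK ?num_real//.
    have : a ^+ 2 <= b ^+ 2.
      by rewrite -real_normK ?num_real// -[leRHS]real_normK ?num_real// lerXn2r ?nnegrE.
    by have := sqr_ge0 (a + b / 2); have := sqr_ge0 a; split=> //; [|split]; lra.
  have : b ^+ 2 <= a ^+ 2.
    rewrite -real_normK ?num_real// -[leRHS]real_normK ?num_real//.
    by rewrite lerXn2r ?nnegrE// ltW.
  by have := sqr_ge0 (b + a / 2); have := sqr_ge0 b; split=> //; [|split]; lra.
have pfg : primitive s t (fun x => \int[mu]_(z in `[s, x]) (f z * g z)) (fun x => f x * g x).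
  apply: primitive_integral; apply: bounded_measurableM.
    exact: primitive_bounded solf.1.
  exact: primitive_bounded solg.1.
set J := fun x => _ in pfg.
have -> : edge_energy s t f f' - edge_energy s t g g' = (nu2 - nu1) * (J t - J s).
  have := primitive_eq (ltW st) (solution_green solf solg) (primitiveZ (nu2 - nu1) pfg).
  rewrite /edge_energy fs ft gs gt -mulrBr => <-; first ring.
  by move=> x _ _; ring.
have fm : `|f s| <= m by rewrite fs.
have fm' : `|f t| <= m by rewrite ft.
have gm : `|g s| <= m by rewrite gs.
have gm' : `|g t| <= m by rewrite gt.
rewrite -!mulrA; apply/andP; split; apply: ler_wpM2l; rewrite ?subr_ge0//.
  pose c := (b - a) / (t - s).
  have p1 : primitive s t (fun x => x - s) (fun=> 1 - 0).
    by apply: primitiveB; [exact: primitive_id|exact: primitive_cst].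
  have p2 := primitiveM p1 p1; have p3 := primitiveM p1 p2.
  (* A cubic primitive of l^2 - 3/16 m^2. Its increment is at least (t - s) (m^2 / 4 - 3/16 m^2) =
     (t - s) m^2 / 16, whence the 1/32. *)
  have pL := primitiveD (primitiveZ (a ^+ 2 - 3 / 16 * m ^+ 2) p1)
    (primitiveD (primitiveZ (a * c) p2) (primitiveZ (c ^+ 2 / 3) p3)).
  have H := primitive_le (ltW st) pL pfg; apply: (le_trans _ (H _)) => {H}; last first.
    move=> x sx xt.
    have := solution_near_interpolant st k1K Kh solf fm fm' sx xt.
    have := solution_near_interpolant st k2K Kh solg gm gm' sx xt.
    have := interpolant_bound st am bm sx xt.
    rewrite fs ft gs gt.
    have -> : interpolant s t a b x = a + c * (x - s) by rewrite /interpolant /c mulrAC mulrA.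
    set l := a + c * (x - s).
    have -> : (a ^+ 2 - 3 / 16 * m ^+ 2) * (1 - 0) +
      (a * c * ((1 - 0) * (x - s) + (x - s) * (1 - 0)) +
       c ^+ 2 / 3 * ((1 - 0) * ((x - s) * (x - s)) +
                     (x - s) * ((1 - 0) * (x - s) + (x - s) * (1 - 0))))
      = l ^+ 2 - 3 / 16 * m ^+ 2 by rewrite /l; field.
    move=> Hl Hd2 Hd1; rewrite -[f x](subrK l) -[g x](subrK l).
    move: Hd1 Hd2; set d1 := f x - l; set d2 := g x - l => Hd1 Hd2.
    have -> : (d1 + l) * (d2 + l) = l ^+ 2 + (l * d1 + l * d2 + d1 * d2) by ring.
    rewrite lerD2l.
    have A1 : `|l * d1| <= m * (m / 16) by rewrite normrM ler_pM.
    have A2 : `|l * d2| <= m * (m / 16) by rewrite normrM ler_pM.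
    have A3 : `|d1 * d2| <= (m / 16) * (m / 16) by rewrite normrM ler_pM.
    move: A1 A2 A3; rewrite !ler_norml => /andP[A1 _] /andP[A2 _] /andP[A3 _]; nra.
  rewrite !subrr !mul0r !mulr0 !addr0 subr0.
  have -> : (a ^+ 2 - 3 / 16 * m ^+ 2) * (t - s) + (a * c * ((t - s) * (t - s)) + c ^+ 2 / 3 *
     ((t - s) * ((t - s) * (t - s)))) =
     (t - s) * ((a ^+ 2 + a * b + b ^+ 2) / 3 - 3 / 16 * m ^+ 2).
    by rewrite /c; field; rewrite gt_eqF.
  rewrite -mulrA; apply: ler_wpM2l; first exact: ltW.
  by case: abm => ? ?; lra.
have := primitive_le (ltW st) pfg (primitiveZ (2 * m ^+ 2) (primitive_id s t)).
move=> H; apply: le_trans (H _) _.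
  move=> x sx xt; rewrite mulr1 (le_trans (ler_norm _))// normrM.
  have F1 := solution_bound st k1K Kh solf fm fm' sx xt.
  have F2 := solution_bound st k2K Kh solg gm gm' sx xt.
  rewrite (le_trans (ler_pM _ _ F1 F2))//; nra.
rewrite -mulrBr; nra.
Qed.

(* The Riccati substitution: if w' + w^2 <= k then [f f' - w f^2] has the derivative
   [(f' - w f)^2 + (k - w' - w^2) f^2 >= 0]. *)
Lemma edge_energy_riccati k s t f f' w0 w1 : s <= t -> solution k s t f f' ->
  (forall x, s <= x -> x <= t -> w1 + (w0 + w1 * x) ^+ 2 <= k x) ->
  (w0 + w1 * t) * f t ^+ 2 - (w0 + w1 * s) * f s ^+ 2 <= edge_energy s t f f'.
Proof.
move=> st [pf pf'] wk.
have pw : primitive s t (fun x => w0 + w1 * x) (fun=> 0 + w1 * 1).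
  by apply: primitiveD; [exact: primitive_cst|apply: primitiveZ; exact: primitive_id].
have := primitive_le st (primitive_cst s t 0)
  (primitiveB (primitiveM pf pf') (primitiveM pw (primitiveM pf pf))).
move=> H; rewrite /edge_energy -subr_ge0 -(subrr (0 : R)); apply: le_trans (H _) _; last first.
  by rewrite le_eqVlt; apply/orP; left; apply/eqP; ring.
move=> x sx xt; have := wk x sx xt; set w := w0 + w1 * x => wkx.
have -> : f' x * f' x + f x * (k x * f x) -
    ((0 + w1 * 1) * (f x * f x) + w * (f' x * f x + f x * f' x))
  = (f' x - w * f x) ^+ 2 + (k x - (w1 + w ^+ 2)) * f x ^+ 2 by ring.
by rewrite addr_ge0 ?sqr_ge0// mulr_ge0 ?sqr_ge0// subr_ge0.
Qed.

Lemma solutionS k s t s' t' f f' : s <= s' -> t' <= t ->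
  solution k s t f f' -> solution k s' t' f f'.
Proof. by move=> ss' tt' [pf pf']; split; exact: primitiveS ss' tt' _. Qed.

Lemma solution_glue k s t r f f' g g' : s <= t -> t <= r ->
  solution k s t f f' -> solution k t r g g' -> f t = g t -> f' t = g' t ->
  solution k s r (fun x => if x <= t then f x else g x)
                 (fun x => if x <= t then f' x else g' x).
Proof.
move=> st tr [pf pf'] [pg pg'] fg fg'.
have lf (u v : R -> R) x : s <= x -> x <= t -> u x = if x <= t then u x else v x by move=> _ ->.
have rg (u v : R -> R) x : u t = v t -> t <= x -> x <= r -> v x = if x <= t then u x else v x.
  by move=> uv; rewrite le_eqVlt => /predU1P[<-|tx] _; rewrite ?lexx// leNgt tx.
split; apply: (@primitive_glue _ s t r) => //.
- by apply: primitive_ext pf => x sx xt; exact: lf.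
- by apply: primitive_ext pg => x tx xr; exact: rg.
- by apply: primitive_ext pf' => x sx xt; [exact: lf|rewrite xt].
- by apply: primitive_ext pg' => x tx xr; [exact: rg|rewrite -rg].
Qed.

End EdgeEquation.

(** * Inertia of Hermitian matrices *)

Section Inertia.
Variable C : numClosedFieldType.
Implicit Types d m r : nat.

Definition sqnorm d (u : 'rV[C]_d) : C := (u *m u^t*) 0 0.

Definition quad d (A : 'M[C]_d) (u : 'rV[C]_d) : C := (u *m A *m u^t*) 0 0.

Lemma sqnormE d (u : 'rV[C]_d) : sqnorm u = \sum_i `|u 0 i| ^+ 2.
Proof. by rewrite /sqnorm mxE; apply: eq_bigr => i _; rewrite !mxE normCK. Qed.

Lemma sqnorm_ge0 d (u : 'rV[C]_d) : 0 <= sqnorm u.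
Proof. by rewrite sqnormE sumr_ge0// => i _; rewrite exprn_ge0. Qed.

Lemma sqnorm_eq0 d (u : 'rV[C]_d) : sqnorm u = 0 -> u = 0.
Proof.
rewrite sqnormE => /psumr_eq0P H; apply/rowP => i; rewrite mxE; apply/eqP.
by rewrite -normr_eq0 -sqrf_eq0 H// => j _; rewrite exprn_ge0.
Qed.

Lemma sqnorm_gt0 d (u : 'rV[C]_d) : u != 0 -> 0 < sqnorm u.
Proof. by move=> u0; rewrite lt0r sqnorm_ge0 andbT; apply: contra_neq u0 => /sqnorm_eq0. Qed.

Lemma sqnorm_unitary r d (u : 'rV[C]_r) (P : 'M[C]_(r, d)) : P \is unitarymx ->
  sqnorm (u *m P) = sqnorm u.
Proof. by move=> Pu; rewrite /sqnorm trmx_mul map_mxM mulmxA mulmxtVK. Qed.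

Lemma mxrank_disjoint r1 r2 d (U : 'M[C]_(r1, d)) (V : 'M[C]_(r2, d)) :
  (forall u : 'rV_d, u != 0 -> (u <= U)%MS -> (u <= V)%MS -> False) ->
  (\rank U + \rank V <= d)%N.
Proof.
move=> UV; rewrite -mxrank_sum_cap.
suff -> : (U :&: V)%MS = 0 by rewrite mxrank0 addn0 rank_leq_col.
apply/eqP; rewrite -submx0; apply/rV_subP => u; rewrite sub_capmx => /andP[uU uV].
by rewrite submx0; apply/negP => /negP u0; exact: UV u0 uU uV.
Qed.

Section Diagonalization.
Variables (d : nat) (A : 'M[C]_d).
Hypothesis hA : A \is hermsymmx.

Local Notation P := (spectralmx A).
Local Notation D := (spectral_diag A).

Lemma spectral_decomposition : A = P^t* *m diag_mx D *m P.
Proof.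
rewrite -invmx_unitary ?spectral_unitarymx//.
by apply/orthomx_spectralP; exact: hermitian_normalmx.
Qed.

Definition eigspace (J : {set 'I_d}) : 'M[C]_(#|J|, d) :=
  rowsub (fun i : 'I_#|J| => enum_val i) P.

Lemma rank_eigspace J : \rank (eigspace J) = #|J|.
Proof.
apply: mxrank_unitary; apply/unitarymxP; rewrite /eigspace.
have /unitarymxP PP := spectral_unitarymx A.
apply/matrixP => i j; have /matrixP/(_ (enum_val i) (enum_val j)) := PP.
rewrite !mxE (inj_eq enum_val_inj) => <-; apply: eq_bigr => k _.
by rewrite !mxE.
Qed.

Lemma sub_eigspace (J : {set 'I_d}) (u : 'rV_d) : (u <= eigspace J)%MS ->
  exists2 w : 'rV_d, u = w *m P & forall i, i \notin J -> w 0 i = 0.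
Proof.
case/submxP=> v ->; exists (v *m rowsub (fun i : 'I_#|J| => enum_val i) 1%:M).
  by rewrite -mulmxA mul_rowsub_mx mul1mx.
move=> i iJ.
rewrite mxE big1// => k _; rewrite !mxE; case: eqP => [ki|]; last by rewrite mulr0.
by rewrite -ki enum_valP in iJ.
Qed.

Lemma mulmx_spectral (w : 'rV_d) : w *m P *m A = w *m diag_mx D *m P.
Proof.
by rewrite [X in _ *m X = _]spectral_decomposition !mulmxA mulmxtVK ?spectral_unitarymx.
Qed.

Lemma quad_spectral (w : 'rV_d) : quad A (w *m P) = \sum_i D 0 i * `|w 0 i| ^+ 2.
Proof.
rewrite /quad mulmx_spectral trmx_mul map_mxM mulmxA mulmxtVK ?spectral_unitarymx//.
rewrite mxE; apply: eq_bigr => i _.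
by rewrite mul_mx_diag !mxE normCK mulrAC mulrC mulrA.
Qed.

Lemma eig_real i : D 0 i \is Num.real.
Proof. by have /mxOverP := hermitian_spectral_diag_real hA; exact. Qed.

Definition eigpos : {set 'I_d} := [set i | (0 < D 0 i)%R]%SET.
Definition eignonneg : {set 'I_d} := [set i | (0 <= D 0 i)%R]%SET.
Definition eignonpos : {set 'I_d} := [set i | (D 0 i <= 0)%R]%SET.
Definition eigneg : {set 'I_d} := [set i | (D 0 i < 0)%R]%SET.
Definition eignull : {set 'I_d} := [set i | D 0 i == 0]%SET.

Lemma card_eignonposE : #|eignonpos| = (#|eigneg| + #|eignull|)%N.
Proof.
rewrite -[RHS]cardsUI (_ : eigneg :&: eignull = finset.set0)%SET ?cards0 ?addn0.
  by apply: eq_card => i; rewrite !inE le_eqVlt orbC.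
by apply/setP => i; rewrite !inE; case: eqP => [->|]; rewrite ?ltxx ?andbF.
Qed.

Lemma card_eigpos_compl : (#|eigpos| + #|eignonpos|)%N = d.
Proof.
rewrite -[RHS]card_ord -(cardsC eignonpos) addnC; congr (_ + _)%N.
by apply: eq_card => i; rewrite !inE real_ltNge ?real0 ?eig_real.
Qed.

Lemma card_eignonneg_compl : (#|eignonneg| + #|eigneg|)%N = d.
Proof.
rewrite -[RHS]card_ord -(cardsC eigneg) addnC; congr (_ + _)%N.
by apply: eq_card => i; rewrite !inE real_leNgt ?real0 ?eig_real.
Qed.

Lemma card_eignull_compl : (#|~: eignull| + #|eignull|)%N = d.
Proof. by rewrite -[RHS]card_ord -(cardsC eignull) addnC. Qed.

Lemma quad_eigspace_nonpos u : (u <= eigspace eignonpos)%MS ->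
  quad A u <= 0.
Proof.
case/sub_eigspace=> w -> wJ; rewrite quad_spectral -oppr_ge0 -sumrN sumr_ge0// => i _.
rewrite -mulNr; have [Di|Di] := boolP (D 0 i <= 0).
  by rewrite mulr_ge0 ?exprn_ge0// oppr_ge0.
by rewrite wJ ?inE// normr0 expr0n mulr0.
Qed.

Lemma quad_eigspace_nonneg u : (u <= eigspace eignonneg)%MS ->
  0 <= quad A u.
Proof.
case/sub_eigspace=> w -> wJ; rewrite quad_spectral sumr_ge0// => i _.
have [Di|Di] := boolP (0 <= D 0 i); first by rewrite mulr_ge0 ?exprn_ge0.
by rewrite wJ ?inE// normr0 expr0n mulr0.
Qed.

(** c is the minimum of 1 and the moduli of the nonzero eigenvalues. *)
Lemma spectral_gap : exists2 c : C, 0 < c &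
  (forall u, (u <= eigspace eigpos)%MS -> c * sqnorm u <= quad A u) /\
  (forall u, (u <= eigspace eigneg)%MS -> quad A u <= - (c * sqnorm u)).
Proof.
have [c c0 cD] : exists2 c : C, 0 < c & forall i, D 0 i != 0 -> c <= `|D 0 i|.
  pose s : seq C := [seq `|D 0 i| | i in [pred i | D 0 i != 0]].
  suff [c c0 cs] : exists2 c : C, 0 < c & forall x, x \in s -> c <= x.
    by exists c => // i Di; apply: cs; apply/fintype.imageP; exists i => //; rewrite inE.
  have : forall x, x \in s -> 0 < x by move=> x /fintype.imageP[i + ->]; rewrite inE normr_gt0.
  elim: s => [_|x r IH xs]; first by exists 1.
  have [|c c0 cs] := IH; first by move=> y yr; apply: xs; rewrite inE yr orbT.
  have x0 := xs x (mem_head _ _).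
  have cr : (c >=< x)%O by rewrite real_comparable ?gtr0_real.
  exists (Num.min c x); first by rewrite comparable_lt_min ?c0 ?x0.
  move=> y; rewrite inE comparable_ge_min// => /predU1P[->|/cs ->]//.
  by rewrite lexx orbT.
exists c => //; split=> u /sub_eigspace[w -> wJ];
  rewrite sqnorm_unitary ?spectral_unitarymx// quad_spectral.
  rewrite sqnormE mulr_sumr; apply: ler_sum => i _.
  have [Di|Di] := boolP (0 < D 0 i); last by rewrite wJ ?inE// normr0 expr0n !mulr0.
  apply: ler_wpM2r; first by rewrite exprn_ge0.
  by have := cD i; rewrite (gt_eqF Di) (ger0_norm (ltW Di)); exact.
rewrite sqnormE mulr_sumr -sumrN; apply: ler_sum => i _.
have [Di|Di] := boolP (D 0 i < 0); last by rewrite wJ ?inE// normr0 expr0n !mulr0 oppr0.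
rewrite -mulNr; apply: ler_wpM2r; first by rewrite exprn_ge0.
by have := cD i; rewrite (lt_eqF Di) (ler0_norm (ltW Di)) lerNr; exact.
Qed.

(** The half of the Courant-Fischer principle used for counting: the row space of T meets the span
    of the positive eigenvectors only in 0. *)
Lemma card_eignonpos_max r (T : 'M[C]_(r, d)) : row_free T ->
  (forall u, quad A (u *m T) <= 0) -> (r <= #|eignonpos|)%N.
Proof.
move=> /eqP Tr Tneg; have [c c0 [cpos _]] := spectral_gap.
have := @mxrank_disjoint _ _ _ T (eigspace eigpos) _.
rewrite Tr rank_eigspace => H; rewrite -(leq_add2l #|eigpos|) card_eigpos_compl.
rewrite addnC; apply: H => u u0 /submxP[v uE] /cpos; rewrite uE => H.
have := lt_le_trans (mulr_gt0 c0 (sqnorm_gt0 u0)); rewrite uE => /(_ _ H).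
by move=> /(fun h => lt_le_trans h (Tneg v)); rewrite ltxx.
Qed.

Lemma eignonpos_attained : exists T : 'M[C]_(#|eignonpos|, d), row_free T /\
  forall u, quad A (u *m T) <= 0.
Proof.
exists (eigspace eignonpos); split; first exact/eqP/rank_eigspace.
by move=> u; apply: quad_eigspace_nonpos; exact: submxMl.
Qed.

Lemma card_eignull_max r (T : 'M[C]_(r, d)) : row_free T -> T *m A = 0 -> (r <= #|eignull|)%N.
Proof.
move=> /eqP Tr TA.
have := @mxrank_disjoint _ _ _ T (eigspace (~: eignull)%SET) _.
rewrite Tr rank_eigspace => H; rewrite -(leq_add2l #|~: eignull|%SET) card_eignull_compl.
rewrite addnC; apply: H => u + /submxP[v uE] /sub_eigspace[w uw wJ].
apply/negP; rewrite negbK.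
have : u *m A = 0 by rewrite uE -mulmxA TA mulmx0.
rewrite uw mulmx_spectral => /(congr1 (mulmx^~ (P^t*))).
rewrite /= mulmxtVK ?spectral_unitarymx// mul0mx => wD.
suff -> : w = 0 by rewrite mul0mx.
apply/rowP => i; rewrite mxE; have [Di|Di] := boolP (D 0 i == 0).
  by apply: wJ; rewrite !inE Di.
move/rowP/(_ i): wD; rewrite mul_mx_diag !mxE => /eqP.
by rewrite mulf_eq0 (negbTE Di) orbF => /eqP.
Qed.

Lemma eignull_attained : exists T : 'M[C]_(#|eignull|, d), row_free T /\ T *m A = 0.
Proof.
exists (eigspace eignull); split; first exact/eqP/rank_eigspace.
apply/row_matrixP => i; rewrite row_mul row0.
have [w -> wJ] := sub_eigspace (row_sub i (eigspace eignull)).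
rewrite mulmx_spectral (_ : w *m _ = 0) ?mul0mx//.
apply/rowP => j; rewrite mul_mx_diag !mxE.
have [/eqP->|Dj] := boolP (D 0 j == 0); first by rewrite mulr0.
by rewrite wJ ?mul0r// inE.
Qed.

Lemma card_eignonpos0 : (forall u, u != 0 -> 0 < quad A u) -> #|eignonpos| = 0%N.
Proof.
move=> Apos; apply/eqP; rewrite -leqn0.
have := @mxrank_disjoint _ _ _ (eigspace eignonpos) 1%:M _.
rewrite rank_eigspace mxrank1 -[leqRHS]add0n leq_add2r; apply=> //.
by move=> u /Apos u0 /quad_eigspace_nonpos; rewrite lt_geF.
Qed.

End Diagonalization.

Lemma card_eigspace_disjoint d (A A' : 'M[C]_d) (J J' : {set 'I_d}) :
  (forall u : 'rV_d, u != 0 -> (u <= eigspace A J)%MS -> (u <= eigspace A' J')%MS ->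
    False) -> (#|J| + #|J'| <= d)%N.
Proof. by move/mxrank_disjoint; rewrite !rank_eigspace. Qed.

(** A perturbation of at most half the spectral gap moves no positive and no negative direction
    across 0; only null directions can change sign. *)
Lemma inertia_stable d (A : 'M[C]_d) : A \is hermsymmx ->
  exists2 c : C, 0 < c & forall A', A' \is hermsymmx ->
  (forall u, `|quad A' u - quad A u| <= c * sqnorm u) ->
  (#|eignonpos A'| <= #|eignonpos A|)%N /\ (#|eigneg A| <= #|eigneg A'|)%N.
Proof.
move=> hA; have [c c0 [cpos cneg]] := spectral_gap hA.
exists (c / 2); first by rewrite divr_gt0.
move=> A' hA' AA'.
have half u : u != 0 -> c * sqnorm u <= `|quad A' u - quad A u| -> False.
  move=> u0 /le_trans/(_ (AA' u)); rewrite ler_pM2r ?sqnorm_gt0// ler_pdivlMr//.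
  by rewrite ger_pMr// => /(lt_le_trans (ltr1n C 2)); rewrite ltxx.
split.
  rewrite -(leq_add2l #|eigpos A|) card_eigpos_compl// addnC.
  apply: card_eigspace_disjoint => u u0 /(quad_eigspace_nonpos hA') u2 /cpos u1.
  apply: (half u u0); have H : quad A' u - quad A u <= - (c * sqnorm u).
    by rewrite -[leRHS]add0r lerD// lerN2.
  rewrite ler0_norm; first by rewrite lerNr.
  by rewrite (le_trans H)// oppr_le0 mulr_ge0 ?sqnorm_ge0// ltW.
rewrite -(leq_add2l #|eignonneg A'|) card_eignonneg_compl//.
apply: card_eigspace_disjoint => u u0 /(quad_eigspace_nonneg hA') u2 /cneg u1.
apply: (half u u0); have H : c * sqnorm u <= quad A' u - quad A u.
  by rewrite -[leLHS]add0r lerD// lerNr.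
by rewrite ger0_norm// (le_trans _ H)// mulr_ge0 ?sqnorm_ge0// ltW.
Qed.

(** A nonzero vector nonpositive for A and nonnegative for A' would contradict the strict
    inequality, so the two eigenspaces meet only in 0. *)
Lemma eigneg_monotone d (A A' : 'M[C]_d) : A \is hermsymmx -> A' \is hermsymmx ->
  (forall u, u != 0 -> quad A' u < quad A u) -> (#|eignonpos A| <= #|eigneg A'|)%N.
Proof.
move=> hA hA' AA'.
rewrite -(leq_add2l #|eignonneg A'|) card_eignonneg_compl//.
rewrite addnC; apply: (@card_eigspace_disjoint _ A A').
move=> u u0 + /(quad_eigspace_nonneg hA') u1 => /(quad_eigspace_nonpos hA) u2.
by have := le_lt_trans u1 (lt_le_trans (AA' u u0) u2); rewrite ltxx.
Qed.

End Inertia.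

(** * Spectral flow of a Lipschitz family of Hermitian matrices *)

Section SpectralFlow.
Variable R : realType.
Local Notation C := R[i].

Lemma sum_le_jump (s : seq R) (k : R -> nat) (x y : R) : uniq s -> y < x ->
  (k x != 0 -> x \in s)%N ->
  (\sum_(nu <- s | (nu <= y)%R) k nu + k x <= \sum_(nu <- s | (nu <= x)%R) k nu)%N.
Proof.
move=> us yx kx.
have le_yx nu : nu <= y -> nu <= x by move=> /le_trans; apply; exact: ltW.
have [kx0|kx0] := eqVneq (k x) 0%N.
  rewrite kx0 addn0 [leqRHS](bigID (fun nu => (nu <= y)%R))/=.
  rewrite (eq_bigl (fun nu => (nu <= x)%R && (nu <= y)%R)) ?leq_addr// => nu.
  by have [/le_yx ->|] := boolP (nu <= y); rewrite ?andbF.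
rewrite -[leqRHS]big_filter (bigD1_seq x) ?filter_uniq ?mem_filter ?lexx ?kx//=.
rewrite addnC leq_add2l big_filter_cond.
rewrite [leqRHS](bigID (fun nu => (nu <= y)%R))/=.
rewrite (eq_bigl (fun nu => (nu <= x)%R && (nu != x) && (nu <= y)%R)) ?leq_addr// => nu.
have [ny|] := boolP (nu <= y); last by rewrite andbF.
by rewrite le_yx//= lt_eqF// (le_lt_trans ny).
Qed.

Lemma sum_le_mono (s : seq R) (k : R -> nat) (x y : R) : x <= y ->
  (\sum_(nu <- s | (nu <= x)%R) k nu <= \sum_(nu <- s | (nu <= y)%R) k nu)%N.
Proof.
move=> xy; rewrite [leqRHS](bigID (fun nu => (nu <= x)%R))/=.
rewrite (eq_bigl (fun nu => (nu <= y)%R && (nu <= x)%R)) ?leq_addr// => nu.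
by have [nx|] := boolP (nu <= x); rewrite ?andbF// (le_trans nx xy).
Qed.

(* Only semicontinuity of the inertia is used: just to the right of a point the number of
   nonpositive eigenvalues does not increase, and on reaching a point from the left it
   grows by at most the dimension of the kernel there. *)
Lemma spectral_flow d (A : R -> 'M[C]_d) (a b L : R) (s : seq R) (k : R -> nat) :
  a <= b -> 0 <= L ->
  (forall nu, a <= nu -> nu <= b -> A nu \is hermsymmx) ->
  (forall nu nu' u, a <= nu -> nu <= b -> a <= nu' -> nu' <= b ->
     `|quad (A nu) u - quad (A nu') u| <= (L * `|nu - nu'|)%:C%C * sqnorm u) ->
  (forall u, u != 0 -> 0 < quad (A a) u) ->
  (forall nu, a <= nu -> nu <= b -> (#|eignull (A nu)| <= k nu)%N) ->
  uniq s -> (forall nu, a <= nu -> nu <= b -> k nu != 0%N -> nu \in s) ->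
  (#|eignonpos (A b)| <= \sum_(nu <- s) k nu)%N.
Proof.
move=> ab L0 hA lip pos ker us ks.
pose Q x := (#|eignonpos (A x)| <= \sum_(nu <- s | (nu <= x)%R) k nu)%N.
(* Real induction: E collects the points up to which the bound holds throughout; its supremum lies
   in E and equals b. *)
pose E := [set x | a <= x <= b /\ forall y, a <= y -> y <= x -> Q y].
have stable x : a <= x -> x <= b -> exists2 del, 0 < del &
    forall y, a <= y -> y <= b -> `|y - x| <= del ->
    (#|eignonpos (A y)| <= #|eignonpos (A x)|)%N /\ (#|eigneg (A x)| <= #|eigneg (A y)|)%N.
  move=> ax xb; have [c c0 cA] := inertia_stable (hA x ax xb).
  have cE : (complex.Re c)%:C%C = c by rewrite RRe_real// gtr0_real.
  have Rc0 : 0 < complex.Re c by rewrite -ltcR cE.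
  (* The denominator is L + 1 because L may be 0. *)
  exists (complex.Re c / (L + 1)); first by rewrite divr_gt0// ltr_wpDl.
  move=> y ay yb yx; apply: cA; first exact: hA.
  move=> u; rewrite (le_trans (lip _ _ _ ay yb ax xb))// ler_wpM2r ?sqnorm_ge0//.
  rewrite -cE lecR (le_trans (ler_wpM2l L0 yx))// mulrCA ler_piMr// ?(ltW Rc0)//.
  by rewrite ler_pdivrMr ?mul1r ?lerDl// ltr_wpDl.
have Ea : E a.
  split; first by rewrite lexx.
  move=> y ay ya; have -> : y = a by apply/eqP; rewrite eq_le ya ay.
  by rewrite /Q card_eignonpos0// hA.
have supE : has_sup E.
  by split; [exists a|exists b => x [/andP[_ xb] _]].
have aS : a <= sup E by apply: ub_le_sup; [case: supE|].
have Sb : sup E <= b by apply: ge_sup; [case: supE|move=> x [/andP[_ ?] _]].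
have below y : a <= y -> y < sup E -> Q y.
  move=> ay; rewrite -subr_gt0 => yS; have [e [_ eQ]] := sup_adherent yS supE.
  by rewrite opprB addrCA subrr addr0 => ye; apply: eQ => //; exact: ltW.
have QS : Q (sup E).
  have [<-|aneS] := eqVneq a (sup E); first by case: Ea => _; apply.
  have aS' : a < sup E by rewrite lt_neqAle aneS.
  have [del del0 st] := stable _ aS Sb.
  (* Just left of sup E the bound is known and the negative directions at sup E persist; the other
     nonpositive directions at sup E are null and are paid for by [k (sup E)]. *)
  pose y := Num.max a (sup E - del).
  have ay : a <= y by rewrite le_max lexx.
  have yS : y < sup E by rewrite gt_max aS' ltrBlDr ltrDl.
  have yS1 : `|y - sup E| <= del.
    rewrite distrC ger0_norm ?subr_ge0 ?(ltW yS)// lerBlDr -lerBlDl le_max lexx orbT//.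
  have [_ H] := st y ay (le_trans (ltW yS) Sb) yS1.
  have Qy := below y ay yS; rewrite /Q card_eignonposE.
  rewrite (leq_trans _ (sum_le_jump us yS _))//; last exact: ks.
  apply: leq_add; last exact: ker.
  by rewrite (leq_trans H)// (leq_trans _ Qy)// card_eignonposE leq_addr.
have ES : E (sup E).
  split; first by rewrite aS Sb.
  by move=> y ay; rewrite le_eqVlt => /predU1P[->//|]; exact: below.
suff Sb' : sup E = b.
  rewrite -Sb'; apply: leq_trans QS _.
  by rewrite [leqRHS](bigID (fun nu => (nu <= sup E)%R))/= leq_addr.
apply/eqP; rewrite eq_le Sb leNgt; apply/negP => Sb1.
have [del del0 st] := stable _ aS Sb.
(* Just right of sup E there are no more nonpositive directions than at sup E, so E would extend
   beyond its supremum. *)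
pose y := Num.min b (sup E + del).
have Sy : sup E < y by rewrite lt_min Sb1 ltrDl.
have yb : y <= b by rewrite ge_min lexx.
suff : y <= sup E by rewrite leNgt Sy.
apply: ub_le_sup; first by case: supE.
split=> [|z az zy]; first by rewrite yb (le_trans aS (ltW Sy)).
have [/below|Sz] := ltP z (sup E); first exact.
have zb := le_trans zy yb.
have [|H _] := st z az zb.
  rewrite ger0_norm ?subr_ge0// lerBlDl (le_trans zy)// ge_min lexx orbT//.
by apply: leq_trans H (leq_trans QS _); exact: sum_le_mono.
Qed.

End SpectralFlow.

(** * Families of Hermitian forms on a subspace *)

Section Forms.
Variable R : realType.
Local Notation C := R[i].
Variable N : nat.
Implicit Types (f : 'rV[C]_N -> 'rV[C]_N -> C) (S : 'rV[C]_N -> Prop).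

Definition hermitian_form f :=
  (forall a u v w, f (a *: u + v) w = a * f u w + f v w) /\
  (forall u v, f v u = (f u v)^*).

Definition linear_subspace S := S 0 /\ forall a u v, S u -> S v -> S (a *: u + v).

Definition form_mx f d (X : 'M[C]_(d, N)) : 'M[C]_d :=
  \matrix_(i, j) f (row i X) (row j X).

Lemma hermitian_form_suml f d (u : 'rV[C]_d) (X : 'M[C]_(d, N)) w : hermitian_form f ->
  f (u *m X) w = \sum_i u 0 i * f (row i X) w.
Proof.
move=> [fl _]; have f0 : f 0 w = 0.
  by have := fl (-1) 0 0 w; rewrite scaleN1r oppr0 addr0 mulN1r addNr.
rewrite mulmx_sum_row; elim/big_rec2: _ => [//|i y1 y2 _ <-].
by rewrite fl.
Qed.

Lemma hermitian_form_sumr f d (u : 'rV[C]_d) (X : 'M[C]_(d, N)) w : hermitian_form f ->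
  f w (u *m X) = \sum_i (u 0 i)^* * f w (row i X).
Proof.
move=> hf; have [_ fs] := hf; rewrite fs hermitian_form_suml// rmorph_sum.
by apply: eq_bigr => i _; rewrite (fs (row i X) w) rmorphM.
Qed.

Lemma form_mxE f d (X : 'M[C]_(d, N)) (u v : 'rV[C]_d) : hermitian_form f ->
  (u *m form_mx f X *m v^t*) 0 0 = f (u *m X) (v *m X).
Proof.
move=> hf; rewrite hermitian_form_sumr// mxE; apply: eq_bigr => j _.
rewrite mulrC !mxE hermitian_form_suml//; congr (_ * _).
by apply: eq_bigr => i _; rewrite !mxE.
Qed.

Lemma form_mx_herm f d (X : 'M[C]_(d, N)) : hermitian_form f ->
  form_mx f X \is hermsymmx.
Proof.
move=> [_ fs]; apply/is_hermitianmxP; rewrite expr0 scale1r.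
by apply/matrixP => i j; rewrite !mxE.
Qed.

Lemma form_mx_null f d (X : 'M[C]_(d, N)) r (T : 'M[C]_(r, d)) : hermitian_form f ->
  T *m form_mx f X = 0 <-> forall i (u : 'rV_d), f (row i (T *m X)) (u *m X) = 0.
Proof.
move=> hf; split=> [TA i u|H].
  by rewrite row_mul -form_mxE// -row_mul TA row0 mul0mx mxE.
apply/row_matrixP => i; rewrite row0 row_mul; apply/rowP => j.
have := H i (delta_mx 0 j); rewrite row_mul -form_mxE// => H'.
rewrite [RHS]mxE -[RHS]H' [RHS]mxE (bigD1 j)//= big1 ?addr0 => [|k kj];
  rewrite !mxE !eqxx ?(negbTE kj) /=.
  by rewrite rmorph1 mulr1.
by rewrite rmorph0 mulr0.
Qed.

Lemma subspace_mulmx S r (T : 'M[C]_(r, N)) (u : 'rV_r) : linear_subspace S ->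
  (forall i, S (row i T)) -> S (u *m T).
Proof.
move=> [S0 Sl] ST; rewrite mulmx_sum_row; elim/big_rec: _ => // i y _ Sy; exact: Sl.
Qed.

(** An independent family of maximal size in S spans S. Gram-Schmidt makes it unitary, so
    coordinates preserve [sqnorm] and Lipschitz bounds for forms carry over to their matrices. *)
Lemma subspace_basis S : linear_subspace S ->
  exists d (X : 'M[C]_(d, N)), X \is unitarymx /\ forall z, S z <-> (z <= X)%MS.
Proof.
move=> hS.
pose P r := `[< exists T : 'M[C]_(r, N), row_free T /\ forall i, S (row i T) >].
have P0 : exists r, P r.
  exists 0%N; apply/asboolP; exists 0; split=> [|[]//].
  by rewrite /row_free mxrank0.
have PN r : P r -> (r <= N)%N.
  by move=> /asboolP[T [/eqP Tr _]]; rewrite -Tr; exact: rank_leq_col.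
case: (ex_maxnP P0 PN) => d Pd dmax; have dN := PN d Pd.
have /asboolP[T [Tf ST]] := Pd.
exists d, (schmidt T); split; first exact: schmidt_unitarymx.
move=> z; rewrite (eqmx_schmidt_free Tf); split; last by case/submxP=> u ->; exact: subspace_mulmx.
move=> Sz; apply/negP => /negP nz.
suff : (d.+1 <= d)%N by rewrite ltnn.
apply: dmax; apply/asboolP; rewrite -addn1; exists (col_mx T z); split.
  have : (T < T + z)%MS by rewrite ltmxE addsmxSl addsmx_sub submx_refl.
  move/rank_ltmx; rewrite (eqP Tf) addsmxE => lt_d.
  by rewrite /row_free eqn_leq rank_leq_row /=; apply: leq_trans lt_d; rewrite addn1.
move=> i; rewrite -(splitK i); case: (fintype.split i) => j /=.
  by rewrite rowKu.
by rewrite rowKd (_ : row j z = z)//; apply/rowP => k; rewrite mxE ord1.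
Qed.

Theorem form_spectral_flow S (f : R -> 'rV[C]_N -> 'rV[C]_N -> C) (a b L : R)
    (s : seq R) (k : R -> nat) :
  a <= b -> 0 <= L -> linear_subspace S -> (forall nu, hermitian_form (f nu)) ->
  (forall nu nu' z, a <= nu -> nu <= b -> a <= nu' -> nu' <= b ->
     `|f nu z z - f nu' z z| <= (L * `|nu - nu'|)%:C%C * sqnorm z) ->
  (forall z, S z -> z != 0 -> 0 < f a z z) ->
  (forall nu r (T : 'M[C]_(r, N)), a <= nu -> nu <= b -> row_free T ->
     (forall i, S (row i T)) -> (forall i w, S w -> f nu (row i T) w = 0) ->
     (r <= k nu)%N) ->
  uniq s -> (forall nu, a <= nu -> nu <= b -> k nu != 0%N -> nu \in s) ->
  forall r (T : 'M[C]_(r, N)), row_free T ->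
    (forall u : 'rV_r, S (u *m T) /\ f b (u *m T) (u *m T) <= 0) ->
    (r <= \sum_(nu <- s) k nu)%N.
Proof.
move=> ab L0 hS hf lip pos ker us ks r T Tf Tneg.
have [d [X [Xu SX]]] := subspace_basis hS.
have quadE nu u : quad (form_mx (f nu) X) u = f nu (u *m X) (u *m X).
  exact: form_mxE.
have Xf : row_free X by rewrite /row_free mxrank_unitary.
have X0 (u : 'rV_d) : u != 0 -> u *m X != 0.
  by apply: contra_neq => /eqP; rewrite mulmx_free_eq0// => /eqP.
apply: (@leq_trans #|eignonpos (form_mx (f b) X)|).
  have TX : (T <= X)%MS.
    apply/row_subP => i; apply/SX; rewrite -[T]mul1mx row_mul; apply: (Tneg _).1.
  case/submxP: TX => T' TE.
  apply: (@card_eignonpos_max _ _ _ (form_mx_herm _ (hf b)) _ T').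
    rewrite /row_free eqn_leq rank_leq_row /= -{1}(eqP Tf) TE; exact: mxrankM_maxl.
  by move=> u; rewrite quadE -mulmxA -TE; case: (Tneg u).
apply: (@spectral_flow _ _ (fun nu => form_mx (f nu) X) a b L) => //.
- by move=> nu _ _; exact: form_mx_herm.
- move=> nu nu' u anu nub anu' nub'; rewrite !quadE -(sqnorm_unitary _ Xu).
  exact: lip.
- by move=> u u0; rewrite quadE; apply: pos; [apply/SX; exact: submxMl|exact: X0].
- move=> nu anu nub.
  have [T' [T'f /(form_mx_null _ _ (hf nu)) T'0]] := eignull_attained (form_mx_herm X (hf nu)).
  apply: (ker nu _ (T' *m X)) => //.
  + by rewrite /row_free mxrankMfree.
  + by move=> i; apply/SX; rewrite row_mul; exact: submxMl.
  + by move=> i w /SX/submxP[u ->]; exact: T'0.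
Qed.

(** By induction the matrix at [lam i] has more than i nonpositive eigenvalues. With j0 the first
    index of the value [lam i], at least j0 directions were nonpositive at the preceding value and
    have become negative, and the kernel adds at least i + 1 - j0 more. *)
Theorem form_index_lower S (f : R -> 'rV[C]_N -> 'rV[C]_N -> C) (lam : nat -> R)
    (k : nat) :
  linear_subspace S -> (forall nu, hermitian_form (f nu)) ->
  (forall i j, (i <= j)%N -> lam i <= lam j) ->
  (forall i j z, (i <= k)%N -> (j <= k)%N -> lam i < lam j -> S z -> z != 0 ->
     f (lam j) z z < f (lam i) z z) ->
  (forall i, (i <= k)%N -> exists s : seq nat, [/\ uniq s,
     forall j, j \in s <-> lam j = lam i &
     exists T : 'M[C]_(size s, N), [/\ row_free T, forall i, S (row i T) &
       forall j w, S w -> f (lam i) (row j T) w = 0]]) ->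
  exists r (T : 'M[C]_(r, N)), [/\ (k < r)%N, row_free T &
    forall u : 'rV_r, S (u *m T) /\ f (lam k) (u *m T) (u *m T) <= 0].
Proof.
move=> hS hf mono strict ker.
have [d [X [Xu SX]]] := subspace_basis hS.
have Xf : row_free X by rewrite /row_free mxrank_unitary.
have X0 (u : 'rV_d) : u != 0 -> u *m X != 0.
  by apply: contra_neq => /eqP; rewrite mulmx_free_eq0// => /eqP.
pose A i := form_mx (f (lam i)) X.
have hA i : A i \is hermsymmx by exact: form_mx_herm.
have quadE i u : quad (A i) u = f (lam i) (u *m X) (u *m X) by exact: form_mxE.
have index i : (i <= k)%N -> (i < #|eignonpos (A i)|)%N.
  elim/ltn_ind: i => i IH ik.
  have [s [us sE [T [Tf ST T0]]]] := ker i ik.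
  have TX : (T <= X)%MS by apply/row_subP => j; apply/SX.
  case/submxP: TX => T' TE.
  have null : (size s <= #|eignull (A i)|)%N.
    apply: (@card_eignull_max _ _ _ (hA i) _ T').
      rewrite /row_free eqn_leq rank_leq_row /= -{1}(eqP Tf) TE; exact: mxrankM_maxl.
    apply/form_mx_null => // j u; rewrite -TE T0//; apply/SX; exact: submxMl.
  have si : i \in s by apply/sE.
  have [j0 [j0s j0min]] : exists j0, j0 \in s /\ forall j, j \in s -> (j0 <= j)%N.
    have ex : exists j, j \in s by exists i.
    by exists (ex_minn ex); case: ex_minnP.
  have j0i : (j0 <= i)%N := j0min i si.
  have sz : (i.+1 - j0 <= size s)%N.
    rewrite -(size_iota j0 (i.+1 - j0)); apply: uniq_leq_size; first exact: iota_uniq.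
    move=> j; rewrite mem_iota subnKC ?(leq_trans j0i (leqnSn i))// => /andP[j0j ji].
    apply/sE/le_anti/andP; split; first by apply: mono; rewrite -ltnS.
    by rewrite -((sE j0).1 j0s) mono.
  have neg : (j0 <= #|eigneg (A i)|)%N.
    case: j0 j0s j0min j0i sz => // j0 j0s j0min j0i sz.
    have j0k : (j0 <= k)%N by rewrite (leq_trans _ ik)// ltnW.
    apply: leq_trans (IH j0 j0i j0k) _; apply: eigneg_monotone => // u u0.
    rewrite !quadE; apply: strict => //; last exact: X0.
      rewrite lt_neqAle mono ?(ltnW j0i)// andbT; apply/eqP => /sE/j0min.
      by rewrite ltnn.
    by apply/SX; exact: submxMl.
  rewrite card_eignonposE; apply: leq_trans (leq_add neg (leq_trans sz null)).
  by rewrite subnKC// (leq_trans j0i (leqnSn i)).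
have [T [Tf Tneg]] := eignonpos_attained (hA k).
exists _, (T *m X); split; first exact: (index k).
  by rewrite /row_free mxrankMfree.
move=> u; rewrite mulmxA; split; last by rewrite -quadE.
by apply/SX; exact: submxMl.
Qed.

End Forms.

(** * Weak solutions in H2 and classical integral equations *)

Section WeakSolutions.
Variable R : realType.
Implicit Types (l x y nu : R) (k g h : R -> R) (f : R -> R[i]).

Local Notation mu := (@lebesgue_measure R).
Local Notation cRe := (@complex.Re R).
Local Notation cIm := (@complex.Im R).

Lemma ae_imply (P Q : R -> Prop) : (forall x, P x -> Q x) ->
  {ae mu, forall x, P x} -> {ae mu, forall x, Q x}.
Proof. exact: (@filterS _ _ (ae_filter_ringOfSetsType mu)). Qed.

(** Domination by 1 + g^2 + h^2, which is integrable on a bounded interval. *)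
Lemma sqr_integrable l g h :
  measurable_fun (`[0, l]%classic : set R) g -> measurable_fun (`[0, l]%classic : set R) h ->
  (\int[mu]_(x in `[0%R, l]) (g x ^+ 2 + h x ^+ 2)%:E < +oo)%E ->
  mu.-integrable `[0, l] (EFin \o g).
Proof.
move=> mg mh fin.
have mgh : measurable_fun `[0, l] (fun x => g x ^+ 2 + h x ^+ 2).
  by apply: measurable_funD; exact: measurable_funX.
have igh : mu.-integrable `[0, l] (fun x => (g x ^+ 2 + h x ^+ 2)%:E).
  apply/integrableP; split; first exact/measurable_EFinP.
  by under eq_integral do rewrite gee0_abs ?lee_fin ?addr_ge0 ?sqr_ge0//.
have i1 : mu.-integrable `[0, l] (EFin \o (fun=> 1 : R)).
  by apply: bounded_measurable_integrable; exact: bounded_measurable_cst.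
apply: le_integrable (integrableD _ i1 igh) => //; first exact/measurable_EFinP.
move=> x _ /=; rewrite lee_fin [leRHS]ger0_norm ?addr_ge0 ?sqr_ge0//.
have := sqr_ge0 (`|g x| - 1); have := sqr_ge0 (h x).
have := real_normK (num_real (g x)); have := normr_ge0 (g x).
by move: (g x) (h x) => a b; lra.
Qed.

Lemma bounded_sqr_integrable l g h : bounded_measurable 0 l g -> bounded_measurable 0 l h ->
  (\int[mu]_(x in `[0%R, l]) (g x ^+ 2 + h x ^+ 2)%:E < +oo)%E.
Proof.
move=> bg bh.
have bs : bounded_measurable 0 l (fun x => g x * g x + h x * h x).
  by apply: bounded_measurableD; exact: bounded_measurableM.
have /integrableP[_] := bounded_measurable_integrable bs.
apply: le_lt_trans; rewrite le_eqVlt; apply/orP; left; apply/eqP.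
by apply: eq_integral => x _ /=; rewrite -!expr2 ger0_norm// addr_ge0 ?sqr_ge0.
Qed.

Lemma increment_integral l g g' : mu.-integrable `[0, l] (EFin \o g') ->
  (forall x, 0 <= x -> x <= l -> g x = g 0 + \int[mu]_(z in `[0, x]) g' z) ->
  forall x y, 0 <= x -> x <= y -> y <= l -> g y - g x = \int[mu]_(z in `[x, y]) g' z.
Proof.
move=> ig' gE x y x0 xy yl.
rewrite gE ?(le_trans x0)// (gE x)// ?(le_trans xy)// (integral_split x0 xy)//; first ring.
by apply: integrableS ig' => //; apply: subset_itvScc; rewrite bnd_simp.
Qed.

Lemma increment_bounded l g g' : mu.-integrable `[0, l] (EFin \o g') ->
  (forall x, 0 <= x -> x <= l -> g x = g 0 + \int[mu]_(z in `[0, x]) g' z) ->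
  exists M, forall x, 0 <= x -> x <= l -> `|g x| <= M.
Proof.
move=> ig' gE; exists (`|g 0| + \int[mu]_(z in `[0, l]) `|g' z|) => x x0 xl.
rewrite gE// (le_trans (ler_normD _ _))// lerD2l.
have ix : mu.-integrable `[0, x] (EFin \o g').
  by apply: integrableS ig' => //; apply: subset_itvScc; rewrite bnd_simp.
rewrite (le_trans (le_normr_Rintegral _ _))// (integral_split x0 xl)//; last first.
  exact: integrable_norm.
by rewrite lerDl Rintegral_ge0.
Qed.

(** Bootstrap: integrability of g'' makes g' bounded, hence g Lipschitz and k g bounded. As k g
    equals g'' almost everywhere, it may replace g'' in the integral. *)
Lemma weak_solution k l g g' g'' :
  bounded_measurable 0 l k ->
  measurable_fun (`[0, l]%classic : set R) g' -> mu.-integrable `[0, l] (EFin \o g'') ->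
  (forall x, 0 <= x -> x <= l -> g x = g 0 + \int[mu]_(z in `[0, x]) g' z) ->
  (forall x, 0 <= x -> x <= l -> g' x = g' 0 + \int[mu]_(z in `[0, x]) g'' z) ->
  {ae mu, forall x, `[0, l]%classic x -> g'' x = k x * g x} ->
  solution k 0 l g g'.
Proof.
move=> bk mg' ig'' gE g'E kg.
have bg' : bounded_measurable 0 l g' by split=> //; exact: increment_bounded ig'' g'E.
have pg : primitive 0 l g g'.
  split=> //; apply: increment_integral gE; exact: bounded_measurable_integrable.
have bkg := bounded_measurableM bk (primitive_bounded pg).
split=> //; split=> // x y x0 xy yl; rewrite (increment_integral ig'' g'E)//.
congr fine; have sub : (`[x, y]%classic : set R) `<=` `[0, l].
  by apply: subset_itvScc; rewrite bnd_simp.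
apply: ae_eq_integral => //.
- by apply/measurable_EFinP; apply: measurable_funS sub _ => //;
    have /integrableP[/measurable_EFinP] := ig''.
- by apply/measurable_EFinP; apply: measurable_funS sub _ => //; case: bkg.
- by move: kg; apply: ae_imply => z kgz /sub /kgz ->.
Qed.

(** The coefficient k is real, so real and imaginary parts solve the same equation and the real
    theory applies to each. *)
Definition edge_solution k l f f' :=
  solution k 0 l (fun x => cRe (f x)) (fun x => cRe (f' x)) /\
  solution k 0 l (fun x => cIm (f x)) (fun x => cIm (f' x)).

Lemma H2_edge_solution q l nu f f' f'' : bounded_measurable 0 l q -> in_H2 l f f' f'' ->
  (fun x => nu%:C%C * f x) = (fun x => - f'' x + (q x)%:C%C * f x) %[ae mu in `[0, l]%classic] ->
  edge_solution (fun x => q x - nu) l f f'.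
Proof.
move=> bq [[[mR mI _] fE] [[mR2 mI2 fin2] f'E]] ae.
have bk : bounded_measurable 0 l (fun x => q x - nu).
  by apply: bounded_measurableB => //; exact: bounded_measurable_cst.
have itv x : 0 <= x -> x <= l -> x \in `[0, l] by move=> x0 xl; rewrite in_itv /= x0.
split.
  apply: (weak_solution (g'' := fun x => cRe (f'' x))) => //.
  - exact: sqr_integrable mR2 mI2 fin2.
  - by move=> x x0 xl; rewrite fE ?itv//; case: (f 0).
  - by move=> x x0 xl; rewrite f'E ?itv//; case: (f' 0).
  - move: ae; apply: ae_imply => x H /H /(congr1 cRe) /=.
    by case: (f x) (f'' x) => [a b] [a' b'] /= /eqP; rewrite -subr_eq0 => /eqP; lra.
apply: (weak_solution (g'' := fun x => cIm (f'' x))) => //.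
- apply: sqr_integrable mI2 mR2 _; by under eq_integral do rewrite addrC.
- by move=> x x0 xl; rewrite fE ?itv//; case: (f 0).
- by move=> x x0 xl; rewrite f'E ?itv//; case: (f' 0).
- move: ae; apply: ae_imply => x H /H /(congr1 cIm) /=.
  by case: (f x) (f'' x) => [a b] [a' b'] /= /eqP; rewrite -subr_eq0 => /eqP; lra.
Qed.

Lemma edge_solution_H2 k l f f' : edge_solution k l f f' ->
  in_H2 l f f' (fun x => (k x)%:C%C * f x).
Proof.
have primE (F : R -> R) g x : primitive 0 l F g -> x \in `[0, l] ->
    F x = F 0 + \int[mu]_(z in `[0, x]) g z.
  by move=> [_ pF]; rewrite in_itv /= => /andP[x0 xl]; rewrite -pF// addrC subrK.
have eqC (u v : R[i]) : cRe u = cRe v -> cIm u = cIm v -> u = v.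
  by case: u v => [a b] [a' b'] /= -> ->.
move=> [[pR pR'] [pI pI']].
have eR x : cRe ((k x)%:C%C * f x) = k x * cRe (f x).
  by case: (f x) => a b /=; rewrite mul0r subr0.
have eI x : cIm ((k x)%:C%C * f x) = k x * cIm (f x).
  by case: (f x) => a b /=; rewrite mul0r addr0.
split; split.
- have [[mR _] [mI _]] := (pR.1, pI.1); split=> //.
  by apply: bounded_sqr_integrable; [exact: pR.1|exact: pI.1].
- move=> x xl; apply: eqC; rewrite ?raddfD /=.
    by rewrite (primE _ _ _ pR xl); case: (f 0).
  by rewrite (primE _ _ _ pI xl); case: (f 0).
- split.
  + rewrite (_ : (fun x => _) = (fun x => k x * cRe (f x))); first by case: pR'.1.
    by apply/funext => x; exact: eR.
  + rewrite (_ : (fun x => _) = (fun x => k x * cIm (f x))); first by case: pI'.1.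
    by apply/funext => x; exact: eI.
  + under eq_integral => z _ do rewrite (eR z) (eI z).
    by apply: bounded_sqr_integrable; [exact: pR'.1|exact: pI'.1].
- move=> x xl; apply: eqC => /=.
    rewrite (primE _ _ _ pR' xl); case: (f' 0) => a b /=; congr (_ + _).
    by apply: eq_Rintegral => z _; rewrite eR.
  rewrite (primE _ _ _ pI' xl); case: (f' 0) => a b /=; congr (_ + _).
  by apply: eq_Rintegral => z _; rewrite eI.
Qed.

(** The mean of g over [x, y] is 0, so |g x| is at most M (y - x), which is made small. The argument
    needs room to the right of x; the end l follows by continuity. *)
Lemma primitive_ae0 l g g' : primitive 0 l g g' ->
  {ae mu, forall x, `[0, l]%classic x -> g x = 0} ->
  forall x, 0 <= x -> x < l -> g x = 0.
Proof.
move=> pg g0 x x0 xl.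
have [M M0 gM] := bounded_measurable_bound pg.1.
have bg := primitive_bounded pg.
have int0 y : x <= y -> y <= l -> \int[mu]_(z in `[x, y]) g z = 0.
  move=> xy yl; have sub : (`[x, y]%classic : set R) `<=` `[0, l].
    by apply: subset_itvScc; rewrite bnd_simp.
  rewrite -(mul0r (fine (mu `[x, y]))) -Rintegral_cst//; congr fine.
  apply: ae_eq_integral => //.
    by apply/measurable_EFinP; apply: measurable_funS sub _ => //; case: bg.
  by move: g0; apply: ae_imply => z g0z /sub /g0z ->.
apply/eqP; rewrite -normr_le0; apply/ler_addgt0Pl => e e0; rewrite addr0.
pose y := Num.min l (x + e / (M + 1)).
have xy : x < y by rewrite lt_min xl ltrDl divr_gt0// ltr_wpDl.
have yl : y <= l by rewrite ge_min lexx.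
have bd : bounded_measurable x y (fun z => g x - g z).
  by apply: bounded_measurableB; [exact: bounded_measurable_cst|exact: bounded_measurableS bg].
have := integral_bound (M := M * (y - x)) (ltW xy) bd.
have igx : mu.-integrable `[x, y] (EFin \o (fun=> g x)).
  by apply: bounded_measurable_integrable; exact: bounded_measurable_cst.
have ig : mu.-integrable `[x, y] (EFin \o g).
  by apply: bounded_measurable_integrable; exact: bounded_measurableS bg.
rewrite RintegralB// int0 ?(ltW xy)// subr0 Rintegral_cst//= lebesgue_measure_itv /= lte_fin xy /=.
rewrite normrM (gtr0_norm (_ : 0 < y - x)) ?subr_gt0// ler_pM2r ?subr_gt0// => H.
apply: le_trans (H _) _.
  move=> z xz zy; rewrite distrC (le_trans (primitive_lipschitz pg gM x0 xz (le_trans zy yl)))//.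
  by rewrite ler_wpM2l// lerB.
have : y - x <= e / (M + 1) by rewrite lerBlDl ge_min lexx orbT.
move=> /(ler_wpM2l M0)/le_trans; apply.
by rewrite mulrCA ler_piMr ?(ltW e0)// ler_pdivrMr ?mul1r ?lerDl// ltr_wpDl.
Qed.

Lemma primitive_ae_eq0 l g g' : 0 < l -> primitive 0 l g g' ->
  {ae mu, forall x, `[0, l]%classic x -> g x = 0} ->
  forall x, 0 <= x -> x <= l -> g x = 0.
Proof.
move=> l0 pg g0 x x0; rewrite le_eqVlt => /predU1P[->{x x0}|]; last exact: (primitive_ae0 pg).
have [M M0 gM] := bounded_measurable_bound pg.1.
apply/eqP; rewrite -normr_le0; apply/ler_addgt0Pl => e e0; rewrite addr0.
pose x := Num.max 0 (l - e / (M + 1)).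
have x0 : 0 <= x by rewrite le_max lexx.
have xl : x < l by rewrite gt_max l0 ltrBlDr ltrDl divr_gt0// ltr_wpDl.
have := primitive_lipschitz pg gM x0 (ltW xl) (lexx l).
rewrite (primitive_ae0 pg g0 x0 xl) subr0 => /le_trans; apply.
have : l - x <= e / (M + 1) by rewrite lerBlDr -lerBlDl le_max lexx orbT.
move=> /(ler_wpM2l M0)/le_trans; apply.
by rewrite mulrCA ler_piMr ?(ltW e0)// ler_pdivrMr ?mul1r ?lerDl// ltr_wpDl.
Qed.

Lemma solution_glue_nat k (X : nat -> R) n (F F' : nat -> R -> R) :
  (forall j, X j <= X j.+1) ->
  (forall j, (j < n.+1)%N -> solution k (X j) (X j.+1) (F j) (F' j)) ->
  (forall j, (j < n)%N -> F j (X j.+1) = F j.+1 (X j.+1) /\ F' j (X j.+1) = F' j.+1 (X j.+1)) ->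
  exists (f f' : R -> R), solution k (X 0%N) (X n.+1) f f' /\
    forall j x, (j < n.+1)%N -> X j <= x -> x <= X j.+1 -> f x = F j x /\ f' x = F' j x.
Proof.
move=> Xmono; elim: n => [|n IH] sol match_.
  exists (F 0%N), (F' 0%N); split; first exact: sol.
  by move=> [|j].
have [f [f' [solf ff']]] := IH (fun j jn => sol j (ltnW jn)) (fun j jn => match_ j (ltnW jn)).
have X0 m : X 0%N <= X m by elim: m => // m /le_trans; apply.
have [fX f'X] : f (X n.+1) = F n.+1 (X n.+1) /\ f' (X n.+1) = F' n.+1 (X n.+1).
  have [-> ->] := ff' n (X n.+1) (ltnSn n) (Xmono n) (lexx _); exact: match_.
exists (fun x => if x <= X n.+1 then f x else F n.+1 x),
  (fun x => if x <= X n.+1 then f' x else F' n.+1 x).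
split; first by apply: solution_glue => //; exact: sol.
move=> j x; rewrite ltnS leq_eqVlt => /predU1P[->|jn] jx xj; last first.
  have Xm a b : (a <= b)%N -> X a <= X b.
    elim: b => [|b IHb]; rewrite leq_eqVlt => /predU1P[->//|]//.
    by rewrite ltnS => /IHb /le_trans; apply.
  by rewrite (le_trans xj (Xm _ _ jn)); exact: ff'.
by case: leP => // xle; have -> : x = X n.+1 by apply/eqP; rewrite eq_le xle jx.
Qed.

End WeakSolutions.

(** * Eigenfunctions as solutions of integral equations *)

Section Eigenfunctions.
Variables (R : realType) (G : metric_graph R).
Implicit Types (q : edge G -> R -> R) (f g : graph_fun G).

Local Notation mu := (@lebesgue_measure R).

Lemma schrodinger_ae_eq q q' (c : conditions G) :
  (forall e, q e = q' e %[ae mu in `[0, len G e]%classic]) ->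
  schrodinger q c = schrodinger q' c.
Proof.
have impl q1 q2 : (forall e, q1 e = q2 e %[ae mu in `[0, len G e]%classic]) ->
    forall f g, schrodinger q1 c f g -> schrodinger q2 c f g.
  move=> qq f g [f' [f'' [H2 vc eq]]]; exists f', f''; split=> // e.
  have := filterI (Filter := ae_filter_ringOfSetsType mu) (eq e) (qq e).
  apply: ae_imply => x [H1 H2x] Dx; rewrite H1//.
  by rewrite H2x.
move=> qq; apply/funext => f; apply/funext => g; apply/propext; split.
  exact: impl.
apply: impl => e; move: (qq e); apply: ae_imply => x H /H ->; exact: erefl.
Qed.

(** Truncation at the essential bounds changes q only on null sets and gives bounds valid at every
    point; their sum over the edges serves as one common B. *)
Lemma bounded_representative q : essentially_bounded q ->
  exists q' B, [/\ forall e, q e = q' e %[ae mu in `[0, len G e]%classic],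
    forall e, bounded_measurable 0 (len G e) (q' e) & forall e x, `|q' e x| <= B].
Proof.
move=> qb.
have [M HM] := choice (fun e => (qb e).2).
exists (fun e x => Num.max (- `|M e|) (Num.min `|M e| (q e x))), (\sum_e `|M e|).
have bound e x : `|Num.max (- `|M e|) (Num.min `|M e| (q e x))| <= `|M e|.
  by rewrite ler_norml le_max lexx ge_max ge_min lexx /= andbT
    (le_trans _ (normr_ge0 _))// oppr_le0.
split.
- move=> e; move: (HM e); apply: ae_imply => x H Dx.
  have := H _; rewrite inE /= in Dx *; move=> /(_ Dx) qM.
  have qM' : `|q e x| <= `|M e| by rewrite (le_trans qM) ?ler_norm.
  by move: qM'; rewrite ler_norml => /andP[q1 q2]; rewrite (min_idPr q2) (max_idPr q1).
- move=> e; split; last by exists `|M e| => x _ _.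
  apply: measurable_maxr; first exact: measurable_cst.
  by apply: measurable_minr; [exact: measurable_cst|exact: (qb e).1].
- move=> e x; rewrite (le_trans (bound e x))// (bigD1 e)//= lerDl sumr_ge0//.
Qed.

Definition eigenfunction q (c : conditions G) (nu : R) f f' :=
  (forall e, edge_solution (fun x => q e x - nu) (len G e) (f e) (f' e)) /\
  forall v, vc_holds (c v) (bdry_val f v) (bdry_der f' v).

Lemma in_eigenspaceP q c nu f : (forall e, bounded_measurable 0 (len G e) (q e)) ->
  in_eigenspace (schrodinger q c) nu f <-> exists f', eigenfunction q c nu f f'.
Proof.
move=> bq; split=> [[f' [f'' [H2 vc eq]]]|[f' [sol vc]]].
  exists f'; split=> // e; exact: H2_edge_solution (bq e) (H2 e) (eq e).
exists f', (fun e x => (q e x - nu)%:C%C * f e x); split=> // [e|e].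
  exact: edge_solution_H2.
apply: (@ae_imply _ (fun=> True)) => [x _ _|]; last first.
  exact: (filterT (Filter := ae_filter_ringOfSetsType mu)).
by rewrite rmorphB; ring.
Qed.

End Eigenfunctions.

(** * Vertex conditions *)

Section VertexConditions.
Variables (R : realType) (m : nat) (c : vertex_condition R m).
Implicit Types F W : 'cV[R[i]]_m.

Local Notation D := (vcD c).
Local Notation N := (vcN c).
Local Notation P := (vcR c).
Local Notation L := (vcL c).

Lemma hermE n (M : 'M[R[i]]_n) : M \is hermsymmx -> M^t* = M.
Proof. by move/is_hermitianmxP => {2}->; rewrite expr0 scale1r. Qed.

Lemma trCM n1 n2 n3 (A : 'M[R[i]]_(n1, n2)) (B : 'M[R[i]]_(n2, n3)) :
  (A *m B)^t* = B^t* *m A^t*.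
Proof. by rewrite trmx_mul map_mxM. Qed.

Lemma vcRL : P *m L = L.
Proof. by rewrite -(vcL_ran c) !mulmxA (vcR_proj c).2. Qed.

Lemma vcLR : L *m P = L.
Proof. by rewrite -(vcL_ran c) -!mulmxA (vcR_proj c).2. Qed.

Lemma vcNL : N *m L = 0.
Proof. by have [_ _ NR] := vc_orth c; rewrite -vcRL mulmxA NR mul0mx. Qed.

Lemma vcRN : P *m N = 0.
Proof.
have [_ _ NR] := vc_orth c.
by rewrite -(hermE (vcR_proj c).1) -(hermE (vcN_proj c).1) -trCM NR trmx0 map_mx0.
Qed.

(** The projection complementary to [vcD]; its range is the form domain at the vertex. *)
Definition nonDirichlet := N + P.

Lemma nonDirichlet_herm : nonDirichlet^t* = nonDirichlet.
Proof.
by rewrite /nonDirichlet linearD map_mxD (hermE (vcN_proj c).1) (hermE (vcR_proj c).1).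
Qed.

Lemma nonDirichlet_idem : nonDirichlet *m nonDirichlet = nonDirichlet.
Proof.
have [_ _ NR] := vc_orth c.
rewrite /nonDirichlet mulmxDl !mulmxDr NR vcRN addr0 add0r.
by rewrite (vcN_proj c).2 (vcR_proj c).2.
Qed.

Lemma vcD_nonDirichlet : D *m nonDirichlet = 0.
Proof. by have [DN DR _] := vc_orth c; rewrite /nonDirichlet mulmxDr DN DR addr0. Qed.

Lemma vcD_ker W : D *m W = 0 -> W = nonDirichlet *m W.
Proof.
by move=> DW; rewrite -[LHS]mul1mx -(vc_sum c) -addrA mulmxDl DW add0r.
Qed.

(** Weak form of the vertex condition, with [L F - F'] as defect; [vc_holds_of_orthogonal] is the
    converse. *)
Lemma vc_holds_orthogonal F F' W : vc_holds c F F' -> D *m W = 0 ->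
  W^t* *m (L *m F - F') = 0.
Proof.
move=> [DF NF RF] /vcD_ker ->; rewrite trCM nonDirichlet_herm -mulmxA.
rewrite /nonDirichlet mulmxBr !mulmxDl !mulmxA vcNL vcRL mul0mx add0r NF add0r RF.
by rewrite mulmxA vcLR subrr mulmx0.
Qed.

Lemma vcN_nonDirichlet : N *m nonDirichlet = N.
Proof. by have [_ _ NR] := vc_orth c; rewrite /nonDirichlet mulmxDr NR addr0 (vcN_proj c).2. Qed.

Lemma vcR_nonDirichlet : P *m nonDirichlet = P.
Proof. by rewrite /nonDirichlet mulmxDr vcRN add0r (vcR_proj c).2. Qed.

Lemma vc_holds_of_orthogonal F F' : D *m F = 0 ->
  nonDirichlet *m (L *m F - F') = 0 -> vc_holds c F F'.
Proof.
move=> DF H; split=> //.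
  have /(congr1 (mulmx N)) := H; rewrite mulmx0 mulmxA vcN_nonDirichlet.
  by rewrite mulmxBr mulmxA vcNL mul0mx sub0r => /eqP; rewrite oppr_eq0 => /eqP.
have /(congr1 (mulmx P)) := H; rewrite mulmx0 mulmxA vcR_nonDirichlet.
rewrite mulmxBr !mulmxA vcRL vcLR => /eqP; rewrite subr_eq0 => /eqP <-//.
Qed.

(** Applied to a vertex defect: tested with its own projection it yields a sum of squares. *)
Lemma nonDirichlet_sqnorm F : ((nonDirichlet *m F)^t* *m F) 0 0 =
  \sum_i `|(nonDirichlet *m F) i 0| ^+ 2.
Proof.
have -> : (nonDirichlet *m F)^t* *m F = (nonDirichlet *m F)^t* *m (nonDirichlet *m F).
  rewrite trCM nonDirichlet_herm -[RHS]mulmxA [in RHS](mulmxA nonDirichlet).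
  by rewrite nonDirichlet_idem mulmxA.
rewrite mxE; apply: eq_bigr => i _.
by rewrite [X in X * _]mxE [X in X^* * _]mxE normCK mulrC.
Qed.

Definition vc_form F W : R[i] := (W^t* *m L *m F) 0 0.

Lemma vc_form_conj F W : vc_form W F = (vc_form F W)^*.
Proof.
rewrite /vc_form (_ : F^t* *m L *m W = (W^t* *m L *m F)^t*).
  by rewrite [LHS]mxE [X in X^* = _]mxE.
by rewrite !trCM trmxCK mulmxA (hermE (vcL_herm c)).
Qed.

(** [delta_type] does not display the projections, so the form is evaluated through the admissible
    pair (F, L F): the entries of L F sum to alpha z, and F is the constant z. *)
Lemma vc_delta_form alpha F : delta_type alpha c -> D *m F = 0 ->
  exists2 z, forall j, F j 0 = z & vc_form F F = alpha%:C%C * `|z| ^+ 2.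
Proof.
move=> hc DF; have vcF : vc_holds c F (L *m F).
  split=> //; first by rewrite mulmxA vcNL mul0mx.
  by rewrite !mulmxA vcRL vcLR.
have [z [Fz sF]] := (hc _ _).1 vcF; exists z => //.
rewrite /vc_form -mulmxA mxE normCK mulrA -sF mulr_suml; apply: eq_bigr => j _.
by rewrite mulrC [X in _ * X]mxE [X in _ * X^*]mxE Fz.
Qed.

Lemma vc_delta_const alpha F z : delta_type alpha c -> (0 < m)%N ->
  (forall j, F j 0 = z) -> D *m F = 0.
Proof.
move=> hc m0 Fz; pose i0 := Ordinal m0.
(* Any vector with entry sum alpha z completes F to an admissible pair; here the whole sum sits in
   one entry. *)
have [//] : vc_holds c F (\col_j (alpha%:C%C * z *+ (j == i0))).
apply/hc; exists z; split=> //.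
rewrite (bigD1 i0)//= big1 ?addr0 ?mxE ?eqxx// => j ji.
by rewrite mxE (negbTE ji).
Qed.

End VertexConditions.

(** * The form on node values *)

Section NodeForm.
Variables (R : realType) (E : finType) (m : nat).
Local Notation C := R[i].
Implicit Types (p : E -> nat -> R * R * R) (e : E) (j : nat).

(** Every edge carries m + 2 nodes, ends included. Ends meeting at a vertex are not identified, so
    the node space depends only on the edge set and m. *)
Definition nnodes := #|{: E * 'I_m.+2}|.
Implicit Types z w u v : 'rV[C]_nnodes.

(** Natural indices let the neighbour of j be written [j.+1]; the intended range is j < m + 2. *)
Definition node z e j : C := z 0 (enum_rank (e, inord j : 'I_m.+2)).

Lemma node_lin a u v e j : node (a *: u + v) e j = a * node u e j + node v e j.
Proof. by rewrite /node !mxE. Qed.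

Lemma node0 e j : node 0 e j = 0.
Proof. by rewrite /node mxE. Qed.

Lemma node_eq0 z : (forall e j, (j < m.+2)%N -> node z e j = 0) -> z = 0.
Proof.
move=> H; apply/rowP => i; rewrite mxE -(enum_valK i).
case: (enum_val i) => e j; have := H e j (ltn_ord j).
by rewrite /node inord_val.
Qed.

Lemma node_exists (Z : E -> nat -> C) :
  exists z, forall e j, (j < m.+2)%N -> node z e j = Z e j.
Proof.
exists (\row_i Z (enum_val i : E * 'I_m.+2).1 (enum_val i : E * 'I_m.+2).2) => e j jm.
by rewrite /node mxE enum_rankK /= inordK.
Qed.

Lemma sqnorm_node z : sqnorm z = \sum_e \sum_(j < m.+2) `|node z e j| ^+ 2.
Proof.
rewrite sqnormE pair_big /= (reindex (@enum_val _ {: E * 'I_m.+2})) /=; last first.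
  by apply: onW_bij; exact: enum_val_bij.
apply: eq_bigr => i _; rewrite /node inord_val -surjective_pairing enum_valK.
by [].
Qed.

(* [dplus p z e j] and [dminus p z e j] are the derivatives, at the left and at the right
   end of the j-th piece, of the solution with the node values z. *)
Definition dplus p z e j : C :=
  - ((p e j).1.1%:C%C * node z e j + (p e j).1.2%:C%C * node z e j.+1).

Definition dminus p z e j : C :=
  (p e j).1.2%:C%C * node z e j + (p e j).2%:C%C * node z e j.+1.

Definition edge_form p z w : C := \sum_e \sum_(j < m.+1)
  ((node w e j.+1)^* * dminus p z e j - (node w e j)^* * dplus p z e j).

Lemma edge_form_lin p a u v w :
  edge_form p (a *: u + v) w = a * edge_form p u w + edge_form p v w.
Proof.
rewrite /edge_form mulr_sumr -big_split; apply: eq_bigr => e _ /=.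
rewrite mulr_sumr -big_split; apply: eq_bigr => j _ /=.
by rewrite /dminus /dplus !node_lin; ring.
Qed.

Lemma conj_real (x : R) : (x%:C%C)^* = x%:C%C :> C.
Proof. exact: conjc_real. Qed.

Lemma edge_form_conj p u v : edge_form p v u = (edge_form p u v)^*.
Proof.
rewrite /edge_form rmorph_sum; apply: eq_bigr => e _ /=.
rewrite rmorph_sum; apply: eq_bigr => j _ /=.
rewrite /dminus /dplus rmorphB !rmorphM rmorphN !rmorphD !rmorphM /=.
rewrite !conjCK !conj_real; ring.
Qed.

(** Summation by parts: terms are regrouped from pieces to nodes, so an interior node is paired with
    the jump of the derivative there. *)
Lemma edge_form_abel p z w : edge_form p z w = \sum_e
  ((node w e m.+1)^* * dminus p z e m - (node w e 0)^* * dplus p z e 0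
   + \sum_(j < m) (node w e j.+1)^* * (dminus p z e j - dplus p z e j.+1)).
Proof.
apply: eq_bigr => e _; rewrite big_split /= big_ord_recr /= sumrN big_ord_recl /=.
have -> : \sum_(j < m) (node w e j.+1)^* * (dminus p z e j - dplus p z e j.+1) =
    \sum_(j < m) (node w e j.+1)^* * dminus p z e j -
    \sum_(j < m) (node w e j.+1)^* * dplus p z e j.+1.
  by rewrite -sumrB; apply: eq_bigr => j _; rewrite mulrBr.
ring.
Qed.

Definition piece_form (t : R * R * R) (a b : R) : R :=
  t.1.1 * a ^+ 2 + 2 * t.1.2 * a * b + t.2 * b ^+ 2.

Definition edge_energy_sum p z : R := \sum_e \sum_(j < m.+1)
  (piece_form (p e j) (complex.Re (node z e j)) (complex.Re (node z e j.+1)) +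
   piece_form (p e j) (complex.Im (node z e j)) (complex.Im (node z e j.+1))).

(** The piece matrices are real and symmetric, so mixed terms of real and imaginary parts cancel. *)
Lemma edge_form_diag p z : edge_form p z z = (edge_energy_sum p z)%:C%C.
Proof.
rewrite /edge_form /edge_energy_sum rmorph_sum; apply: eq_bigr => e _ /=.
rewrite rmorph_sum; apply: eq_bigr => j _ /=; rewrite /dplus /dminus /piece_form.
case: (p e j) => [[p11 p12] p22] /=.
case: (node z e j) (node z e j.+1) => [a b] [a' b'].
apply/eqP; rewrite eq_complex /=; apply/andP; split; apply/eqP; simpc; rewrite /=; ring.
Qed.

End NodeForm.

(** * The form of the graph: edge terms and vertex terms *)

Section GraphForm.
Variables (R : realType) (G : metric_graph R) (m : nat).
Local Notation C := R[i].
Implicit Types (c : conditions G) (p : edge G -> nat -> R * R * R) (e : edge G) (v : vertex G).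
Implicit Types z w u : 'rV[C]_(nnodes (edge G) m).

Lemma vertex_sum (g g' : graph_fun G) :
  \sum_v ((bdry_val g v)^t* *m bdry_der g' v) 0 0 =
  \sum_e ((g e 0)^* * g' e 0 - (g e (len G e))^* * g' e (len G e)).
Proof.
have part (S : vertex G -> {set edge G}) (F : edge G -> C) :
    (forall e, exists! v, e \in S v) ->
    \sum_v \sum_(j < #|S v|) F (enum_val j) = \sum_e F e.
  move=> uS; transitivity (\sum_v \sum_(e in S v) F e).
    by apply: eq_bigr => v _; rewrite [RHS]big_enum_val.
  rewrite (exchange_big_dep predT)//=; apply: eq_bigr => e _.
  have [v [ev vu]] := uS e; rewrite (big_pred1 v)// => v' /=.
  by apply/idP/eqP => [/vu//|->].
rewrite sumrB -(part _ (fun e => (g e 0)^* * g' e 0) (@outE_unique _ G)).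
rewrite -(part _ (fun e => (g e (len G e))^* * g' e (len G e)) (@inE_unique _ G)).
rewrite -sumrB; apply: eq_bigr => v _.
rewrite /bdry_val /bdry_der tr_col_mx map_row_mx mul_row_col [LHS]mxE !mxE; congr (_ + _).
  by apply: eq_bigr => j _; rewrite !mxE.
by rewrite -sumrN; apply: eq_bigr => j _; rewrite !mxE mulrN.
Qed.

(* Only the boundary values of this function matter; it turns a vector of node values
   into an argument for [bdry_val] and [bdry_der]. *)
Definition ends (a b : edge G -> C) : graph_fun G := fun e x => if x == 0 then a e else b e.

Definition bdry z v := bdry_val (ends (fun e => node z e 0) (fun e => node z e m.+1)) v.

Definition bdry_flux p z v :=
  bdry_der (ends (fun e => dplus p z e 0) (fun e => dminus p z e m)) v.

Lemma len_neq0 e : len G e != 0. Proof. by rewrite gt_eqF// len_gt0. Qed.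

Lemma bdry_lin a u w v : bdry (a *: u + w) v = a *: bdry u v + bdry w v.
Proof.
apply/colP => i; rewrite !mxE; case: fintype.splitP => j _;
  rewrite !mxE /ends ?eqxx ?(negbTE (len_neq0 _));
exact: node_lin.
Qed.

Definition graph_form c p z w : C :=
  edge_form p z w + \sum_v vc_form (c v) (bdry z v) (bdry w v).

Definition form_domain c z := forall v, vcD (c v) *m bdry z v = 0.

Lemma form_domain_subspace c : linear_subspace (form_domain c).
Proof.
have bdry0 v : bdry 0 v = 0.
  have := bdry_lin (-1) 0 0 v; rewrite scaleN1r oppr0 addr0 => ->.
  by rewrite scaleN1r addNr.
split=> [v|a u w Su Sw v]; first by rewrite bdry0 mulmx0.
by rewrite bdry_lin mulmxDr -scalemxAr (Su v) (Sw v) scaler0 addr0.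
Qed.

Lemma graph_form_hermitian c p : hermitian_form (graph_form c p).
Proof.
split=> [a u w x|u w].
  rewrite /graph_form edge_form_lin mulrDr [a * \sum_(v : vertex G) _]mulr_sumr addrACA.
  congr (_ + _).
  rewrite -big_split; apply: eq_bigr => v _ /=.
  by rewrite /vc_form bdry_lin mulmxDr -scalemxAr !mxE.
rewrite /graph_form rmorphD /= -edge_form_conj rmorph_sum; congr (_ + _).
by apply: eq_bigr => v _; rewrite [LHS]vc_form_conj.
Qed.

(** Derivative jumps at interior nodes and vertex defects, each tested with w: kernel vectors are
    those for which all of these vanish weakly. *)
Lemma graph_form_abel c p z w : graph_form c p z w =
  \sum_e \sum_(j < m) (node w e j.+1)^* * (dminus p z e j - dplus p z e j.+1) +
  \sum_v ((bdry w v)^t* *m (vcL (c v) *m bdry z v - bdry_flux p z v)) 0 0.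
Proof.
rewrite /graph_form edge_form_abel big_split /= [in LHS]addrAC addrC; congr (_ + _).
under [in RHS]eq_bigr => v _.
  rewrite mulmxBr mxE [X in _ + X]mxE mulmxA; over.
rewrite [RHS]sumrB addrC /vc_form; congr (_ + _).
rewrite vertex_sum -sumrN; apply: eq_bigr => e _.
by rewrite /ends eqxx (negbTE (len_neq0 e)) opprB.
Qed.

(** Every edge end belongs to exactly one vertex, so boundary vectors can be prescribed
    independently. This supplies test vectors. *)
Lemma bdry_exists (W : forall v, 'cV[C]_(deg v)) (Y : edge G -> nat -> C) :
  exists w, (forall v, bdry w v = W v) /\ forall e j, (j < m)%N -> node w e j.+1 = Y e j.
Proof.
have pick (S : vertex G -> {set edge G}) (F : forall v, 'I_#|S v| -> C) :
    (forall e, exists! v, e \in S v) ->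
    exists Z : edge G -> C, forall v j, Z (enum_val j) = F v j.
  move=> uS; exists (fun e => \sum_v \sum_(j < #|S v|) (F v j *+ (enum_val j == e))) => v j.
  have vS := enum_valP j; have [v0 [_ vu]] := uS (enum_val j).
  rewrite (bigD1 v)//= [X in _ + X]big1 ?addr0 => [|v' vv'].
    rewrite (bigD1 j)//= eqxx mulr1n big1 ?addr0// => j' jj'.
    by rewrite (inj_eq enum_val_inj) (negbTE jj').
  apply: big1 => j' _; case: eqP => // jj; case/negP: vv'.
  by have := enum_valP j'; rewrite jj => /vu <-; rewrite (vu _ vS).
have [a Ha] := pick (outE G) (fun v j => W v (lshift _ j) 0) (@outE_unique _ G).
have [b Hb] := pick (Defs.inE G) (fun v j => W v (rshift _ j) 0) (@inE_unique _ G).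
have [w Hw] := node_exists m (fun e j => if j == 0%N then a e else
  if j == m.+1 then b e else Y e j.-1).
exists w; split=> [v|e j jm]; last by rewrite Hw ?ltnS ?(ltnW jm)//= eqSS (ltn_eqF jm).
apply/colP => i; rewrite !mxE; case: fintype.splitP => j ij;
  rewrite !mxE /ends ?eqxx ?(negbTE (len_neq0 _)) Hw//=.
  by rewrite Ha; congr (W v _ 0); apply: val_inj.
by rewrite eqxx Hb; congr (W v _ 0); apply: val_inj.
Qed.

End GraphForm.

(** * Discretization of the edges *)

Section Discretization.
Variables (R : realType) (G : metric_graph R) (q : edge G -> R -> R) (a b K : R) (m : nat).
Local Notation C := R[i].
Implicit Types (e : edge G) (nu x y : R) (j : nat) (c : conditions G).
Implicit Types z w u : 'rV[C]_(nnodes (edge G) m).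

Definition mesh e : R := len G e / m.+1%:R.
Definition mesh_point e j : R := j%:R * mesh e.

Lemma mesh_gt0 e : 0 < mesh e.
Proof. by rewrite divr_gt0 ?len_gt0. Qed.

Lemma mesh_pointS e j : mesh_point e j.+1 - mesh_point e j = mesh e.
Proof. by rewrite /mesh_point -natr1; ring. Qed.

Lemma mesh_point_lt e j : mesh_point e j < mesh_point e j.+1.
Proof. by rewrite -subr_gt0 mesh_pointS mesh_gt0. Qed.

Lemma mesh_point0 e : mesh_point e 0 = 0.
Proof. exact: mul0r. Qed.

Lemma mesh_point_last e : mesh_point e m.+1 = len G e.
Proof. by rewrite /mesh_point /mesh mulrCA divff ?mulr1// pnatr_eq0. Qed.

Lemma mesh_point_ge0 e j : 0 <= mesh_point e j.
Proof. by rewrite mulr_ge0 ?ler0n// ltW// mesh_gt0. Qed.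

Lemma mesh_point_le e j : (j < m.+2)%N -> mesh_point e j <= len G e.
Proof. by move=> jm; rewrite -mesh_point_last ler_wpM2r ?ler_nat// ltW// mesh_gt0. Qed.

Lemma mesh_point_cover e x : 0 <= x -> x <= len G e ->
  exists2 j, (j < m.+1)%N & mesh_point e j <= x <= mesh_point e j.+1.
Proof.
rewrite -mesh_point_last => x0; elim: m => [|n IH] xn.
  by exists 0%N => //; rewrite mesh_point0 x0.
have [/IH[j jn jx]|nx] := leP x (mesh_point e n.+1); first by exists j => //; exact: ltnW.
by exists n.+1 => //; rewrite (ltW nx).
Qed.

Hypothesis bq : forall e, bounded_measurable 0 (len G e) (q e).
Hypothesis qK : forall e x nu, a <= nu -> nu <= b -> `|q e x - nu| <= K.
Hypothesis small : forall e, 34 * (K * mesh e ^+ 2) <= 1.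

(* [p nu e j] lists the entries p11, p12 = p21, p22 of the Dirichlet-to-Neumann matrix of
   the j-th piece of e; derivatives are taken in the outward direction. *)
Definition is_dtn (p : R -> edge G -> nat -> R * R * R) := forall nu e j f f',
  a <= nu -> nu <= b -> (j < m.+1)%N ->
  solution (fun x => q e x - nu) (mesh_point e j) (mesh_point e j.+1) f f' ->
  f' (mesh_point e j) =
    - ((p nu e j).1.1 * f (mesh_point e j) + (p nu e j).1.2 * f (mesh_point e j.+1)) /\
  f' (mesh_point e j.+1) =
    (p nu e j).1.2 * f (mesh_point e j) + (p nu e j).2 * f (mesh_point e j.+1).

Lemma piece_bounded nu e j : (j < m.+1)%N ->
  bounded_measurable (mesh_point e j) (mesh_point e j.+1) (fun x => q e x - nu).
Proof.
move=> jm; apply: bounded_measurableB; last exact: bounded_measurable_cst.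
by apply: bounded_measurableS (bq e); [exact: mesh_point_ge0|exact: mesh_point_le].
Qed.

Lemma dtn_exists : exists p, is_dtn p.
Proof.
have /choice[p Hp] : forall t : R * edge G * nat, exists p : R * R * R, forall f f',
    a <= t.1.1 -> t.1.1 <= b -> (t.2 < m.+1)%N ->
    solution (fun x => q t.1.2 x - t.1.1) (mesh_point t.1.2 t.2) (mesh_point t.1.2 t.2.+1) f f' ->
    f' (mesh_point t.1.2 t.2) =
      - (p.1.1 * f (mesh_point t.1.2 t.2) + p.1.2 * f (mesh_point t.1.2 t.2.+1)) /\
    f' (mesh_point t.1.2 t.2.+1) =
      p.1.2 * f (mesh_point t.1.2 t.2) + p.2 * f (mesh_point t.1.2 t.2.+1).
  move=> [[nu e] j] /=.
  (* Outside the spectral window and the range of pieces the triple takes the default value 0. *)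
  have [anu|] := boolP (a <= nu); last by exists (0, 0, 0).
  have [nub|] := boolP (nu <= b); last by exists (0, 0, 0).
  have [jm|] := boolP (j < m.+1)%N; last by exists (0, 0, 0).
  have := @dirichlet_to_neumann R _ _ _ K (mesh_point_lt e j) (piece_bounded nu e jm).
  rewrite mesh_pointS => H.
  have [p11 [p12 [p22 Hp]]] := H (fun x _ _ => qK e x anu nub) (small e).
  by exists (p11, p12, p22) => f f' _ _ _; exact: Hp.
by exists (fun nu e j => p (nu, e, j)) => nu e j f f'; exact: (Hp (nu, e, j)).
Qed.

Lemma piece_solution nu e j x y : a <= nu -> nu <= b -> (j < m.+1)%N ->
  exists f f', [/\ solution (fun x => q e x - nu) (mesh_point e j) (mesh_point e j.+1) f f',
    f (mesh_point e j) = x & f (mesh_point e j.+1) = y].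
Proof.
move=> anu nub jm.
apply: (@solution_exists _ _ _ _ K) (mesh_point_lt e j) (piece_bounded nu e jm) _ _.
  by move=> z _ _; exact: qK.
by rewrite mesh_pointS.
Qed.

Variable p : R -> edge G -> nat -> R * R * R.
Hypothesis pE : is_dtn p.

Lemma piece_form_energy nu e j f f' : a <= nu -> nu <= b -> (j < m.+1)%N ->
  solution (fun x => q e x - nu) (mesh_point e j) (mesh_point e j.+1) f f' ->
  piece_form (p nu e j) (f (mesh_point e j)) (f (mesh_point e j.+1)) =
    edge_energy (mesh_point e j) (mesh_point e j.+1) f f'.
Proof.
by move=> anu nub jm sf; have [E1 E2] := pE anu nub jm sf;
  rewrite /edge_energy E1 E2 /piece_form; ring.
Qed.

Lemma piece_form_monotone nu1 nu2 e j x y : a <= nu1 -> nu1 <= nu2 -> nu2 <= b ->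
  (j < m.+1)%N ->
  (nu2 - nu1) * (mesh e / 32) * (x ^+ 2 + y ^+ 2) <=
    piece_form (p nu1 e j) x y - piece_form (p nu2 e j) x y <=
  (nu2 - nu1) * (2 * mesh e) * (x ^+ 2 + y ^+ 2).
Proof.
move=> anu1 nu12 nu2b jm.
have nu1b := le_trans nu12 nu2b; have anu2 := le_trans anu1 nu12.
have [f [f' [sf fx fy]]] := piece_solution e x y anu1 nu1b jm.
have [g [g' [sg gx gy]]] := piece_solution e x y anu2 nu2b jm.
have := piece_form_energy anu1 nu1b jm sf; rewrite fx fy => ->.
have := piece_form_energy anu2 nu2b jm sg; rewrite gx gy => ->.
rewrite -(mesh_pointS e j).
apply: (@edge_energy_monotone _ (q e) _ _ K x y) => //.
- exact: mesh_point_lt.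
- by move=> t _ _; exact: qK.
- by move=> t _ _; exact: qK.
- by rewrite mesh_pointS.
Qed.

Definition nodesq z e j : R := complex.Re (node z e j) ^+ 2 + complex.Im (node z e j) ^+ 2.

Lemma nodesq_ge0 z e j : 0 <= nodesq z e j.
Proof. by rewrite addr_ge0 ?sqr_ge0. Qed.

Lemma nodesqE z e j : (nodesq z e j)%:C%C = `|node z e j| ^+ 2.
Proof. exact: add_Re2_Im2. Qed.

Lemma nodesq_eq0 z e j : nodesq z e j = 0 -> node z e j = 0.
Proof.
move=> /(congr1 (fun x => x%:C%C)); rewrite nodesqE => /eqP.
by rewrite rmorph0 sqrf_eq0 normr_eq0 => /eqP.
Qed.

Lemma edge_energy_sum_diff nu1 nu2 z : a <= nu1 -> nu1 <= nu2 -> nu2 <= b ->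
  \sum_e \sum_(j < m.+1) (nu2 - nu1) * (mesh e / 32) * (nodesq z e j + nodesq z e j.+1) <=
    edge_energy_sum (p nu1) z - edge_energy_sum (p nu2) z <=
  \sum_e \sum_(j < m.+1) (nu2 - nu1) * (2 * mesh e) * (nodesq z e j + nodesq z e j.+1).
Proof.
move=> anu1 nu12 nu2b; rewrite /edge_energy_sum -sumrB.
have H e (j : 'I_m.+1) := fun x y => piece_form_monotone e x y anu1 nu12 nu2b (ltn_ord j).
apply/andP; split; apply: ler_sum => e _; rewrite -sumrB; apply: ler_sum => j _.
  have /andP[H1 _] := H e j (complex.Re (node z e j)) (complex.Re (node z e j.+1)).
  have /andP[H2 _] := H e j (complex.Im (node z e j)) (complex.Im (node z e j.+1)).
  rewrite /nodesq; lra.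
have /andP[_ H1] := H e j (complex.Re (node z e j)) (complex.Re (node z e j.+1)).
have /andP[_ H2] := H e j (complex.Im (node z e j)) (complex.Im (node z e j.+1)).
rewrite /nodesq; lra.
Qed.

(** Strict on the whole node space: the lower bound weighs both ends of every piece, and every node
    is an end of some piece. *)
Lemma edge_energy_sum_strict nu1 nu2 z : a <= nu1 -> nu1 < nu2 -> nu2 <= b -> z != 0 ->
  edge_energy_sum (p nu2) z < edge_energy_sum (p nu1) z.
Proof.
move=> anu1 nu12 nu2b z0; rewrite -subr_gt0.
have /andP[+ _] := edge_energy_sum_diff z anu1 (ltW nu12) nu2b.
apply: lt_le_trans.
have t0 e j : 0 <= (nu2 - nu1) * (mesh e / 32) * (nodesq z e j + nodesq z e j.+1).
  apply: mulr_ge0; last by rewrite addr_ge0 ?nodesq_ge0.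
  by apply: mulr_ge0; rewrite ?subr_ge0 ?(ltW nu12)// divr_ge0// ltW// mesh_gt0.
have s0 e : 0 <= \sum_(j < m.+1) (nu2 - nu1) * (mesh e / 32) * (nodesq z e j + nodesq z e j.+1).
  by rewrite sumr_ge0.
rewrite lt0r sumr_ge0 ?andbT//; apply: contra_neq z0 => H.
have zero e j : (j < m.+1)%N -> node z e j = 0 /\ node z e j.+1 = 0.
  move=> jm.
  have He : \sum_(j < m.+1) (nu2 - nu1) * (mesh e / 32) * (nodesq z e j + nodesq z e j.+1) = 0.
    by apply: (psumr_eq0P (fun e' _ => s0 e') H).
  have : (nu2 - nu1) * (mesh e / 32) * (nodesq z e (Ordinal jm) + nodesq z e (Ordinal jm).+1) = 0.
    by apply: (psumr_eq0P (fun (j' : 'I_m.+1) _ => t0 e j') He).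
  move=> /= /eqP.
  have c0 : 0 < (nu2 - nu1) * (mesh e / 32).
    by apply: mulr_gt0; rewrite ?subr_gt0// divr_gt0// mesh_gt0.
  rewrite mulf_eq0 (gt_eqF c0) /= paddr_eq0 ?nodesq_ge0//.
  by move=> /andP[/eqP h1 /eqP h2]; split; exact: nodesq_eq0.
apply: node_eq0 => e [|j] jm; first by have [] := zero e 0%N isT.
by have [] := zero e j jm.
Qed.

Lemma sqnorm_nodesq z : sqnorm z = (\sum_e \sum_(j < m.+2) nodesq z e j)%:C%C.
Proof.
rewrite sqnorm_node rmorph_sum; apply: eq_bigr => e _; rewrite /= rmorph_sum.
by apply: eq_bigr => j _; rewrite /= nodesqE.
Qed.

(** The 4 is the 2 from the upper bound on one piece times 2, as a node belongs to at most two
    pieces. *)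
Lemma edge_energy_sum_lipschitz nu1 nu2 z : a <= nu1 -> nu1 <= b -> a <= nu2 -> nu2 <= b ->
  `|edge_energy_sum (p nu1) z - edge_energy_sum (p nu2) z| <=
    (4 * \sum_e len G e) * `|nu1 - nu2| * \sum_e \sum_(j < m.+2) nodesq z e j.
Proof.
wlog nu12 : nu1 nu2 / nu1 <= nu2.
  move=> H; case: (leP nu1 nu2) => [/H//|/ltW/H] h a1 b1 a2 b2.
  by rewrite distrC (distrC nu1); exact: h.
move=> anu1 nu1b anu2 nu2b.
have /andP[lo hi] := edge_energy_sum_diff z anu1 nu12 nu2b.
have meshL e : mesh e <= \sum_e len G e.
  rewrite (bigD1 e)//= ler_wpDr ?sumr_ge0// => [e' _|]; first exact/ltW/len_gt0.
  by rewrite ler_pdivrMr ?ltr0Sn// ler_peMr ?ler1n// ltW// len_gt0.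
rewrite ger0_norm; last first.
  apply: le_trans lo; apply: sumr_ge0 => e _; apply: sumr_ge0 => j _.
  apply: mulr_ge0; last by rewrite addr_ge0 ?nodesq_ge0.
  by apply: mulr_ge0; rewrite ?subr_ge0// divr_ge0// ltW// mesh_gt0.
apply: (le_trans hi); rewrite distrC (ger0_norm (_ : 0 <= nu2 - nu1)) ?subr_ge0//.
set H := \sum_e len G e in meshL *.
rewrite mulr_sumr; apply: ler_sum => e _; rewrite -mulr_sumr.
have sums : \sum_(j < m.+1) (nodesq z e j + nodesq z e j.+1) <= 2 * \sum_(j < m.+2) nodesq z e j.
  rewrite big_split /= mulr_natl mulr2n; apply: lerD.
    by rewrite [leRHS]big_ord_recr /= lerDl nodesq_ge0.
  by rewrite [leRHS]big_ord_recl /= lerDr nodesq_ge0.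
have S0 : 0 <= \sum_(j < m.+1) (nodesq z e j + nodesq z e j.+1).
  by rewrite sumr_ge0// => j _; rewrite addr_ge0 ?nodesq_ge0.
have -> : 4 * H * (nu2 - nu1) * \sum_(j < m.+2) nodesq z e j =
  (nu2 - nu1) * (2 * H) * (2 * \sum_(j < m.+2) nodesq z e j) by ring.
apply: ler_pM => //; first by apply: mulr_ge0; rewrite ?subr_ge0// pmulr_rge0// ltW// mesh_gt0.
by rewrite ler_wpM2l ?subr_ge0// ler_wpM2l.
Qed.

(** The affine [W] runs from - C0 to C0 along the edge, so W' + W^2 <= 2 C0 / len + C0^2 <= q - nu.
    Summed over the pieces, the Riccati bounds telescope to the two ends. *)
Lemma edge_energy_sum_riccati nu C0 z : a <= nu -> nu <= b -> 0 <= C0 ->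
  (forall e x, C0 ^+ 2 + 2 * C0 / len G e <= q e x - nu) ->
  C0 * \sum_e (nodesq z e 0 + nodesq z e m.+1) <= edge_energy_sum (p nu) z.
Proof.
move=> anu nub C00 qC; rewrite mulr_sumr; apply: ler_sum => e _.
have l0 : 0 < len G e := len_gt0 e.
pose w1 := 2 * C0 / len G e.
pose W j := - C0 + w1 * mesh_point e j.
have piece j x y : (j < m.+1)%N -> W j.+1 * y ^+ 2 - W j * x ^+ 2 <= piece_form (p nu e j) x y.
  move=> jm; have [f [f' [sf <- <-]]] := piece_solution e x y anu nub jm.
  rewrite (piece_form_energy anu nub jm sf); apply: (edge_energy_riccati _ sf).
    exact/ltW/mesh_point_lt.
  move=> t jt tj; apply: le_trans (qC e t); rewrite addrC lerD2r.
  have t0 : 0 <= t := le_trans (mesh_point_ge0 e j) jt.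
  have tl : t <= len G e := le_trans tj (@mesh_point_le e j.+1 jm).
  have w1t : 0 <= w1 * t by rewrite mulr_ge0// divr_ge0 ?mulr_ge0// ltW.
  have w1t' : w1 * t <= 2 * C0.
    by rewrite /w1 mulrAC ler_pdivrMr// ler_wpM2l ?mulr_ge0.
  nra.
have -> : C0 * (nodesq z e 0 + nodesq z e m.+1) =
    \sum_(j < m.+1) (W j.+1 * nodesq z e j.+1 - W j * nodesq z e j).
  rewrite -(big_mkord predT (fun j => W j.+1 * nodesq z e j.+1 - W j * nodesq z e j)).
  rewrite telescope_sumr// /W mesh_point0 mesh_point_last /w1.
  by field; rewrite gt_eqF.
apply: ler_sum => j _.
have H1 := piece j (complex.Re (node z e j)) (complex.Re (node z e j.+1)) (ltn_ord j).
have H2 := piece j (complex.Im (node z e j)) (complex.Im (node z e j.+1)) (ltn_ord j).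
rewrite /nodesq; lra.
Qed.

End Discretization.

(** * Kernel vectors and eigenfunctions *)

Section ComplexSolutions.
Variable R : realType.
Local Notation C := R[i].
Implicit Types (k : R -> R) (l : R).

Lemma edge_solution_lin k l (al : C) (f f' g g' : R -> C) :
  edge_solution k l f f' -> edge_solution k l g g' ->
  edge_solution k l (fun x => al * f x + g x) (fun x => al * f' x + g' x).
Proof.
have ext (F F' H H' : R -> R) : solution k 0 l F F' -> F =1 H -> F' =1 H' -> solution k 0 l H H'.
  by move=> + /funext <- /funext <-.
move=> [fR fI] [gR gI]; split.
  apply: ext (solutionD (solutionD (solutionZ (complex.Re al) fR)
    (solutionZ (- complex.Im al) fI)) gR) _ _ => x /=.
    by case: al (f x) (g x) => [? ?] [? ?] [? ?] /=; ring.
  by case: al (f' x) (g' x) => [? ?] [? ?] [? ?] /=; ring.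
apply: ext (solutionD (solutionD (solutionZ (complex.Re al) fI)
    (solutionZ (complex.Im al) fR)) gI) _ _ => x /=.
  by case: al (f x) (g x) => [? ?] [? ?] [? ?] /=; ring.
by case: al (f' x) (g' x) => [? ?] [? ?] [? ?] /=; ring.
Qed.

Lemma solution_zero k l : solution k 0 l (fun=> 0) (fun=> 0).
Proof.
split; first exact: primitive_cst.
by apply: primitive_ext (primitive_cst 0 l 0) => // x _ _; rewrite mulr0.
Qed.

Lemma edge_solution_sum k l n (al : 'I_n -> C) (f f' : 'I_n -> R -> C) :
  (forall i, edge_solution k l (f i) (f' i)) ->
  edge_solution k l (fun x => \sum_i al i * f i x) (fun x => \sum_i al i * f' i x).
Proof.
elim: n al f f' => [|n IH] al f f' H.
  have E (h : 'I_0 -> R -> C) : (fun x => \sum_i al i * h i x) = fun=> 0.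
    by apply/funext => x; rewrite big_ord0.
  by rewrite !E; split; exact: solution_zero.
have E (h : 'I_n.+1 -> R -> C) : (fun x => \sum_i al i * h i x) =
    fun x => al ord0 * h ord0 x + \sum_(i < n) al (lift ord0 i) * h (lift ord0 i) x.
  by apply/funext => x; rewrite big_ord_recl.
rewrite !E; apply: edge_solution_lin => //; exact: IH.
Qed.

Lemma edge_solution_ae_eq0 k l f f' : 0 < l -> edge_solution k l f f' ->
  {ae (@lebesgue_measure R), forall x, `[0, l]%classic x -> f x = 0} ->
  forall x, 0 <= x -> x <= l -> f x = 0.
Proof.
move=> l0 [fR fI] f0 x x0 xl.
have : complex.Re (f x) = 0.
  apply: (primitive_ae_eq0 l0 fR.1) => //.
  by move: f0; apply: ae_imply => y H /H ->.
have : complex.Im (f x) = 0.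
  apply: (primitive_ae_eq0 l0 fI.1) => //.
  by move: f0; apply: ae_imply => y H /H ->.
by case: (f x) => [? ?] /= -> ->.
Qed.

Lemma complex_ext (x y : C) : complex.Re x = complex.Re y ->
  complex.Im x = complex.Im y -> x = y.
Proof. by case: x y => [? ?] [? ?] /= -> ->. Qed.

End ComplexSolutions.

(** * Control of the vertex terms by the edge energy *)

Section VertexFormBound.
Variables (R : realType) (G : metric_graph R) (m : nat) (c : conditions G).
Local Notation C := R[i].
Implicit Types z : 'rV[C]_(nnodes (edge G) m).

Lemma bdry_sqnorm z :
  \sum_v \sum_i `|bdry z v i 0| ^+ 2 = (\sum_e (nodesq z e 0 + nodesq z e m.+1))%:C%C.
Proof.
(* The sign at the terminal end cancels the one in [bdry_der], so [vertex_sum] applies to a sum of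
   squares. *)
pose g' := ends (fun e => node z e 0) (fun e => - node z e m.+1).
transitivity (\sum_v ((bdry z v)^t* *m bdry_der g' v) 0 0).
  apply: eq_bigr => v _; rewrite mxE; apply: eq_bigr => i _.
  have -> : bdry_der g' v i 0 = bdry z v i 0.
    rewrite !mxE; case: fintype.splitP => j _; rewrite !mxE; first by rewrite /g' /ends ?eqxx.
    by rewrite /g' /ends ?eqxx// (negbTE (len_neq0 _)) opprK.
  by rewrite [X in _ = X * _]mxE [X in _ = X^* * _]mxE normCK mulrC.
rewrite vertex_sum rmorph_sum; apply: eq_bigr => e _.
rewrite /g' /ends eqxx (negbTE (len_neq0 e)) mulrN opprK /= rmorphD /=.
by rewrite !nodesqE !normCK; congr (_ + _); rewrite mulrC.
Qed.

Lemma vc_form_bound n (vc : vertex_condition R n) F :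
  `|vc_form vc F F| <= (\sum_i \sum_j `|vcL vc i j|) * \sum_i `|F i 0| ^+ 2.
Proof.
set S := \sum_i `|F i 0| ^+ 2.
have FS i : `|F i 0| ^+ 2 <= S.
  by rewrite /S (bigD1 i)//= lerDl sumr_ge0// => j _; rewrite exprn_ge0.
rewrite /vc_form mxE (le_trans (ler_norm_sum _ _ _))//.
rewrite exchange_big /= mulr_suml; apply: ler_sum => j _.
rewrite mxE normrM (le_trans (ler_wpM2r (normr_ge0 _) (ler_norm_sum _ _ _)))//.
rewrite !mulr_suml; apply: ler_sum => i _; rewrite !mxE normrM norm_conjC.
rewrite -mulrA mulrC -mulrA; apply: ler_wpM2l => //.
rewrite mulrC; have [ij|/ltW ji] := real_leP (normr_real (F i 0)) (normr_real (F j 0)).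
  by rewrite (le_trans _ (FS j))// expr2 ler_wpM2r.
by rewrite (le_trans _ (FS i))// expr2 ler_wpM2l.
Qed.

Lemma normc_ge0 (x : C) : 0 <= Normc.normc x.
Proof. by case: x => ? ?; exact: sqrtr_ge0. Qed.

(** A crude bound for all Lambda_v at once; [normc] takes values in R, the norm of R[i] in R[i]. *)
Definition vc_size : R := \sum_v \sum_i \sum_j Normc.normc (vcL (c v) i j).

Lemma vc_size_ge0 : 0 <= vc_size.
Proof.
apply: sumr_ge0 => v _; apply: sumr_ge0 => i _; apply: sumr_ge0 => j _.
exact: normc_ge0.
Qed.

Lemma graph_form_ge0 (p : edge G -> nat -> R * R * R) z :
  vc_size * \sum_e (nodesq z e 0 + nodesq z e m.+1) <= edge_energy_sum p z ->
  0 <= graph_form c p z z.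
Proof.
move=> H; rewrite /graph_form edge_form_diag -lerBlDr sub0r.
apply: le_trans (_ : (vc_size * \sum_e (nodesq z e 0 + nodesq z e m.+1))%:C%C <= _); last first.
  by rewrite lecR.
have Vreal : \sum_v vc_form (c v) (bdry z v) (bdry z v) \is Num.real.
  by apply: sum_real => v _; rewrite CrealE -vc_form_conj.
apply: (@le_trans _ _ `|\sum_v vc_form (c v) (bdry z v) (bdry z v)|).
  by rewrite -normrN real_ler_norm// realN.
rewrite rmorphM /= -bdry_sqnorm mulr_sumr (le_trans (ler_norm_sum _ _ _))//.
apply: ler_sum => v _; rewrite (le_trans (vc_form_bound _ _))//.
apply: ler_wpM2r; first by rewrite sumr_ge0// => i _; rewrite exprn_ge0.
have E v' : (\sum_i \sum_j Normc.normc (vcL (c v') i j))%:C%C = \sum_i \sum_j `|vcL (c v') i j|.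
  by rewrite rmorph_sum; apply: eq_bigr => i _; rewrite /= rmorph_sum; apply: eq_bigr.
rewrite -E lecR /vc_size (bigD1 v)//= lerDl.
apply: sumr_ge0 => v' _; apply: sumr_ge0 => i _; apply: sumr_ge0 => j _.
exact: normc_ge0.
Qed.

End VertexFormBound.

Section KernelEigenfunctions.
Variables (R : realType) (G : metric_graph R) (q : edge G -> R -> R) (a b K : R) (m : nat).
Local Notation C := R[i].
Implicit Types (e : edge G) (nu x y : R) (j : nat) (c : conditions G).
Implicit Types z w u : 'rV[C]_(nnodes (edge G) m).
Local Notation X := (@mesh_point R G m).

Hypothesis bq : forall e, bounded_measurable 0 (len G e) (q e).
Hypothesis qK : forall e x nu, a <= nu -> nu <= b -> `|q e x - nu| <= K.
Hypothesis small : forall e, 34 * (K * mesh m e ^+ 2) <= 1.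
Variable p : R -> edge G -> nat -> R * R * R.
Hypothesis pE : is_dtn q a b m p.

Lemma solution_piece k e j (f f' : R -> R) : (j < m.+1)%N ->
  solution k 0 (len G e) f f' -> solution k (X e j) (X e j.+1) f f'.
Proof.
by move=> jm; apply: solutionS; [exact: mesh_point_ge0|exact: mesh_point_le].
Qed.

Lemma eigenfunction_flux nu e (f f' : R -> C) z : a <= nu -> nu <= b ->
  edge_solution (fun x => q e x - nu) (len G e) f f' ->
  (forall j, (j < m.+2)%N -> node z e j = f (X e j)) ->
  forall j, (j < m.+1)%N ->
    dplus (p nu) z e j = f' (X e j) /\ dminus (p nu) z e j = f' (X e j.+1).
Proof.
move=> anu nub [sR sI] zf j jm.
have [R1 R2] := pE anu nub jm (solution_piece jm sR).
have [I1 I2] := pE anu nub jm (solution_piece jm sI).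
rewrite /dplus /dminus !zf ?ltnS// 1?ltnW//.
move: R1 R2 I1 I2; case: (p nu e j) => [[p11 p12] p22] /=.
case: (f (X e j)) (f (X e j.+1)) (f' (X e j)) (f' (X e j.+1)) => [? ?] [? ?] [? ?] [? ?] /=.
by move=> -> -> -> ->; split; apply: complex_ext => /=; ring.
Qed.

Lemma real_solution_zero nu e (f f' : R -> R) : a <= nu -> nu <= b ->
  solution (fun x => q e x - nu) 0 (len G e) f f' ->
  (forall j, (j < m.+2)%N -> f (X e j) = 0) ->
  forall x, 0 <= x -> x <= len G e -> f x = 0.
Proof.
move=> anu nub sf f0 x x0 xl.
have [j jm /andP[jx xj]] := mesh_point_cover m x0 xl.
have [] := @solution0 R _ _ _ f f' K (mesh_point_lt m e j) _ _
  (solution_piece jm sf) _ _ x jx xj => //.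
- by move=> y _ _; exact: qK.
- by rewrite mesh_pointS.
- by rewrite f0// ltnW.
- by rewrite f0.
Qed.

Lemma edge_solution_zero nu e (f f' : R -> C) : a <= nu -> nu <= b ->
  edge_solution (fun x => q e x - nu) (len G e) f f' ->
  (forall j, (j < m.+2)%N -> f (X e j) = 0) ->
  forall x, 0 <= x -> x <= len G e -> f x = 0.
Proof.
move=> anu nub [sR sI] f0 x x0 xl; apply: complex_ext => /=.
  by apply: (real_solution_zero anu nub sR) => // j jm; rewrite f0.
by apply: (real_solution_zero anu nub sI) => // j jm; rewrite f0.
Qed.

(** Both one-sided derivatives at an interior node equal the value of f' there, so the jumps vanish,
    and the vertex defects are orthogonal to the form domain. *)
Lemma eigenfunction_kernel c nu (f f' : graph_fun G) z : a <= nu -> nu <= b ->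
  eigenfunction q c nu f f' ->
  (forall e j, (j < m.+2)%N -> node z e j = f e (X e j)) ->
  form_domain c z /\ forall w, form_domain c w -> graph_form c (p nu) z w = 0.
Proof.
move=> anu nub [sol vc] zf.
have flux e j : (j < m.+1)%N -> dplus (p nu) z e j = f' e (X e j) /\
    dminus (p nu) z e j = f' e (X e j.+1).
  by apply: eigenfunction_flux (sol e) _ j => // j; exact: zf.
have bz v : bdry z v = bdry_val f v.
  apply/colP => i; rewrite !mxE; case: fintype.splitP => j _; rewrite !mxE /ends.
    by rewrite eqxx zf// mesh_point0.
  by rewrite (negbTE (len_neq0 _)) zf// mesh_point_last.
have bf v : bdry_flux (p nu) z v = bdry_der f' v.
  apply/colP => i; rewrite !mxE; case: fintype.splitP => j _; rewrite !mxE /ends.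
    by rewrite eqxx (flux _ 0%N isT).1 mesh_point0.
  by rewrite (negbTE (len_neq0 _)) (flux _ m (ltnSn m)).2 mesh_point_last.
split=> [v|w Sw]; first by rewrite bz; have [] := vc v.
rewrite graph_form_abel big1 => [|e _].
  by rewrite add0r big1// => v _; rewrite bz bf (vc_holds_orthogonal (vc v)) ?mxE.
rewrite big1// => j _; rewrite (flux e j (ltnW (ltn_ord j))).2.
by rewrite (flux e j.+1 _).1 ?ltnS// subrr mulr0.
Qed.

Lemma real_solution_of_nodes nu e (zr : nat -> R) : a <= nu -> nu <= b ->
  (forall j, (j < m)%N ->
     (p nu e j).1.2 * zr j + (p nu e j).2 * zr j.+1 =
     - ((p nu e j.+1).1.1 * zr j.+1 + (p nu e j.+1).1.2 * zr j.+2)) ->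
  exists (f f' : R -> R), solution (fun x => q e x - nu) 0 (len G e) f f' /\
    forall j, (j < m.+2)%N -> f (X e j) = zr j.
Proof.
move=> anu nub match_.
have /choice[F /choice[F' HF]] : forall j, exists F F' : R -> R, (j < m.+1)%N ->
    [/\ solution (fun x => q e x - nu) (X e j) (X e j.+1) F F', F (X e j) = zr j &
      F (X e j.+1) = zr j.+1].
  move=> j; have [jm|] := boolP (j < m.+1)%N; last by exists (fun=> 0), (fun=> 0).
  have [F [F' ?]] := piece_solution bq qK small e (zr j) (zr j.+1) anu nub jm.
  by exists F, F'.
have [] := @solution_glue_nat R (fun x => q e x - nu) (X e) m F F' _ _ _.
- by move=> j; exact/ltW/mesh_point_lt.
- by move=> j /HF[].
- move=> j jm; have [s1 l1 r1] := HF j (ltnW jm); have [s2 l2 r2] := HF j.+1 jm.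
  rewrite r1 l2; split=> //.
  rewrite (pE anu nub (ltnW jm) s1).2 (pE anu nub (jm : (j.+1 < m.+1)%N) s2).1.
  by rewrite l1 r1 l2 r2 match_.
move=> f [f' []]; rewrite mesh_point0 mesh_point_last => sf fF.
exists f, f'; split=> // -[_|j jm].
  have [_ l _] := HF 0%N isT; rewrite -l; apply: (fF 0%N _ isT _ _).1 => //.
  exact/ltW/mesh_point_lt.
have [_ _ r] := HF j jm; rewrite -r; apply: (fF j _ jm _ _).1 => //.
exact/ltW/mesh_point_lt.
Qed.

Lemma kernel_eigenfunction c nu z : a <= nu -> nu <= b -> form_domain c z ->
  (forall w, form_domain c w -> graph_form c (p nu) z w = 0) ->
  exists f f', eigenfunction q c nu f f' /\
    forall e j, (j < m.+2)%N -> node z e j = f e (X e j).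
Proof.
move=> anu nub Sz ker.
pose Y v := vcL (c v) *m bdry z v - bdry_flux (p nu) z v.
(* Testing with the jumps of the derivative and the projected vertex defects
   turns the form into a sum of squares. *)
have [w [wb wi]] := bdry_exists m (fun v => nonDirichlet (c v) *m Y v)
  (fun e j => dminus (p nu) z e j - dplus (p nu) z e j.+1).
have Sw : form_domain c w by move=> v; rewrite wb mulmxA vcD_nonDirichlet mul0mx.
have := ker w Sw; rewrite graph_form_abel.
have -> : \sum_e \sum_(j < m) (node w e j.+1)^* * (dminus (p nu) z e j - dplus (p nu) z e j.+1) =
   \sum_e \sum_(j < m) `|dminus (p nu) z e j - dplus (p nu) z e j.+1| ^+ 2.
  by apply: eq_bigr => e _; apply: eq_bigr => j _; rewrite wi// normCK mulrC.
have -> : \sum_v ((bdry w v)^t* *m (vcL (c v) *m bdry z v - bdry_flux (p nu) z v)) 0 0 =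
   \sum_v \sum_i `|(nonDirichlet (c v) *m Y v) i 0| ^+ 2.
  by apply: eq_bigr => v _; rewrite wb -/(Y v) nonDirichlet_sqnorm.
have n0 (x : C) : 0 <= `|x| ^+ 2 by rewrite exprn_ge0.
have n0' (x : C) : `|x| ^+ 2 = 0 -> x = 0.
  by move=> /eqP; rewrite sqrf_eq0 normr_eq0 => /eqP.
move=> /eqP; rewrite paddr_eq0; last 2 first.
- by apply: sumr_ge0 => e _; exact: sumr_ge0.
- by apply: sumr_ge0 => e _; exact: sumr_ge0.
move=> /andP[/eqP inner /eqP outer].
have jump e j : (j < m)%N -> dminus (p nu) z e j = dplus (p nu) z e j.+1.
  move=> jm.
  have He : \sum_(j < m) `|dminus (p nu) z e j - dplus (p nu) z e j.+1| ^+ 2 = 0.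
    by apply: psumr_eq0P inner _ _ => // e' _; exact: sumr_ge0.
  apply/eqP; rewrite -subr_eq0; apply/eqP/n0'.
  have /(_ _ (Ordinal jm)) := psumr_eq0P _ He; apply=> //.
have vert v : nonDirichlet (c v) *m Y v = 0.
  have Hv : \sum_i `|(nonDirichlet (c v) *m Y v) i 0| ^+ 2 = 0.
    by apply: psumr_eq0P outer _ _ => // v' _; exact: sumr_ge0.
  apply/colP => i; rewrite [RHS]mxE; apply: n0'.
  have /(_ _ i) := psumr_eq0P _ Hv; apply=> //.
(* The matching conditions have real coefficients, so real and imaginary parts are glued
   separately. *)
have /choice[fR /choice[fR' HR]] : forall e, exists f f' : R -> R,
    solution (fun x => q e x - nu) 0 (len G e) f f' /\
    forall j, (j < m.+2)%N -> f (X e j) = complex.Re (node z e j).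
  move=> e; apply: real_solution_of_nodes => // j jm.
  have := congr1 (@complex.Re R) (jump e j jm); rewrite /dminus /dplus.
  case: (node z e j) (node z e j.+1) (node z e j.+2) => [? ?] [? ?] [? ?] /=.
  by rewrite !mul0r !subr0.
have /choice[fI /choice[fI' HI]] : forall e, exists f f' : R -> R,
    solution (fun x => q e x - nu) 0 (len G e) f f' /\
    forall j, (j < m.+2)%N -> f (X e j) = complex.Im (node z e j).
  move=> e; apply: real_solution_of_nodes => // j jm.
  have := congr1 (@complex.Im R) (jump e j jm); rewrite /dminus /dplus.
  case: (node z e j) (node z e j.+1) (node z e j.+2) => [? ?] [? ?] [? ?] /=.
  by rewrite !mul0r !addr0.
pose f e x : C := (fR e x +i* fI e x)%C; pose f' e x : C := (fR' e x +i* fI' e x)%C.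
have sol e : edge_solution (fun x => q e x - nu) (len G e) (f e) (f' e).
  by split; [exact: (HR e).1|exact: (HI e).1].
have zf e j : (j < m.+2)%N -> node z e j = f e (X e j).
  by move=> jm; apply: complex_ext; rewrite /= ?(HR e).2 ?(HI e).2.
exists f, f'; split=> //; split=> // v.
have flux e j (jm : (j < m.+1)%N) := eigenfunction_flux anu nub (sol e) (zf e) jm.
have bz : bdry_val f v = bdry z v.
  apply/colP => i; rewrite !mxE; case: fintype.splitP => j _; rewrite !mxE /ends.
    by rewrite eqxx zf// mesh_point0.
  by rewrite (negbTE (len_neq0 _)) zf// mesh_point_last.
have bf : bdry_der f' v = bdry_flux (p nu) z v.
  apply/colP => i; rewrite !mxE; case: fintype.splitP => j _; rewrite !mxE /ends.
    by rewrite eqxx (flux _ 0%N isT).1 mesh_point0.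
  by rewrite (negbTE (len_neq0 _)) (flux _ m (ltnSn m)).2 mesh_point_last.
by rewrite bz bf; apply: vc_holds_of_orthogonal.
Qed.

End KernelEigenfunctions.

(** * Counting eigenvalues *)

Section Multiplicity.
Variables (R : realType) (G : metric_graph R) (q : edge G -> R -> R) (a b K : R) (m : nat).
Local Notation C := R[i].
Implicit Types (e : edge G) (nu x y : R) (c : conditions G).
Local Notation nn := (nnodes (edge G) m).
Implicit Types z w : 'rV[C]_nn.
Local Notation X := (@mesh_point R G m).

Hypothesis bq : forall e, bounded_measurable 0 (len G e) (q e).
Hypothesis qK : forall e x nu, a <= nu -> nu <= b -> `|q e x - nu| <= K.
Hypothesis small : forall e, 34 * (K * mesh m e ^+ 2) <= 1.
Variable p : R -> edge G -> nat -> R * R * R.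
Hypothesis pE : is_dtn q a b m p.

Lemma node_mulmx r (T : 'M[C]_(r, nn)) (u : 'rV_r) e j :
  node (u *m T) e j = \sum_i u 0 i * node (row i T) e j.
Proof. by rewrite /node mxE; apply: eq_bigr => i _; rewrite mxE. Qed.

(** An eigenbasis is sampled at the nodes. Sampling is injective because a solution vanishing at
    both ends of a short piece is zero. *)
Lemma eigenspace_nodes c nu r : a <= nu -> nu <= b ->
  multiplicity (schrodinger q c) nu r ->
  exists T : 'M[C]_(r, nn), [/\ row_free T, forall i, form_domain c (row i T) &
    forall i w, form_domain c w -> graph_form c (p nu) (row i T) w = 0].
Proof.
move=> anu nub [phi [phiE phifree _]].
have /choice[phi' sol] : forall i, exists f', eigenfunction q c nu (phi i) f'.
  by move=> i; apply/in_eigenspaceP.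
have /choice[Z HZ] : forall i, exists z, forall e j, (j < m.+2)%N ->
    node z e j = phi i e (X e j) by move=> i; exact: node_exists.
pose T := \matrix_i Z i.
have TZ i : row i T = Z i by exact: rowK.
exists T; split; last 2 first.
- move=> i; rewrite TZ; exact: (eigenfunction_kernel pE anu nub (sol i) (HZ i)).1.
- move=> i w; rewrite TZ; exact: (eigenfunction_kernel pE anu nub (sol i) (HZ i)).2.
apply: inj_row_free => u uT; apply/rowP => i; rewrite [RHS]mxE.
apply: (phifree (fun i => u 0 i)) => e.
apply: aeW => x /=; rewrite in_itv /= => /andP[x0 xl].
have := edge_solution_zero qK small anu nub
  (edge_solution_sum (fun i => u 0 i) (fun i => (sol i).1 e)).
apply=> // j jm; have := congr1 (fun z => node z e j) uT.
rewrite node_mulmx node0 => uX; rewrite -[RHS]uX.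
by apply: eq_bigr => i' _; rewrite TZ HZ.
Qed.

(** The rows of T extend to eigenfunctions with coefficient matrix M in the eigenbasis. If u M = 0,
    their combination vanishes almost everywhere, hence at every node, so u T = 0 and u = 0: M has r
    independent rows of length k. *)
Lemma kernel_dim_le c nu r k (T : 'M[C]_(r, nn)) : a <= nu -> nu <= b ->
  multiplicity (schrodinger q c) nu k -> row_free T ->
  (forall i, form_domain c (row i T)) ->
  (forall i w, form_domain c w -> graph_form c (p nu) (row i T) w = 0) -> (r <= k)%N.
Proof.
move=> anu nub [phi [_ _ phispan]] Tf TS T0.
have /choice[f /choice[f' Hf]] : forall i, exists f f', eigenfunction q c nu f f' /\
    forall e j, (j < m.+2)%N -> node (row i T) e j = f e (X e j).
  move=> i; exact: (kernel_eigenfunction bq qK small pE anu nub (TS i) (T0 i)).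
have /choice[A HA] : forall i, exists al, eq_L2 (f i) (lincomb al phi).
  by move=> i; apply: phispan; apply/in_eigenspaceP => //; exists (f' i); exact: (Hf i).1.
pose M := \matrix_(i, j) A i j.
suff Mf : row_free M by rewrite -(eqP Mf) rank_leq_col.
apply: inj_row_free => u uM.
apply/eqP; rewrite -(mulmx_free_eq0 _ Tf); apply/eqP/node_eq0 => e j jm.
rewrite node_mulmx; under eq_bigr => i _ do rewrite (Hf i).2//.
have xs0 := mesh_point_ge0 m e j; have xsl := mesh_point_le e jm.
have sol := edge_solution_sum (fun i => u 0 i) (fun i => (Hf i).1.1 e).
apply: (edge_solution_ae_eq0 (len_gt0 e) sol) => //.
have := @filter_forall _ _ _ _ (ae_filter_ringOfSetsType (@lebesgue_measure R))
  (fun i => HA i e).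
apply: ae_imply => x H Dx; rewrite (eq_bigr (fun i => \sum_l u 0 i * (A i l * phi l e x))).
  rewrite exchange_big big1//= => l _.
  have /rowP/(_ l) := uM; rewrite !mxE => uMl.
  transitivity ((\sum_i u 0 i * A i l) * phi l e x).
    by rewrite mulr_suml; apply: eq_bigr => i _; rewrite mulrA.
  suff -> : \sum_i u 0 i * A i l = 0 by rewrite mul0r.
  by rewrite -[RHS]uMl; apply: eq_bigr => i _; rewrite mxE.
by move=> i _; rewrite H// -mulr_sumr.
Qed.

Lemma graph_form_sub c nu1 nu2 z : graph_form c (p nu1) z z - graph_form c (p nu2) z z =
  (edge_energy_sum (p nu1) z - edge_energy_sum (p nu2) z)%:C%C.
Proof. by rewrite /graph_form !edge_form_diag rmorphB /=; ring. Qed.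

Lemma graph_form_strict c nu1 nu2 z : a <= nu1 -> nu1 < nu2 -> nu2 <= b -> z != 0 ->
  graph_form c (p nu2) z z < graph_form c (p nu1) z z.
Proof.
move=> anu1 nu12 nu2b z0; rewrite -subr_gt0 graph_form_sub -[ltLHS]/(0%:C%C) ltcR subr_gt0.
exact: (edge_energy_sum_strict bq qK small pE).
Qed.

Lemma graph_form_lipschitz c nu1 nu2 z : a <= nu1 -> nu1 <= b -> a <= nu2 -> nu2 <= b ->
  `|graph_form c (p nu1) z z - graph_form c (p nu2) z z| <=
  ((4 * \sum_e len G e) * `|nu1 - nu2|)%:C%C * sqnorm z.
Proof.
move=> a1 b1 a2 b2; rewrite graph_form_sub sqnorm_nodesq -rmorphM /=.
rewrite normc_def /= expr0n addr0 sqrtr_sqr lecR.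
exact: (edge_energy_sum_lipschitz bq qK small pE).
Qed.

End Multiplicity.

(** * Comparison of the forms of the two graphs *)

Section Joining.
Variables (R : realType) (G : metric_graph R) (m : nat) (v1 v2 : vertex G).
Local Notation C := R[i].
Implicit Types z : 'rV[C]_(nnodes (edge G) m).

Lemma sum_join (F : join_vertex v1 v2 -> C) (F' : vertex G -> C) :
  (forall t, F (Some t) = F' (val t)) ->
  \sum_w F w = F None + \sum_(v | (v != v1) && (v != v2)) F' v.
Proof.
move=> FF'; rewrite (bigD1 None)//=; congr (_ + _).
rewrite (reindex_omap Some id) => [|[t|]//].
rewrite (eq_bigl predT) => [|t]; last by rewrite /= eqxx.
rewrite (eq_bigr (fun t => F' (val t))) => [|t _]; last exact: FF'.
by rewrite -(big_sub [pred v | (v != v1) && (v != v2)]).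
Qed.

Lemma bdry_const (G' : metric_graph R) (z : 'rV[C]_(nnodes (edge G') m)) (v : vertex G') zeta :
  (forall j, bdry z v j 0 = zeta) <->
  (forall e, e \in outE G' v -> node z e 0 = zeta) /\
  (forall e, e \in Defs.inE G' v -> node z e m.+1 = zeta).
Proof.
split=> [H|[Ho Hi] j]; last first.
  rewrite !mxE; case: fintype.splitP => i _; rewrite !mxE /ends.
    by rewrite eqxx Ho ?enum_valP.
  by rewrite (negbTE (len_neq0 _)) Hi ?enum_valP.
split=> e ev.
  have := H (lshift _ (enum_rank_in ev e)); rewrite /bdry /bdry_val col_mxEu mxE /ends eqxx.
  by rewrite enum_rankK_in.
have := H (rshift _ (enum_rank_in ev e)); rewrite /bdry /bdry_val col_mxEd mxE /ends.
by rewrite (negbTE (len_neq0 _)) enum_rankK_in.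
Qed.

Variables (c : conditions G) (c0 : vertex_condition R (deg (None : vertex (join v1 v2)))).
Variables (alpha1 alpha2 : R).
Hypothesis v12 : v1 != v2.
Hypotheses (deg1 : (0 < deg v1)%N) (deg2 : (0 < deg v2)%N).
Hypotheses (hc1 : delta_type alpha1 (c v1)) (hc2 : delta_type alpha2 (c v2)).
Hypothesis hc0 : delta_type (alpha1 + alpha2) c0.

Lemma join_form (pp : edge G -> nat -> R * R * R) z :
  @form_domain R (join v1 v2) m (join_conditions c c0) z ->
  form_domain c z /\
  @graph_form R (join v1 v2) m (join_conditions c c0) pp z z = graph_form c pp z z.
Proof.
move=> Sz.
have [zeta z0 E0] := vc_delta_form hc0 (Sz None).
have [zo zi] := (bdry_const _ _ _).1 z0.
have z1 : forall j, bdry z v1 j 0 = zeta.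
  by apply/bdry_const; split=> e ev; [apply: zo|apply: zi]; rewrite /= finset.inE ev.
have z2 : forall j, bdry z v2 j 0 = zeta.
  by apply/bdry_const; split=> e ev; [apply: zo|apply: zi]; rewrite /= finset.inE ev orbT.
have S1 := vc_delta_const hc1 deg1 z1; have S2 := vc_delta_const hc2 deg2 z2.
(* [vc_delta_form] produces its own constant xi; an edge end at v identifies it with zeta. *)
have value v al (zv : forall j, bdry z v j 0 = zeta) : (0 < deg v)%N -> delta_type al (c v) ->
    vcD (c v) *m bdry z v = 0 -> vc_form (c v) (bdry z v) (bdry z v) = al%:C%C * `|zeta| ^+ 2.
  move=> dv hv Sv; have [xi zxi ->] := vc_delta_form hv Sv.
  by rewrite -(zxi (Ordinal dv)) zv.
split.
  move=> v; have [hv|] := boolP ((v != v1) && (v != v2)).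
    (* At the other vertices the boundary vectors and conditions of both graphs agree by
       computation. *)
    exact: (Sz (Some (exist _ v hv))).
  by rewrite negb_and !negbK => /orP[] /eqP ->.
rewrite /graph_form; congr (_ + _).
rewrite (@sum_join _ (fun v => vc_form (c v) (bdry z v) (bdry z v))) => [|t]; last by [].
rewrite [RHS](bigD1 v1)//= [\sum_(v | v != v1) _](bigD1 v2) 1?eq_sym//= addrA; congr (_ + _).
rewrite (value v1 alpha1)// (value v2 alpha2)// -mulrDl -rmorphD.
exact: E0.
Qed.

End Joining.

(* [c0] is the vertex condition at the new vertex v0 of the joined graph. *)
Theorem theorem4p1 (R : realType) (G : metric_graph R)
  (q : edge G -> R -> R) (c : conditions G)
  (v1 v2 : vertex G) (alpha1 alpha2 : R)
  (c0 : vertex_condition R (deg (None : vertex (join v1 v2))))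
  (lam lamj : nat -> R) :
  essentially_bounded q ->
  v1 != v2 ->
  (0 < deg v1)%N -> (0 < deg v2)%N ->
  delta_type alpha1 (c v1) ->
  delta_type alpha2 (c v2) ->
  delta_type (alpha1 + alpha2) c0 ->
  eigenvalues (schrodinger q c) lam ->
  eigenvalues
    (@schrodinger R (join v1 v2) q (join_conditions c c0)) lamj ->
  forall k : nat, lam k <= lamj k.
Proof.
move=> /bounded_representative[q' [B [qq' bq qB]]] v12 deg1 deg2 hc1 hc2 hc0.
rewrite (schrodinger_ae_eq c qq') (@schrodinger_ae_eq R (join v1 v2) q q' _ qq').
move=> [lam_mono lam_mult] [lamj_mono lamj_mult] k.
(* Under the contrary assumption every eigenvalue of H up to [lamj k] has all its indices below
   k. *)
rewrite leNgt; apply/negP => lt_k.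
pose H := \sum_e len G e.
pose kap := vc_size c.
(* [a1] bounds all [lamj i] from below and is so low that the Riccati bound holds with C0 = [kap] on
   every edge. The form of H is thus nonnegative at [a1] and, by strict decrease, positive at a. *)
pose a1 := Num.min (lamj 0%N) (- (B + kap ^+ 2 + \sum_e 2 * kap / len G e)).
pose a := a1 - 1; pose b := lamj k.
have kap0 : 0 <= kap := vc_size_ge0 c.
have H0 : 0 <= H by apply: sumr_ge0 => e _; exact/ltW/len_gt0.
have a1lamj i : a1 <= lamj i by apply: (@le_trans _ _ (lamj 0%N)); rewrite ?lamj_mono// ge_min lexx.
have a1b : a1 <= b := a1lamj k.
have aa1 : a < a1 by rewrite ltrBlDr ltrDl.
have ab : a <= b by rewrite (le_trans _ a1b)// ltW.
pose K := `|B| + `|a| + `|b|.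
have qK (e : edge G) x nu : a <= nu -> nu <= b -> `|q' e x - nu| <= K.
  move=> anu nub; rewrite (le_trans (ler_normB _ _))// /K -addrA lerD//.
    by rewrite (le_trans (qB e x))// ler_norm.
  rewrite ler_norml opprD; have := ler_norm (- a); have := ler_norm b; have := normr_ge0 a.
  have := normr_ge0 b; rewrite normrN => ? ? ? ?; apply/andP; split; lra.
have K0 : 0 <= K by rewrite !addr_ge0.
(* Then 34 K H^2 < m + 1 <= (m + 1)^2, and each mesh is at most H / (m + 1). *)
pose m := Num.truncn (34 * K * H ^+ 2).
have small (e : edge G) : 34 * (K * mesh m e ^+ 2) <= 1.
  have leH : len G e <= H.
    by rewrite /H (bigD1 e)//= lerDl sumr_ge0// => e' _; exact/ltW/len_gt0.
  have l0 := ltW (len_gt0 e).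
  have n1 : 1 <= m.+1%:R :> R by rewrite ler1n.
  have n0 : 0 < m.+1%:R :> R by rewrite ltr0n.
  have -> : 34 * (K * mesh m e ^+ 2) = 34 * K * len G e ^+ 2 / m.+1%:R ^+ 2.
    by rewrite /mesh; field; rewrite gt_eqF.
  rewrite ler_pdivrMr ?exprn_gt0// mul1r.
  apply: (@le_trans _ _ (34 * K * H ^+ 2)).
    by rewrite ler_wpM2l ?mulr_ge0// lerXn2r// nnegrE.
  apply: (le_trans (ltW (truncnS_gt _))); rewrite -/m expr2 ler_peMr// ltW//.
have [p pE] := dtn_exists bq qK small.
have pEj : @is_dtn R (join v1 v2) q' a b m p := pE.
pose S z := @form_domain R (join v1 v2) m (join_conditions c c0) z.
have [|||||r [T [kr Tf TS]]] := @form_index_lower R (nnodes (edge G) m) S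
    (fun nu => @graph_form R (join v1 v2) m (join_conditions c c0) (p nu)) lamj k.
- exact: (@form_domain_subspace R (join v1 v2)).
- by move=> nu; exact: (@graph_form_hermitian R (join v1 v2)).
- exact: lamj_mono.
- move=> i j z ik jk ij _ z0.
  apply: (@graph_form_strict R (join v1 v2) q' a b K m bq qK small p pEj) => //.
    exact: le_trans (ltW aa1) (a1lamj i).
  exact: lamj_mono.
- move=> i ik; have [s [us sE ms]] := lamj_mult (lamj i).
  exists s; split=> //.
  apply: (@eigenspace_nodes R (join v1 v2) q' a b K m bq qK small p pEj) ms.
    exact: le_trans (ltW aa1) (a1lamj i).
  exact: lamj_mono.
(* Only the first k eigenvalues of H enter: [cnt nu] is the multiplicity of nu among them, L the
   list of their distinct values. *)
pose cnt nu := count (fun i => lam i == nu) (iota 0 k).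
pose L := undup [seq lam i | i <- iota 0 k].
have : (r <= \sum_(nu <- L) cnt nu)%N.
  apply: (@form_spectral_flow R _ (form_domain c) (fun nu => graph_form c (p nu)) a b
    (4 * H) L cnt) Tf _ => //.
  - by rewrite mulr_ge0.
  - exact: form_domain_subspace.
  - by move=> nu; exact: graph_form_hermitian.
  - move=> nu nu' z anu nub anu' nub'.
    exact: (graph_form_lipschitz bq qK small pE).
  - move=> z _ z0.
    apply: le_lt_trans (graph_form_strict bq qK small pE c (lexx a) aa1 a1b z0).
    apply: graph_form_ge0; apply: (edge_energy_sum_riccati bq qK small pE z (ltW aa1) a1b) => //.
    move=> e x; rewrite -/kap.
    have : a1 <= - (B + kap ^+ 2 + \sum_e 2 * kap / len G e) by rewrite ge_min lexx orbT.
    have : 2 * kap / len G e <= \sum_e 2 * kap / len G e.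
      rewrite [leRHS](bigD1 e)//= lerDl sumr_ge0// => e' _.
      by rewrite divr_ge0 ?mulr_ge0// ltW// len_gt0.
    have := qB e x; rewrite ler_norml => /andP[+ _]; lra.
  - move=> nu r' T' anu nub T'f T'S T'0.
    have [s [us sE ms]] := lam_mult nu.
    (* Since nu <= b < [lam k], each index i with [lam i = nu] is below k, so [cnt nu] counts the
       full multiplicity. *)
    apply: leq_trans (kernel_dim_le bq qK small pE anu nub ms T'f T'S T'0) _.
    rewrite /cnt -size_filter; apply: uniq_leq_size => // i /sE lami.
    rewrite mem_filter lami eqxx mem_iota /= add0n ltnNge; apply/negP => ki.
    by have := lam_mono _ _ ki; rewrite lami leNgt (le_lt_trans nub).
  - exact: undup_uniq.
  - move=> nu _ _; rewrite -lt0n -has_count => /hasP[i ik /eqP <-].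
    by rewrite mem_undup map_f.
  - move=> u; have [Su fu] := TS u; have [Su' fE] := join_form v12 deg1 deg2 hc1 hc2 hc0 (p b) Su.
    by split=> //; rewrite -fE.
move=> /leq_trans/(_ _)/(leq_trans kr); suff sumk : (\sum_(nu <- L) cnt nu <= k)%N.
  by move=> /(_ k sumk); rewrite ltnn.
(* Double counting: an index i < k contributes to at most one member of the duplicate-free list
   L. *)
rewrite /cnt; under eq_bigr => nu _ do rewrite -sum1_count big_mkcond.
rewrite exchange_big /= -[leqRHS](size_iota 0) -[leqRHS]sum1_size.
rewrite big_seq [leqRHS]big_seq; apply: leq_sum => i _.
rewrite -big_mkcond sum1_count.
have := count_uniq_mem (lam i) (undup_uniq [seq lam i | i <- iota 0 k]).
rewrite (@eq_count _ _ (pred1 (lam i))) => [->|nu]; first exact: leq_b1.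
by rewrite /= eq_sym.
Qed.
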